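(* Let $d\ge 1$ and $0<t<s<1$. Then the weak greedy algorithms for the multivariate Haar system defined in the context (the first algorithm, and the second algorithm obtained by modifying step 3) converge, i.e. $f=\lim_{m\to\infty}G_m^{s,t}(f)$ in $L_1[0,1]^d$ for every $f\in L_1[0,1]^d$. Moreover, the greedy approximants are uniformly bounded: for all $f\in L_1[0,1]^d$ and all $m\ge 1$, $$\|G_m^{s,t}(f)\|\le C(d,s,t)\,\|f\|,$$ where $C(d,s,t)$ is a constant depending only on $d,s,t$.
   Context: $L_1[0,1]^d$ is the space $L_1([0,1]^d)$ with Lebesgue measure $\mu$ and norm $\|f\|=\int|f|$. Haar system. For $n\ge 0$ let $\mathcal D_n$ be the set of dyadic intervals $[k2^{-n},(k+1)2^{-n})$, $0\le k<2^n$; let $\mathcal D_n^d=\mathcal D_n\times\cdots\times\mathcal D_n$ ($d$ factors) be the set of dyadic cubes of side length $2^{-n}$, and $\mathcal D^d=\bigcup_{n\ge 0}\mathcal D_n^d$. For $a<b$ put $r^{(0)}_{[a,b)}=\frac{\chi_{[a,b)}}{b-a}$ and $r^{(1)}_{[a,b)}=\frac{\chi_{[a,(a+b)/2)}-\chi_{[(a+b)/2,b)}}{b-a}$, where $\chi$ denotes the characteristic function. For $I=I_1\times\cdots\times I_d\in\mathcal D^d$ and $1\le j\le 2^d-1$ with binary representation $j=\sum_{k=1}^d\epsilon_k2^{d-k}$, $\epsilon_k\in\{0,1\}$, put $h_I^{(j)}(x)=\prod_{k=1}^d r_{I_k}^{(\epsilon_k)}(x_k)$. The Haar system is the set of all $h_I^{(j)}$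 together with $\chi_{[0,1)^d}$. The Haar coefficients are $c_I^{(i)}(f)=\mu(I)\int_I f h_I^{(i)}$. Order. For intervals, $[a,b)\prec[c,d)$ if $b-a>d-c$, or $b-a=d-c$ and $a<c$. For cubes $I=I_1\times\cdots\times I_d$ and $J=J_1\times\cdots\times J_d$ in $\mathcal D^d$, $I\prec J$ if for some $k$ one has $I_1=J_1,\dots,I_{k-1}=J_{k-1}$ and $I_k\prec J_k$. First algorithm ($0<t\le s\le 1$). For $f\in L_1[0,1]^d$ put $G_0^{s,t}=G_0^{s,t}(f)=0$ and $R_0^{s,t}=R_0^{s,t}(f)=f$. For each $m\ge 1$ define $G_m^{s,t}(f)$ and $R_m^{s,t}(f)$ inductively as follows. 1) Find the first cube in the order $\prec$, denoted $\Delta_m$, and then the smallest $j_m$ with $1\le j_m\le 2^d-1$, such that $|c_{\Delta_m}^{(j_m)}(R_{m-1}^{s,t})|=\max|c_I^{(i)}(R_{m-1}^{s,t})|$, the maximum being over $I\in\mathcal D^d$ and $1\le i\le 2^d-1$. 2) Let $\tilde\Delta_m\supseteq\Delta_m$ be the largest cube containing $\Delta_m$ such that for every $I\in\mathcal D^d$ with $\Delta_m\subseteq I\subseteq\tilde\Delta_m$ there exists $1\le i\le 2^d-1$ with $|c_I^{(i)}(R_{m-1}^{s,t})|\ge s\,|c_{\Delta_m}^{(j_m)}(R_{m-1}^{s,t})|$. 3) Find $1\le i_m\le 2^d-1$ for which $|c_{\tilde\Delta_m}^{(i_m)}(R_{m-1}^{s,t})|$ is the smallest value to satisfy $|c_{\tilde\Delta_m}^{(i_m)}(R_{m-1}^{s,t})|\ge\frac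 ts\max_{1\le j\le 2^d-1}|c_{\tilde\Delta_m}^{(j)}(R_{m-1}^{s,t})|$. 4) Put $G_m^{s,t}(f)=G_{m-1}^{s,t}+c_{\tilde\Delta_m}^{(i_m)}(f)\,h_{\tilde\Delta_m}^{(i_m)}$ and $R_m^{s,t}=f-G_m^{s,t}$. Second algorithm. The same, except that the selection condition in step 3) is replaced by $|c_{\tilde\Delta_m}^{(i_m)}(R_{m-1}^{s,t})|\ge t\,|c_{\Delta_m}^{(j_m)}(R_{m-1}^{s,t})|$.
   Formalization: As the constant Haar function is never selected (f=1 gives G_m=0), the limit proved is f = ∫f + lim G_m(f); and the algorithm stops (G_m=G_{m-1}) once all Haar coefficients of the remainder vanish, since step 4 would otherwise re-add a term already present (f=h_{[0,1)}). *)

(* Defs.v *)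
From HB Require Import structures.
From mathcomp Require Import all_boot all_order all_algebra.
From mathcomp Require Import all_classical all_reals all_analysis.

Set Implicit Arguments.
Unset Strict Implicit.
Unset Printing Implicit Defensive.

Import Order.TTheory GRing.Theory Num.Theory.
Import numFieldNormedType.Exports.

Local Open Scope classical_set_scope.
Local Open Scope ring_scope.

(** Points of [R^d] are tuples, with the product (Borel) sigma-algebra that the
    library puts on [d.-tuple _]. *)
Notation Rspace R d := (d.-tuple (measurableTypeR R)).

Section lebesgue_cons.
Context (R : realType) (n : nat).
Variable m : {sigma_finite_measure set (Rspace R n) -> \bar R}.

Definition pcons (p : measurableTypeR R * Rspace R n) : Rspace R n.+1 :=
  [tuple of p.1 :: p.2].

Lemma measurable_pcons : measurable_fun [set: _] pcons.
Proof. exact: measurable_cons. Qed.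

(** The image of the product of one-dimensional Lebesgue measure and [m] under
    [R * R^n ~ R^(n+1)]. *)
Definition lebesgue_cons : set (Rspace R n.+1) -> \bar R :=
  pushforward (@lebesgue_measure R \x m)%E pcons.

Let lebesgue_cons0 : lebesgue_cons set0 = 0%E.
Proof. by rewrite /lebesgue_cons /pushforward preimage_set0 measure0. Qed.

Let lebesgue_cons_ge0 A : (0 <= lebesgue_cons A)%E.
Proof. by rewrite /lebesgue_cons /pushforward; exact: measure_ge0. Qed.

Let lebesgue_cons_sigma_additive : semi_sigma_additive lebesgue_cons.
Proof.
move=> F mF tF mUF; rewrite /lebesgue_cons /pushforward preimage_bigcup.
apply: measure_semi_sigma_additive.
- by move=> i; rewrite -[X in measurable X]setTI; exact: measurable_pcons.
- apply/trivIsetP => /= i j _ _ ij; rewrite -preimage_setI.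
  by move/trivIsetP : tF => /(_ _ _ _ _ ij) ->//; rewrite preimage_set0.
- rewrite -preimage_bigcup -[X in measurable X]setTI.
  exact: measurable_pcons.
Qed.

HB.instance Definition _ := isMeasure.Build _ _ _ lebesgue_cons
  lebesgue_cons0 lebesgue_cons_ge0 lebesgue_cons_sigma_additive.

Let lebesgue_cons_sigma_finite : sigma_finite setT lebesgue_cons.
Proof.
have /sigma_finiteP[F [FT ndF mF]] := sigma_finiteT (@lebesgue_measure R).
have /sigma_finiteP[G [GT ndG mG]] := sigma_finiteT m.
pose uncons (x : Rspace R n.+1) : measurableTypeR R * Rspace R n :=
  (tnth x ord0, [tuple of behead x]).
have muncons : measurable_fun [set: _] uncons.
  apply: measurable_fun_pair; first exact: measurable_tnth.
  exact: measurable_behead.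
exists (fun i => uncons @^-1` (F i `*` G i)).
  apply/esym; rewrite -subTset => x _.
  have [i _ Fi] : (\bigcup_i F i) (tnth x ord0) by rewrite -FT.
  have [j _ Gj] : (\bigcup_i G i) [tuple of behead x] by rewrite -GT.
  exists (maxn i j) => //; split => /=.
    exact: (subsetPset _ _ (ndF _ _ (leq_maxl i j))).
  exact: (subsetPset _ _ (ndG _ _ (leq_maxr i j))).
move=> i; have [mFi Fioo] := mF i; have [mGi Gioo] := mG i.
have mFG : measurable (F i `*` G i) by exact: measurableX.
split; first by rewrite -[X in measurable X]setTI; exact: muncons.
rewrite /lebesgue_cons /pushforward -comp_preimage.
have -> : uncons \o pcons = id.
  apply/funext => -[a t]; rewrite /uncons /pcons /=; congr pair.
  exact/val_inj.
rewrite preimage_id product_measure1E//.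
by rewrite lte_mul_pinfty// ge0_fin_numE.
Qed.

HB.instance Definition _ := Measure_isSigmaFinite.Build _ _ _ lebesgue_cons
  lebesgue_cons_sigma_finite.

End lebesgue_cons.

(** Lebesgue measure on [R^d]. *)
Fixpoint lebesgue_tuple (R : realType) (d : nat) :
    {sigma_finite_measure set (Rspace R d) -> \bar R} :=
  match d with
  | 0 => \d_([tuple] : Rspace R 0)
  | n.+1 => lebesgue_cons (lebesgue_tuple R n)
  end.

Lemma lebesgue_tuple_box (R : realType) (n : nat)
    (A : 'I_n -> set (measurableTypeR R)) :
  (forall i, measurable (A i)) ->
  lebesgue_tuple R n [set x | forall i, A i (tnth x i)] =
  (\prod_(i < n) lebesgue_measure (A i))%E.
Proof.
elim: n A => [|n IH] A mA.
  rewrite big_ord0 /= diracE mem_set// => -[]//.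
rewrite big_ord_recl /= /lebesgue_cons /pushforward.
rewrite -IH// -product_measure1E//.
  congr (product_measure1 _ _ _); apply/seteqP; split => -[a x] /=.
    move=> h; split => [|i]; first by have := h ord0; rewrite tnth0.
    by have := h (lift ord0 i); rewrite tnthS.
  move=> [h0 h] i; case: (unliftP ord0 i) => [j ->|->]; last by rewrite tnth0.
  by rewrite tnthS; exact: h.
rewrite (_ : [set _ | _] = \bigcap_(i in [set: 'I_n])
    ((@tnth n _ ^~ i) @^-1` A (lift ord0 i))).
  apply: fin_bigcap_measurable => // i _.
  by rewrite -[X in measurable X]setTI; exact: measurable_tnth.
by apply/seteqP; split => x h i; [move=> _; exact: (h i)|exact: (h i I)].
Qed.

Section haar.
Context (R : realType) (d : nat).

Local Notation mu := (lebesgue_tuple R d).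

Definition unit_cube : set (Rspace R d) :=
  [set x | forall k : 'I_d, 0 <= tnth x k <= 1].

Definition L1 (f : Rspace R d -> R) : Prop :=
  mu.-integrable unit_cube (EFin \o f).

Definition L1norm (f : Rspace R d -> R) : \bar R :=
  (\int[mu]_(x in unit_cube) `|(f x)%:E|)%E.

(** The dyadic cube of side [2^-level] whose [k]-th side is
    [[pos k * 2^-level, (pos k + 1) * 2^-level)]. *)
Record dcube := DCube { level : nat; pos : {ffun 'I_d -> 'I_(2 ^ level)} }.

Definition lo (I : dcube) (k : 'I_d) : R := (pos I k)%:R / 2 ^+ level I.
Definition hi (I : dcube) (k : 'I_d) : R := (pos I k).+1%:R / 2 ^+ level I.

Definition cube_set (I : dcube) : set (Rspace R d) :=
  [set x | forall k, lo I k <= tnth x k < hi I k].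

Definition interval_prec (a b a' b' : R) : Prop :=
  b' - a' < b - a \/ (b - a = b' - a' /\ a < a').

Definition cube_prec (I J : dcube) : Prop :=
  exists k : 'I_d,
    (forall l : 'I_d, (l < k)%N -> lo I l = lo J l /\ hi I l = hi J l) /\
    interval_prec (lo I k) (hi I k) (lo J k) (hi J k).

Definition rfun (eps : bool) (a b x : R) : R :=
  if eps then
    (\1_(`[a, ((a + b) / 2)[%classic : set R) x
     - \1_(`[((a + b) / 2), b[%classic : set R) x) / (b - a)
  else \1_(`[a, b[%classic : set R) x / (b - a).

Definition haar_index (j : nat) : Prop := (1 <= j <= 2 ^ d - 1)%N.

(** Binary digits of [j], most significant first. Coordinates are numbered from
    0, so that [digit j k] is the coefficient of [2 ^ (d - (k + 1))] in [j]. *)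
Definition digit (j : nat) (k : 'I_d) : bool := odd (j %/ 2 ^ (d - k.+1)).

Definition haar (I : dcube) (j : nat) (x : Rspace R d) : R :=
  \prod_(k < d) rfun (digit j k) (lo I k) (hi I k) (tnth x k).

Definition coef (f : Rspace R d -> R) (I : dcube) (j : nat) : R :=
  fine (mu (cube_set I)) * \int[mu]_(x in cube_set I) (f x * haar I j x).

(** The coefficient of [f] on the constant Haar function. The algorithms only
    ever select functions [haar I j] with [1 <= j], so their approximants cannot
    produce this term: it has to be added to [G_m] to recover [f] (for [f]
    constant, every [G_m] is 0). *)
Definition mean (f : Rspace R d -> R) : R := \int[mu]_(x in unit_cube) f x.

Definition is_peak (g : Rspace R d -> R) (I : dcube) (j : nat) : Prop :=
  haar_index j /\
  forall (J : dcube) (i : nat), haar_index i ->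
    `|coef g J i| <= `|coef g I j|.

Definition step1 (g : Rspace R d -> R) (D : dcube) (j : nat) : Prop :=
  [/\ is_peak g D j,
      forall I i, is_peak g I i -> I = D \/ cube_prec D I &
      forall i, is_peak g D i -> (j <= i)%N].

Definition chain_ok (s : R) (g : Rspace R d -> R) (D : dcube) (j : nat)
    (E : dcube) : Prop :=
  cube_set D `<=` cube_set E /\
  forall I : dcube, cube_set D `<=` cube_set I -> cube_set I `<=` cube_set E ->
    exists2 i, haar_index i & s * `|coef g D j| <= `|coef g I i|.

Definition step2 (s : R) (g : Rspace R d -> R) (D : dcube) (j : nat)
    (E : dcube) : Prop :=
  chain_ok s g D j E /\
  forall E', chain_ok s g D j E' -> cube_set E' `<=` cube_set E.

(** The two algorithms differ only in the threshold used in step 3. *)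
Variant algorithm := FirstAlg | SecondAlg.

Definition threshold (a : algorithm) (s t : R) (g : Rspace R d -> R)
    (D : dcube) (j : nat) (E : dcube) : R :=
  match a with
  | FirstAlg => t / s * \big[Num.max/0]_(1 <= i < 2 ^ d) `|coef g E i|
  | SecondAlg => t * `|coef g D j|
  end.

Definition step3 (tau : R) (g : Rspace R d -> R) (E : dcube) (i : nat) : Prop :=
  [/\ haar_index i, tau <= `|coef g E i| &
      forall i', haar_index i' -> tau <= `|coef g E i'| ->
        `|coef g E i| <= `|coef g E i'|].

(** One step, from [G = G_(m-1)] to [G' = G_m]. When all the coefficients of the
    remainder vanish the algorithm stops: since step 4 uses the coefficient of
    [f], a further step would add again a term that [G] already contains. The
    tie-breaking in step 3 is left free. *)
Definition greedy_step (a : algorithm) (s t : R) (f G G' : Rspace R d -> R) :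
    Prop :=
  let g : Rspace R d -> R := fun x => f x - G x in
  ((forall I i, haar_index i -> coef g I i = 0) /\ G' = G) \/
  ((exists I i, haar_index i /\ coef g I i != 0) /\
   exists (D : dcube) (j : nat) (E : dcube) (i : nat),
     [/\ step1 g D j, step2 s g D j E, step3 (threshold a s t g D j E) g E i &
         G' = fun x => G x + coef f E i * haar E i x]).

(** [G] is the sequence of approximants of a run of the algorithm on [f]. *)
Definition greedy (a : algorithm) (s t : R) (f : Rspace R d -> R)
    (G : nat -> Rspace R d -> R) : Prop :=
  G 0 = (fun=> 0) /\ forall m, greedy_step a s t f (G m) (G m.+1).

End haar.

(* Main.v *)
Require Import Defs.
From mathcomp Require Import all_boot all_order all_algebra.
From mathcomp Require Import all_classical all_reals all_analysis.
From mathcomp Require Import measurable_realfun ring lra.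

Set Implicit Arguments.
Unset Strict Implicit.
Unset Printing Implicit Defensive.

Import Order.TTheory GRing.Theory Num.Theory.
Import numFieldNormedType.Exports.

Local Open Scope ring_scope.

(** Both algorithms produce partial sums of the Haar series of [f] over sets of
    selected coefficients, and the proof bounds such partial sums by combinatorics
    on the tree of dyadic cubes.

    Write [nu Q] for the integral of [|f|] over the cube [Q], and [a Q] for the
    integral of [f]. A Haar coefficient of [Q] is a sum of [a] over the children
    of [Q] with signs, so its absolute value differs from [|a P|] by at most
    [nu Q - nu P] for every cube [P] strictly inside [Q]. Therefore two
    coefficients of one cube, or of two nested cubes, that differ by [k] reveal
    mass of order [k] located between these cubes. On the other hand,
    at most [2 * nu root / k] cubes can be separated from each other by mass [k]
    ([separated_count]).

    Let [M] be the size of the largest coefficient of the last peak. Unselected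
    coefficients are at most [M], selected ones are at least [t * M]. The partial
    sum over all the cubes that contain a selected one is a difference of
    conditional expectations, of norm at most twice that of [f]. It remains to
    subtract the unselected terms. Call a cube costly when it keeps mass of order
    [M] outside each of its children: there are at most a constant times
    [nu root / M] costly cubes, and each contributes at most [(2 ^ d - 1) * M].
    The other cubes with unselected terms have no selected coefficient and only one
    child that contains selected cubes. They form chains, along which the series
    telescopes up to the two ends, so only the number of chains matters. A chain
    ends at a costly cube or just above a selected cube; in the second case the
    algorithm climbed from a peak up to this selected cube and stopped, which means
    that the coefficients of the chain are smaller than [s] times the peak, and
    there is mass of order [M] between the end of the chain and the peak
    ([tame_bound]).

    This argument needs two facts about the selected set ([tame]). A partly
    selected cube has coefficients of clearly different sizes, because the smallest
    admissible coefficient is taken first; and the peaks that are responsible for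
    different chains do not interfere. Both hold as soon as the algorithm has
    exhausted the cube on which it is working, and until then it keeps returning
    to this cube. So every approximant differs from a tame sum by the terms of one
    cube ([run_near_settled]), and the bound follows ([selection_bound]).

    For the convergence, let [E_n f] be the conditional expectation on the cubes of
    level [n], which tends to [f] ([dyadic_approx_L1]). Every nonzero coefficient
    is selected eventually. Once this has happened for all the levels below [n], the
    remainder is [f - E_n f] minus a partial sum of the Haar series of
    [f - E_n f]. Tameness survives when the levels below [n] are discarded
    ([tame_tail]), so the remainder is bounded by a constant times the norm of
    [f - E_n f] ([greedy_cvg_comb]). *)

(** * Dyadic cubes as words, and counting separated cubes *)

Section Words.
Context (B : finType).
Implicit Types (Q P F G : seq B) (b : B).

Lemma suffix_consr b Q P : suffix Q (b :: P) = (Q == b :: P) || suffix Q P.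
Proof.
apply/idP/orP => [/suffixP[[|x s] /= E]|[/eqP->|/suffixP[s ->]]].
- by left; rewrite E.
- by right; case: E => _ ->; exact: suffix_suffix.
- exact: suffix_refl.
- by rewrite -cat_cons suffix_suffix.
Qed.

Lemma suffix_consl b Q P : suffix (b :: Q) P -> suffix Q P.
Proof. by apply: suffix_trans; exact: suffix_cons. Qed.

Lemma suffix_child Q P : suffix Q P -> Q != P -> exists b, suffix (b :: Q) P.
Proof.
move=> /suffixP[s ->]; case/lastP: s => [|s b]; first by rewrite eqxx.
by move=> _; exists b; rewrite cat_rcons suffix_suffix.
Qed.

Lemma suffix_child_inj b b' Q P :
  suffix (b :: Q) P -> suffix (b' :: Q) P -> b = b'.
Proof.
move=> /suffixP[s ->] /suffixP[s' E].
have /eqP : rcons s b ++ Q = rcons s' b' ++ Q by rewrite !cat_rcons.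
by rewrite eqseq_cat; [rewrite eqseq_rcons => /andP[/andP[_ /eqP]]|
  have := congr1 size E; rewrite !size_cat !size_rcons /= => /eqP;
  rewrite eqn_add2r => /eqP ->].
Qed.

Lemma suffix_anti Q P : suffix Q P -> suffix P Q -> Q = P.
Proof.
move=> /suffixP[s ->] /size_suffix; rewrite size_cat -{2}[size Q]add0n leq_add2r.
by rewrite leqn0 size_eq0 => /eqP ->.
Qed.

Lemma suffix_consN b Q : suffix (b :: Q) Q = false.
Proof. by apply/negP => /size_suffix /=; rewrite ltnn. Qed.

Lemma suffix_total Q Q' P :
  suffix Q P -> suffix Q' P -> suffix Q Q' || suffix Q' Q.
Proof.
elim: P => [|b P IH]; first by rewrite !suffixs0 => /eqP-> /eqP->.
rewrite !suffix_consr => /orP[/eqP->|QP] /orP[/eqP->|QP'].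
- by rewrite suffix_refl.
- by rewrite [X in _ || X]suffix_consr QP' !orbT.
- by rewrite suffix_consr QP orbT.
- exact: IH.
Qed.

(** The inductive step of every count over the tree: a cube inside [Q] is [Q]
    itself or lies in exactly one child. *)
Lemma suffix_split Q P :
  (suffix Q P = (P == Q) + \sum_b suffix (b :: Q) P :> nat)%N.
Proof.
have [QP|QP] := boolP (suffix Q P); last first.
  rewrite big1 => [|b _].
    by case: eqP QP => // ->; rewrite suffix_refl.
  by apply/eqP; rewrite eqb0; apply: contra QP; exact: suffix_consl.
have [->|PQ] := eqVneq P Q.
  by rewrite big1 // => b _; rewrite suffix_consN.
have [|b bQ] := suffix_child QP; first by rewrite eq_sym.
rewrite (bigD1 b) //= bQ big1 // => b' nb; apply/eqP; rewrite eqb0.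
by apply: contra nb => /suffix_child_inj/(_ bQ) ->.
Qed.

End Words.

Section Separated.
Context (B : finType) (R : realFieldType) (nu : seq B -> R).
Hypothesis nu_ge0 : forall Q, 0 <= nu Q.
Hypothesis nu_add : forall Q, \sum_b nu (b :: Q) = nu Q.
Implicit Types (Q P F G : seq B) (b : B).

Lemma nu_child b Q : nu (b :: Q) <= nu Q.
Proof. by rewrite -(nu_add Q) (bigD1 b) //= lerDl sumr_ge0. Qed.

Lemma nu_suffix Q P : suffix Q P -> nu P <= nu Q.
Proof.
move=> /suffixP[s ->]; by elim: s => //= b s; apply: le_trans; exact: nu_child.
Qed.

Lemma nu_disjoint F G D :
  suffix F G -> suffix F D -> ~~ suffix G D -> ~~ suffix D G ->
  nu D <= nu F - nu G.
Proof.
move=> /suffixP[s ->] ; elim/last_ind: s F => [|s b IH] F FD.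
  by rewrite cat0s FD.
rewrite cat_rcons => nGD nDG.
have [bFD|nbFD] := boolP (suffix (b :: F) D).
  by apply: (le_trans (IH _ bFD nGD nDG)); rewrite lerD2r nu_child.
have FneD : F != D.
  apply: contra nDG => /eqP <-; rewrite -cat_rcons; exact: suffix_suffix.
have [b' b'D] := suffix_child FD FneD.
have bb' : b' != b by apply: contraNneq nbFD => <-.
rewrite -(nu_add F) (bigD1 b) //= (bigD1 b') //=.
have h1 := nu_suffix b'D.
have h2 : nu (s ++ b :: F) <= nu (b :: F) by apply/nu_suffix/suffix_suffix.
have h3 : 0 <= \sum_(i | (i != b) && (i != b')) nu (i :: F) by exact: sumr_ge0.
lra.
Qed.

Section Count.
Variables (k : R) (S : seq (seq B)).
Hypothesis k_gt0 : 0 < k.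
Hypothesis uS : uniq S.
Hypothesis S_big : {in S, forall F, k <= nu F}.
Hypothesis S_sep : {in S &, forall F G, suffix F G -> F != G -> k <= nu F - nu G}.

Let cnt Q := count (suffix Q) S.

Let cnt_rec Q : cnt Q = ((Q \in S) + \sum_b cnt (b :: Q))%N.
Proof.
have cE (p : pred (seq B)) : (count p S = \sum_(P <- S) p P)%N.
  by rewrite -sum1_count big_mkcond; apply: eq_bigr => P _; case: (p P).
rewrite /cnt -(count_uniq_mem _ uS) !cE (eq_bigr _ (fun b _ => cE (suffix (b :: Q)))).
by rewrite exchange_big -big_split /=; apply: eq_bigr => P _; exact: suffix_split.
Qed.

Let cntP Q : reflect (exists2 F, F \in S & suffix Q F) (cnt Q != 0%N).
Proof. by rewrite -lt0n -has_count; exact: hasP. Qed.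

(* Below [Q], either the members of [S] have a largest element [G], to which a
   separating cube above may be compared, or two disjoint cubes contain members,
   and then there is one more [k] to spare. *)
Let good Q := [\/ cnt Q = 0%N,
  exists G, [/\ G \in S, suffix Q G, forall F, F \in S -> suffix Q F -> suffix G F
     & k * (cnt Q).+1%:R <= 2 * nu G]
  | k * (cnt Q).+2%:R <= 2 * nu Q].

Let good_weak Q : good Q -> cnt Q != 0%N -> k * (cnt Q).+1%:R <= 2 * nu Q.
Proof.
case=> [->|[G [_ QG _ h]] _|h _]; first by [].
  by apply: (le_trans h); rewrite ler_pM2l // nu_suffix.
by apply: le_trans h; rewrite ler_pM2l // ler_nat.
Qed.

Let good_step Q : (forall b, good (b :: Q)) -> good Q.
Proof.
move=> IH; pose A := [set b | cnt (b :: Q) != 0%N].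
have sumA : (\sum_b cnt (b :: Q) = \sum_(b in A) cnt (b :: Q))%N.
  by rewrite [RHS]big_mkcond /=; apply: eq_bigr => b _; rewrite inE; case: eqP.
have crec := cnt_rec Q; rewrite sumA in crec.
have belowA F : F \in S -> suffix Q F -> F != Q ->
    exists2 b, b \in A & suffix (b :: Q) F.
  move=> FS QF FQ; have [|b bF] := suffix_child QF; first by rewrite eq_sym.
  by exists b => //; rewrite inE; apply/cntP; exists F.
have [A0|[b bA]] := set_0Vmem A.
  rewrite A0 big_set0 addn0 in crec; have [QS|QS] := boolP (Q \in S).
    apply: Or32; exists Q; split => //; rewrite ?suffix_refl //.
    by rewrite crec QS mulrC ler_pM2l // S_big.
  by apply: Or31; rewrite crec (negbTE QS).
have [A1|] := eqVneq A [set b]; last first.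
  rewrite finset.eqEsubset finset.sub1set bA andbT => /fintype.subsetPn[b' b'A];
    rewrite inE => bb'.
  have hA : k * (\sum_(b in A) cnt (b :: Q)).+2%:R <= 2 * nu Q.
    apply: (@le_trans _ _ (\sum_(b in A) k * (cnt (b :: Q)).+1%:R)).
      rewrite -mulr_sumr ler_pM2l // -natr_sum ler_nat.
      under [leqRHS]eq_bigr do rewrite -addn1.
      rewrite big_split /= sum1_card -addn2 leq_add2l.
      by apply/card_gt1P; exists b', b; rewrite b'A bA bb'.
    rewrite -nu_add mulr_sumr [leRHS](bigID (mem A)) /=.
    rewrite -[leLHS]addr0 lerD //; last first.
      by apply: sumr_ge0 => i _; rewrite mulr_ge0.
    by apply: ler_sum => i iA; apply: good_weak => //; rewrite inE in iA.
  have [QS|QS] := boolP (Q \in S).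
    by apply: Or32; exists Q; split => //; rewrite ?suffix_refl // crec QS.
  by apply: Or33; rewrite crec (negbTE QS).
rewrite A1 big_set1 in crec; have bn0 : cnt (b :: Q) != 0%N by rewrite inE in bA.
have [QS|QS] := boolP (Q \in S).
  apply: Or32; exists Q; split => //; rewrite ?suffix_refl // crec QS add1n.
  have [/eqP|[G [GS bG _ h]]|h] := IH b; first by rewrite (negbTE bn0).
    have QG : suffix Q G by exact: suffix_consl bG.
    have QnG : Q != G by apply: contraTneq bG => <-; rewrite suffix_consN.
    have := S_sep QS GS QG QnG; move: h; rewrite -[X in k * X%:R]addn1 natrD.
    rewrite -[in X in _ -> _ -> X]addn2 natrD.
    by move: (cnt (b :: Q))%:R (nu Q) (nu G) => x y z; rewrite !mulrDr mulr1;
      move: (k * x) k_gt0 => w h0 h1 h2; lra.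
  by apply: (le_trans h); rewrite ler_pM2l // nu_child.
rewrite (negbTE QS) add0n in crec.
have [/eqP|[G [GS bG top h]]|h] := IH b; first by rewrite (negbTE bn0).
  apply: Or32; exists G; split => //; first exact: suffix_consl bG.
    move=> F FS QF; have [|b' ] := belowA _ FS QF.
      by apply: contraNneq QS => <-.
    by rewrite A1 inE => /eqP -> ; exact: top.
  by rewrite crec.
by apply: Or33; rewrite crec; apply: (le_trans h); rewrite ler_pM2l // nu_child.
Qed.

(** A member of [S] with at most one maximal member inside it owns mass [k] that
    no smaller member sees. The members that branch are fewer than the minimal
    ones, which gives the factor 2. *)
Lemma separated_count : k * (size S)%:R <= 2 * nu [::].
Proof.
pose n := \max_(F <- S) size F.
have allgood Q : good Q.
  have [m] := ubnP (n.+1 - size Q)%N; elim: m Q => // m IH Q Qm.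
  have [nQ|Qn] := ltnP n (size Q).
    apply: Or31; apply/eqP/negPn/negP => /cntP[F FS /size_suffix QF].
    have : (size F <= n)%N by apply: (@leq_bigmax_seq _ S xpredT (fun F => size F)).
    by rewrite leqNgt (leq_trans nQ QF).
  apply: good_step => b; apply: IH => /=; rewrite subSS.
  by move: Qm; rewrite subSn // ltnS.
have -> : size S = cnt [::] by rewrite /cnt -count_predT; apply: eq_count => F;
  rewrite suffix0s.
have [->|n0] := eqVneq (cnt [::]) 0%N; first by rewrite mulr0 mulr_ge0.
by apply: le_trans (good_weak (allgood _) n0); rewrite ler_pM2l // ler_nat.
Qed.
End Count.
End Separated.

(** * Norm bound for tame selections *)

(** [norm_le x r] is meant as: [x] is integrable and its norm is at most [r].
    Keeping both in one relation lets the combinatorial part ignore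
    measurability. *)
Record bound_rel (R : realFieldType) (W : lmodType R) (norm_le : W -> R -> Prop) :
    Prop := BoundRel {
  norm_le0 : norm_le 0 0;
  norm_leD : forall x y r q, norm_le x r -> norm_le y q -> norm_le (x + y) (r + q);
  norm_leZ : forall l x r, norm_le x r -> norm_le (l *: x) (`|l| * r);
  norm_le_weaken : forall x r q, norm_le x r -> r <= q -> norm_le x q }.

(** [e Q] stands for the average of the function on the cube [Q] times the
    indicator of [Q], and [h] for the Haar functions. The inequality [c_near] holds
    because each Haar function is constant, up to normalization [1] or [-1], on
    every cube strictly inside its support. *)
Record expansion (R : realFieldType) (B I : finType) (W : lmodType R)
    (norm_le : W -> R -> Prop) (nu a : seq B -> R) (c : seq B -> I -> R)
    (e : seq B -> W) (h : seq B -> I -> W) : Prop := Expansion {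
  nu_ge0 : forall Q, 0 <= nu Q;
  nu_add : forall Q, \sum_b nu (b :: Q) = nu Q;
  a_add : forall Q, \sum_b a (b :: Q) = a Q;
  abs_a : forall Q, `|a Q| <= nu Q;
  c_near : forall Q P i, suffix Q P -> Q != P ->
    `| `|c Q i| - `|a P| | <= nu Q - nu P;
  norm_le_e : forall Q, norm_le (e Q) `|a Q|;
  norm_le_h : forall Q i, norm_le (h Q i) 1;
  haar_sum : forall Q, \sum_i c Q i *: h Q i = \sum_b e (b :: Q) - e Q }.

Section Tame.
Context (R : realFieldType) (B I : finType).
Implicit Types (c : seq B -> I -> R) (sel : seq B -> I -> bool).

Definition uneven c (k : R) Q := exists i i', `|c Q i'| + 2 * k <= `|c Q i|.

(** What the selection rules give. [tame_part] comes from taking the smallest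
    admissible coefficient, so that a cube left partly selected keeps only much
    smaller coefficients. [tame_top] comes from climbing from the peak [D] to the
    largest admissible cube: the parent [F] of the cube where the climb ends
    fails the comparison with the peak. The last clause says that when the
    climb passed through a cube [b' :: G] already in use while [G] was empty, that
    cube had been exhausted only in part. *)
Record tame c sel (M k : R) : Prop := Tame {
  tame_small : forall Q i, ~~ sel Q i -> `|c Q i| <= M;
  tame_big : forall Q i, sel Q i -> k <= `|c Q i|;
  tame_part : forall Q i i', sel Q i -> ~~ sel Q i' -> uneven c k Q;
  tame_top : forall b F i, sel (b :: F) i -> exists D j,
    [/\ suffix (b :: F) D, 3 * k <= `|c D j|,
        forall i', ~~ sel F i' -> `|c F i'| + 3 * k <= `|c D j| &
        forall b' G, suffix (b :: F) G -> suffix (b' :: G) D ->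
          (forall i', ~~ sel G i') -> (exists i', sel (b' :: G) i') ->
          uneven c k (b' :: G)] }.
End Tame.

Section BoundRel.
Context (R : realFieldType) (W : lmodType R) (norm_le : W -> R -> Prop).
Hypothesis normP : bound_rel norm_le.

Lemma norm_le_sum (J : Type) (r : seq J) (P : pred J) F G :
  (forall j, P j -> norm_le (F j) (G j)) ->
  norm_le (\sum_(j <- r | P j) F j) (\sum_(j <- r | P j) G j).
Proof.
move=> FG; elim: r => [|j r IH]; first by rewrite !big_nil; exact: norm_le0.
by rewrite !big_cons; case: ifP => // Pj; exact: (norm_leD normP (FG _ Pj) IH).
Qed.

Lemma norm_leN x r : norm_le x r -> norm_le (- x) r.
Proof. by move=> /(norm_leZ normP (-1)); rewrite scaleN1r normrN1 mul1r. Qed.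

Lemma norm_leB x y r q : norm_le x r -> norm_le y q -> norm_le (x - y) (r + q).
Proof. by move=> xr /norm_leN; exact: norm_leD. Qed.
End BoundRel.

Section TreeSums.
Context (B : finType) (Z : zmodType).

(** Summation over the parents in an ancestor-closed set: this is what makes sums
    of block differences telescope. *)
Lemma sum_children (V : seq (seq B)) (F : seq B -> Z) :
  uniq V -> [::] \in V -> (forall b Q, b :: Q \in V -> Q \in V) ->
  \sum_(Q <- V) \sum_(b | b :: Q \in V) F (b :: Q) = \sum_(Q <- V) F Q - F [::].
Proof.
move=> uV V0 clV.
rewrite [in RHS](bigD1_seq [::]) //= addrC addrK.
transitivity (\sum_(P <- [seq b :: Q | Q <- V, b <- enum B] | P \in V) F P).
  rewrite [RHS]big_mkcond big_allpairs_dep /=.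
  by apply: eq_bigr => Q _; rewrite big_enum /= big_mkcond.
rewrite -[LHS]big_filter -[RHS]big_filter; apply: perm_big; apply: uniq_perm.
- apply: filter_uniq; apply: allpairs_uniq => //; first exact: enum_uniq.
  by move=> [Q b] [Q' b'] _ _ /= [-> ->].
- exact: filter_uniq.
- move=> P; rewrite !mem_filter; case: P => [|b Q] /=.
    by apply/negP => /andP[_ /allpairsP[[? ?] [_ _]]].
  have [PV|//] := boolP (b :: Q \in V); rewrite andTb.
  by apply/allpairsP; exists (Q, b); rewrite /= mem_enum (clV _ _ PV).
Qed.
End TreeSums.

Section TameBound.
Context (R : realFieldType) (B I : finType) (b0 : B) (i0 : I) (W : lmodType R).
Context (norm_le : W -> R -> Prop) (nu a : seq B -> R) (c : seq B -> I -> R).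
Context (e : seq B -> W) (h : seq B -> I -> W).
Hypothesis normP : bound_rel norm_le.
Hypothesis exP : expansion norm_le nu a c e h.
Context (sel : seq B -> I -> bool) (M k : R).
Hypothesis k_gt0 : 0 < k.
Hypothesis kM : k <= M.
Hypothesis tameP : tame c sel M k.
Variable L : seq (seq B).
Hypothesis uL : uniq L.
Hypothesis selL : forall Q i, sel Q i -> Q \in L.
Implicit Types (Q P F G : seq B) (b : B).

Let nu0 := nu_ge0 exP.
Let nuA := nu_add exP.

Let c_le Q i : `|c Q i| <= nu Q.
Proof.
have QQ : suffix Q (b0 :: Q) by exact: suffix_cons.
have Qn : Q != b0 :: Q by apply/eqP => /(congr1 size) /= /n_Sn.
have h1 := abs_a exP (b0 :: Q); have := c_near exP i QQ Qn.
by rewrite ler_norml => /andP[h2 h3]; lra.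
Qed.

(* [U]: cubes with a selected coefficient; [K]: costly cubes, which keep mass [k]
   outside each child; [V]: cubes containing a selected cube. *)
Let U Q := [exists i, sel Q i].
Let K Q := [forall b, k <= nu Q - nu (b :: Q)].
Let V := undup [seq drop n P | P <- [seq P <- L | U P], n <- iota 0 (size P).+1].

Let VP Q : reflect (exists2 P, U P & suffix Q P) (Q \in V).
Proof.
rewrite mem_undup; apply: (iffP allpairsPdep).
  move=> [P [n [+ _ ->]]]; rewrite mem_filter => /andP[UP _].
  by exists P => //; rewrite -{2}(cat_take_drop n P) suffix_suffix.
move=> [P UP QP]; exists P, (size P - size Q)%N; split.
- by rewrite mem_filter UP; case/existsP: UP => i /selL ->.
- by rewrite mem_iota /= ltnS leq_subr.
- by case/suffixP: QP => s ->; rewrite size_cat addnK drop_size_cat.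
Qed.

Let uV : uniq V. Proof. exact: undup_uniq. Qed.

Let V_suffix Q P : suffix Q P -> P \in V -> Q \in V.
Proof.
by move=> QP /VP[P' UP' PP']; apply/VP; exists P' => //; exact: suffix_trans PP'.
Qed.

Let V_close b Q : b :: Q \in V -> Q \in V.
Proof. by apply: V_suffix; rewrite suffix_consr suffix_refl orbT. Qed.

Let UV Q : U Q -> Q \in V.
Proof. by move=> UQ; apply/VP; exists Q => //; exact: suffix_refl. Qed.

Let V_child Q : Q \in V -> ~~ U Q -> exists b, b :: Q \in V.
Proof.
move=> /VP[P UP QP] nUQ; have [|b bP] := suffix_child QP.
  by apply: contraNneq nUQ => ->.
by exists b; apply/VP; exists P.
Qed.

Let V_mass Q : Q \in V -> k <= nu Q.
Proof.
move=> /VP[P /existsP[i selP] QP]; apply: le_trans (nu_suffix nu0 nuA QP).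
by apply: le_trans (c_le P i); exact: tame_big tameP _ _ selP.
Qed.

Let siblings b b' Q : b != b' -> nu (b :: Q) <= nu Q - nu (b' :: Q).
Proof.
move=> bb'; rewrite -(nuA Q) (bigD1 b') //= (bigD1 b) //= -addrA [leRHS]addrC addrNK
  lerDl.
exact: sumr_ge0.
Qed.

(* The child that carries almost all the mass of [Q], when [Q] is not costly. It is
   the only child that can belong to [V], see [plus_uniq]. *)
Let plus Q := if [pick b | nu Q - nu (b :: Q) < k] is Some b then b :: Q else Q.

Let plusP Q : ~~ K Q -> exists2 b, plus Q = b :: Q & nu Q - nu (b :: Q) < k.
Proof.
rewrite /K negb_forall /plus => /existsP[b]; rewrite -ltNge => bQ.
by case: pickP => [b' ? | /(_ b)]; [exists b' | rewrite bQ].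
Qed.

Let plus_uniq b Q : ~~ K Q -> b :: Q \in V -> plus Q = b :: Q.
Proof.
move=> /plusP[b' -> b'Q] bV; have [->//|bb'] := eqVneq b b'.
have h1 := siblings Q bb'; have h2 := V_mass bV.
by exfalso; lra.
Qed.

Let uneven_K Q : uneven c k Q -> K Q.
Proof.
move=> [i [i' ii']]; apply/forallP => b.
have QQ : suffix Q (b :: Q) by exact: suffix_cons.
have Qn : Q != b :: Q by apply/eqP => /(congr1 size) /= /n_Sn.
have := c_near exP i QQ Qn; have := c_near exP i' QQ Qn; rewrite !ler_norml.
by move=> /andP[h1 h2] /andP[h3 h4]; lra.
Qed.

(* The cubes of [V] whose whole block is missing from the partial sum and which
   are not costly. Each has a unique child in [V], so they form chains. *)
Let N := [seq Q <- V | ~~ U Q && ~~ K Q].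

Let NP Q : reflect [/\ Q \in V, ~~ U Q & ~~ K Q] (Q \in N).
Proof. by rewrite mem_filter andbC; apply: (iffP and3P). Qed.

Let plus_V Q : Q \in N -> plus Q \in V.
Proof. by move=> /NP[QV /(V_child QV)[b bV] KQ]; rewrite (plus_uniq KQ bV). Qed.

Let countK : k * (count K V)%:R <= 2 * nu [::].
Proof.
rewrite -size_filter; apply: separated_count => //; first exact: filter_uniq.
  by move=> F; rewrite mem_filter => /andP[_ /V_mass].
move=> F G; rewrite !mem_filter => /andP[/forallP KF _] _ FG FnG.
have [b bG] := suffix_child FG FnG; apply: (le_trans (KF b)).
by rewrite lerD2l lerN2 nu_suffix.
Qed.

(* Lower ends of chains that sit on top of a selected cube that is not costly. *)
Let S0 := [seq Q <- N | U (plus Q) && ~~ K (plus Q)].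

(* The peak [D] provided by [tame_top] for [F] has a coefficient larger than that
   of [F] by [3 * k]. If [G] is inside [D], the comparison of both coefficients with
   the mass of [G], or with that of the heavy child of [G] when [G = D], gives
   the mass between [F] and [G]. If [D] and [G] are disjoint, [D] itself is this
   mass. If [D] is strictly inside [G], then either the last clause of
   [tame_top] applies, or [D] and the child of [G] in [V] lie in different
   children of [G]; both would make [G] or its child costly. *)
Let sepS0 : {in S0 &, forall F G, suffix F G -> F != G -> k <= nu F - nu G}.
Proof.
move=> F G; rewrite ![_ \in S0]mem_filter.
move=> /andP[/andP[UF KF'] /[dup] FN /NP[FV nUF KF]].
move=> /andP[/andP[UG KG'] /[dup] GN /NP[GV nUG KG]] FG FnG.
have [b bG] := suffix_child FG FnG.
have pF := plus_uniq KF (V_suffix bG GV); rewrite pF in UF KF'.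
case/existsP: UF => i seli.
have [D [j [bD k3D FD top]]] := tame_top tameP seli.
have kD : k <= `|c D j| by have := k_gt0; lra.
have {}FD : `|c F i| + 3 * k <= `|c D j|.
  by apply: FD; move: nUF; rewrite negb_exists => /forallP.
have FsD : suffix F D := suffix_consl bD.
have nFD := nu_suffix nu0 nuA FsD.
have cD := c_le D j.
have [DG|nDG] := boolP (suffix D G).
  have [DG'|DnG] := eqVneq D G.
    subst D; have [b1 _ b1G] := plusP KG.
    have s1 : suffix G (b1 :: G) by exact: suffix_cons.
    have n1 : G != b1 :: G by apply/eqP => /(congr1 size) /= /n_Sn.
    have s2 := suffix_trans FG s1.
    have n2 : F != b1 :: G by apply: contraTneq FG => ->; rewrite suffix_consN.
    have := c_near exP i s2 n2; have := c_near exP j s1 n1; rewrite !ler_norml.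
    by move=> /andP[h1 h2] /andP[h3 h4]; lra.
  have := c_near exP i FG FnG; have := c_near exP j DG DnG; rewrite !ler_norml.
  by move=> /andP[h1 h2] /andP[h3 h4]; lra.
have [GD|nGD] := boolP (suffix G D); last first.
  by have := nu_disjoint nu0 nuA FG FsD nGD nDG; lra.
have [|b1 b1D] := suffix_child GD.
  by apply: contraNneq nDG => ->; rewrite suffix_refl.
have [b2 pG b2G] := plusP KG; rewrite pG in UG KG'.
have [b12|b12] := eqVneq b1 b2.
  rewrite b12 in b1D; case/negP: KG'; apply: uneven_K; apply: top => //.
    by move: nUG; rewrite negb_exists => /forallP.
  by case/existsP: UG => i' ?; exists i'.
have h1 := V_mass (UV UG); have h2 := siblings G b12.
have h3 := nu_suffix nu0 nuA b1D; lra.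
Qed.

Let countS0 : k * (size S0)%:R <= 2 * nu [::].
Proof.
apply: separated_count => //; first by do 2!apply: filter_uniq.
by move=> F; rewrite mem_filter => /andP[_ /NP[/V_mass + _ _]].
Qed.

Let plus_inj : {in N &, injective plus}.
Proof.
move=> Q Q' /NP[_ _ /plusP[b -> _]] /NP[_ _ /plusP[b' -> _]]; by case.
Qed.

(* The chains of [N] correspond to their first cubes and to their last cubes, so
   [starts] and [ends] have the same size. *)
Let starts := [seq Q <- N | Q \notin map plus N].
Let ends := [seq Q <- N | plus Q \notin N].

Let chain_perm :
  perm_eq (map plus [seq Q <- N | plus Q \in N]) [seq Q <- N | Q \in map plus N].
Proof.
have uN : uniq N by exact: filter_uniq.
apply: uniq_perm; last 1 first.
- move=> P; rewrite mem_filter; apply/mapP/andP.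
    move=> [Q]; rewrite mem_filter => /andP[pQ QN] ->; split=> //.
    exact: map_f.
  move=> [/mapP[Q QN ->] PN]; exists Q => //; by rewrite mem_filter PN.
- rewrite map_inj_in_uniq; first exact: filter_uniq.
  move=> Q Q'; rewrite mem_filter => /andP[_ QN].
  by rewrite mem_filter => /andP[_ Q'N]; exact: plus_inj.
- exact: filter_uniq.
Qed.

Let size_starts : size starts = size ends.
Proof.
have := perm_size chain_perm; rewrite size_map !size_filter.
have := count_predC (fun Q => plus Q \in N) N.
have := count_predC (fun Q => Q \in map plus N) N.
rewrite -[count (predC _) _]size_filter -/starts => <-.
rewrite -[count (predC _) _]size_filter -/ends => h1 h2.
by move/eqP: h1; rewrite h2 eqn_add2l => /eqP.
Qed.

Let size_ends : k * (size ends)%:R <= 4 * nu [::].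
Proof.
have le1 : (size ends <= size S0 + count K V)%N.
  rewrite -(count_predC (fun Q => K (plus Q)) ends) addnC leq_add //.
    rewrite -size_filter uniq_leq_size //; first by do 3!apply: filter_uniq.
    move=> Q; rewrite !mem_filter /= => /and3P[KQ plN /andP[nn QV]].
    rewrite KQ nn QV !andbT.
    have pV : plus Q \in V by apply: plus_V; rewrite mem_filter nn.
    by move: plN; rewrite pV KQ !andbT negbK.
  rewrite -size_filter -(size_map plus) -[leqRHS]size_filter uniq_leq_size //.
    rewrite map_inj_in_uniq; first by do 3!apply: filter_uniq.
    move=> Q Q'; rewrite 2!mem_filter => /and3P[_ _ ?].
    by rewrite 2!mem_filter => /and3P[_ _ ?]; exact: plus_inj.
  move=> P /mapP[Q]; rewrite 2!mem_filter => /and3P[KQ _ QN] ->.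
  by rewrite mem_filter KQ plus_V.
apply: (@le_trans _ _ (k * (size S0 + count K V)%:R)).
  by rewrite ler_pM2l // ler_nat.
by rewrite natrD mulrDr; have := countS0; have := countK; lra.
Qed.

(* The average on a cube of a chain cancels against that of its predecessor. *)
Let telescope_chains :
  \sum_(Q <- N) (e (plus Q) - e Q) = \sum_(Q <- ends) e (plus Q) - \sum_(Q <- starts)
    e Q.
Proof.
rewrite big_split sumrN /=.
rewrite (bigID (fun Q => plus Q \in N)) /= [X in _ - X](bigID (mem (map plus N))) /=.
rewrite -[X in X + _ - _]big_filter -(big_map plus xpredT e) (perm_big _ chain_perm) /=.
by rewrite big_filter !big_filter opprD addrACA addrN add0r.
Qed.

(* The mass of [Q] outside its children in [V]. The losses add up to the total
   mass, which bounds everything that happens off the chains. *)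
Let loss Q := nu Q - \sum_(b | b :: Q \in V) nu (b :: Q).

Let loss_ge0 Q : 0 <= loss Q.
Proof.
rewrite /loss subr_ge0 -[leRHS]nuA [leRHS](bigID (fun b => b :: Q \in V)) /=.
by rewrite lerDl sumr_ge0.
Qed.

Let sum_loss : [::] \in V -> \sum_(Q <- V) loss Q = nu [::].
Proof. by move=> V0; rewrite /loss big_split sumrN /= sum_children // opprB addrCA
  addrN addr0. Qed.

Let lossN Q : Q \in N -> loss Q = nu Q - nu (plus Q).
Proof.
move=> /NP[QV UQ KQ]; have [b bV] := V_child QV UQ.
rewrite /loss (plus_uniq KQ bV) (bigD1 b) //= big1 ?addr0 // => b' /andP[b'V].
by have := plus_uniq KQ bV; rewrite (plus_uniq KQ b'V) => -[->]; rewrite eqxx.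
Qed.

Let sum_lossN (r : seq (seq B)) :
  [::] \in V -> uniq r -> {subset r <= N} ->
    \sum_(Q <- r) (nu Q - nu (plus Q)) <= nu [::].
Proof.
move=> V0 ur rN; rewrite -(sum_loss V0).
rewrite (eq_big_seq loss) => [|Q /rN QN]; last by rewrite lossN.
have rV : {subset r <= V} by move=> Q /rN; rewrite mem_filter => /andP[].
rewrite [leRHS](bigID (mem r)) /= -[X in X + _]big_filter.
rewrite -[leLHS]addr0 lerD ?sumr_ge0 //.
rewrite le_eqVlt; apply/orP; left; apply/eqP/perm_big/uniq_perm => //.
  exact: filter_uniq.
move=> Q; rewrite mem_filter; apply/idP/andP => [Qr|[]//].
by split => //; exact: rV.
Qed.

(* The coefficients of a cube of [N] are unselected, hence at most [M], and close
   to the mass of the heavy child. *)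
Let a_plus Q : Q \in N -> `|a (plus Q)| <= M + (nu Q - nu (plus Q)).
Proof.
move=> /NP[QV UQ KQ]; have [b bV] := V_child QV UQ.
rewrite (plus_uniq KQ bV).
have QQ : suffix Q (b :: Q) by exact: suffix_cons.
have Qn : Q != b :: Q by apply/eqP => /(congr1 size) /= /n_Sn.
have := c_near exP i0 QQ Qn; rewrite ler_norml => /andP[h1 h2].
have : `|c Q i0| <= M by apply: (tame_small tameP); move: UQ;
  rewrite negb_exists => /forallP.
by lra.
Qed.

Let a_start Q : Q \in N -> `|a Q| <= M + 2 * (nu Q - nu (plus Q)).
Proof.
move=> QN; have h1 := a_plus QN; move: QN h1 => /NP[QV UQ KQ].
have [b bV] := V_child QV UQ; rewrite (plus_uniq KQ bV) => h1.
have : `|a Q| <= `|a (b :: Q)| + (nu Q - nu (b :: Q)).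
  rewrite -(a_add exP Q) -(nuA Q) (bigD1 b) //= [X in X - _](bigD1 b) //=.
  rewrite addrAC addrN add0r; apply: (le_trans (ler_normD _ _)).
  rewrite lerD2l; apply: (le_trans (ler_norm_sum _ _ _)).
  by apply: ler_sum => b' _; exact: (abs_a exP).
lra.
Qed.

Let norm_le_chains : [::] \in V -> norm_le (\sum_(Q <- N) \sum_i c Q i *: h Q i)
  (4 * nu [::] + 2 * M * (size ends)%:R).
Proof.
move=> V0; have uN : uniq N by exact: filter_uniq.
have -> : \sum_(Q <- N) \sum_i c Q i *: h Q i =
    (\sum_(Q <- ends) e (plus Q) - \sum_(Q <- starts) e Q) +
    \sum_(Q <- N) \sum_(b | b :: Q != plus Q) e (b :: Q).
  rewrite -telescope_chains -big_split /=; apply: eq_big_seq => Q QN.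
  rewrite (haar_sum exP) addrAC; congr (_ - _).
  have [b -> _] := plusP (let: And3 _ _ KQ := NP _ QN in KQ).
  rewrite (bigD1 b) //=; congr (_ + _); apply: eq_bigl => b'.
  by rewrite eqseq_cons eqxx andbT.
have endN : {subset ends <= N} by move=> Q; rewrite mem_filter => /andP[].
have startN : {subset starts <= N} by move=> Q; rewrite mem_filter => /andP[].
have cst (r : seq (seq B)) : \sum_(Q <- r) M = M * (size r)%:R.
  by rewrite big_const_seq count_predT iter_addr_0 mulr_natr.
apply: (@norm_le_weaken _ _ _ normP _ ((\sum_(Q <- ends) `|a (plus Q)| + \sum_(Q <-
  starts) `|a Q|)
    + \sum_(Q <- N) \sum_(b | b :: Q != plus Q) `|a (b :: Q)|)).
  apply: (norm_leD normP); [apply: (norm_leB normP)|].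
  - by apply: (norm_le_sum normP) => Q _; exact: (norm_le_e exP).
  - by apply: (norm_le_sum normP) => Q _; exact: (norm_le_e exP).
  - apply: (norm_le_sum normP) => Q _; apply: (norm_le_sum normP) => b _;
      exact: (norm_le_e exP).
have h1 : \sum_(Q <- ends) `|a (plus Q)| <= M * (size ends)%:R + nu [::].
  apply: (@le_trans _ _ (\sum_(Q <- ends) (M + (nu Q - nu (plus Q))))).
    rewrite big_seq [leRHS]big_seq; by apply: ler_sum => Q /endN /a_plus.
  by rewrite big_split /= cst lerD2l sum_lossN // filter_uniq.
have h2 : \sum_(Q <- starts) `|a Q| <= M * (size ends)%:R + 2 * nu [::].
  apply: (@le_trans _ _ (\sum_(Q <- starts) (M + 2 * (nu Q - nu (plus Q))))).
    rewrite big_seq [leRHS]big_seq; by apply: ler_sum => Q /startN /a_start.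
  by rewrite big_split /= cst size_starts lerD2l -mulr_sumr ler_pM2l // sum_lossN //
    filter_uniq.
have h3 : \sum_(Q <- N) \sum_(b | b :: Q != plus Q) `|a (b :: Q)| <= nu [::].
  apply: le_trans (sum_lossN V0 uN _) => //; rewrite big_seq [leRHS]big_seq;
    apply: ler_sum => Q QN.
  have [b -> _] := plusP (let: And3 _ _ KQ := NP _ QN in KQ).
  rewrite -(nuA Q) [X in _ <= X - _](bigD1 b) //= addrAC addrN add0r.
  rewrite (eq_bigl (fun b' => b' != b)); last first.
    by move=> b'; rewrite eqseq_cons eqxx andbT.
  by apply: ler_sum => b' _; exact: (abs_a exP).
lra.
Qed.

Let norm_le_costly : norm_le (\sum_(Q <- V | K Q) \sum_(i | ~~ sel Q i) c Q i *: h Q i)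
  (#|I|%:R * M * (count K V)%:R).
Proof.
have M0 : 0 <= M by apply: le_trans kM; exact: ltW.
have -> : #|I|%:R * M * (count K V)%:R = \sum_(Q <- V | K Q) #|I|%:R * M.
  by rewrite big_const_seq iter_addr_0 mulr_natr.
apply: (norm_le_sum normP) => Q _.
apply: (@norm_le_weaken _ _ _ normP _ (\sum_(i | ~~ sel Q i) M)).
  apply: (norm_le_sum normP) => i seli;
    have := norm_leZ normP (c Q i) (norm_le_h exP Q i).
  by move/(norm_le_weaken normP); apply; rewrite mulr1; exact: (tame_small tameP).
by rewrite sumr_const -[leLHS]mulr_natl ler_wpM2r // ler_nat max_card.
Qed.

Let unselected_split :
  \sum_(Q <- V) \sum_(i | ~~ sel Q i) c Q i *: h Q i =
  \sum_(Q <- V | K Q) \sum_(i | ~~ sel Q i) c Q i *: h Q i +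
  \sum_(Q <- N) \sum_i c Q i *: h Q i.
Proof.
rewrite (bigID K) /=; congr (_ + _).
rewrite /N big_filter [RHS]big_mkcondl [LHS]big_seq_cond [RHS]big_seq_cond.
apply: eq_bigr => Q /andP[QV KQ]; have [/existsP[i seli]|nU] := boolP (U Q).
  rewrite big1 // => i' nsel; case/negP: KQ; apply: uneven_K.
  exact: (tame_part tameP seli nsel).
by apply: eq_bigl => i; move: nU; rewrite negb_exists => /forallP/(_ i).
Qed.

(** With [P_V] the partial sum over all the coefficients of the cubes of [V], the
    selected sum is [P_V] minus the unselected terms of the costly cubes minus the
    blocks of the cubes of [N]. These three parts contribute [2],
    [2 * #|I| * (M / k)] and [4 + 8 * (M / k)] to the constant. *)
Lemma tame_bound : norm_le (\sum_(Q <- L) \sum_(i | sel Q i) c Q i *: h Q i)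
  ((6 + (2 * #|I|%:R + 8) * (M / k)) * nu [::]).
Proof.
have M0 : 0 <= M by apply: le_trans kM; exact: ltW.
have -> : \sum_(Q <- L) \sum_(i | sel Q i) c Q i *: h Q i =
    \sum_(Q <- V) \sum_(i | sel Q i) c Q i *: h Q i.
  have restr (r : seq (seq B)) : \sum_(Q <- r) \sum_(i | sel Q i) c Q i *: h Q i =
      \sum_(Q <- [seq Q <- r | U Q]) \sum_(i | sel Q i) c Q i *: h Q i.
    rewrite big_filter [RHS]big_mkcond /=; apply: eq_bigr => Q _.
    have [//|nU] := boolP (U Q); rewrite big1 // => i seli.
    by case/negP: nU; apply/existsP; exists i.
  rewrite restr [RHS]restr; apply/perm_big/uniq_perm; try exact: filter_uniq.
  move=> Q; rewrite !mem_filter; have [UQ|//] := boolP (U Q).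
  by rewrite (UV UQ); case/existsP: UQ => i /selL ->.
have [V0|nV0] := boolP ([::] \in V); last first.
  have -> : V = [::].
    case: V nV0 V_suffix => // Q r nV0 /(_ [::] Q);
      rewrite (negbTE nV0) suffix0s mem_head.
    by move=> /(_ isT isT).
  rewrite big_nil; apply: (norm_le_weaken normP (norm_le0 normP));
    apply: mulr_ge0 => //.
  by rewrite addr_ge0 // mulr_ge0 ?addr_ge0 ?mulr_ge0 ?invr_ge0 // ltW.
have -> : \sum_(Q <- V) \sum_(i | sel Q i) c Q i *: h Q i =
    (\sum_(Q <- V) \sum_(b | b :: Q \notin V) e (b :: Q) - e [::]) -
    (\sum_(Q <- V | K Q) \sum_(i | ~~ sel Q i) c Q i *: h Q i +
     \sum_(Q <- N) \sum_i c Q i *: h Q i).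
  rewrite -unselected_split.
  have -> : \sum_(Q <- V) \sum_(b | b :: Q \notin V) e (b :: Q) - e [::] =
      \sum_(Q <- V) \sum_i c Q i *: h Q i.
    rewrite (eq_bigr _ (fun Q _ => haar_sum exP Q)) big_split sumrN /=.
    rewrite [X in _ = X - _](eq_bigr _ (fun Q _ => bigID (fun b => b :: Q \in V) _ _)).
    by rewrite big_split /= sum_children // -[RHS]addrA [X in _ = _ + X]addrC addrACA
      subrr add0r addrC.
  by rewrite -sumrB; apply: eq_bigr => Q _;
    rewrite [X in X - _](bigID (sel Q)) /= addrK.
have hK := countK; have hE := size_ends.
have r0 : 0 <= M / k by rewrite divr_ge0 // ltW.
have scale (x y : R) : k * x <= y -> M * x <= M / k * y.
  move=> xy; rewrite -mulrA ler_wpM2l //.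
  by rewrite mulrC ler_pdivlMr // mulrC.
have {}hK := scale _ _ hK; have {}hE := scale _ _ hE.
apply: (norm_le_weaken normP).
  apply: (norm_leB normP).
    apply: (norm_leB normP); last exact: (norm_le_e exP).
    by apply: (norm_le_sum normP) => Q _; apply: (norm_le_sum normP) => b _;
      exact: (norm_le_e exP).
  by apply: (norm_leD normP); [exact: norm_le_costly|exact: norm_le_chains].
have h1 : \sum_(Q <- V) \sum_(b | b :: Q \notin V) `|a (b :: Q)| <= nu [::].
  rewrite -sum_loss //; apply: ler_sum => Q _.
  rewrite /loss -[X in _ <= X - _](nuA Q) [X in _ <= X - _](bigID (fun b => b :: Q
    \in V)) /=.
  rewrite addrAC addrN add0r; apply: ler_sum => b _; exact: (abs_a exP).
have h2 := abs_a exP [::].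
have h4 : #|I|%:R * M * (count K V)%:R <= #|I|%:R * (M / k * (2 * nu [::])).
  by rewrite -mulrA ler_wpM2l.
move: h1 h2 h4 hE; set x1 := (\sum_(_ <- V) _); set x2 := _ * _ * (count K V)%:R.
move: (#|I|%:R) (M / k) (nu [::]) (size ends)%:R x1 x2 `|a [::]| => n q v z x1 x2 a0.
move=> h1 h2 h4 hE; nra.
Qed.

End TameBound.

(** * Greedy runs and tame selections *)

Section Run.
Context (R : realFieldType) (B I : finType) (c : seq B -> I -> R).
Context (prec : seq B -> seq B -> Prop).
Hypothesis prec_asym : forall P Q, prec P Q -> prec Q P -> False.
Context (s t kap : R).
Hypothesis t_gt0 : 0 < t.
Hypothesis ts : t < s.
Hypothesis kap_gt0 : 0 < kap.
Hypothesis kap_t : kap <= t.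
Hypothesis kap_ts : 2 * kap <= s - t.
Hypothesis kap_s : 3 * kap <= 1 - s.
Implicit Types (sel : seq B -> I -> bool) (r : seq B -> I -> R).
Implicit Types (Q P F G D E : seq B) (b : B) (i j l : I).

Definition residue sel Q i := if sel Q i then 0 else c Q i.

(** The outcome of the first two steps for the residual coefficients [r]: [D] is
    the first cube with a coefficient of maximal size [M], and [E] the cube where
    the climb from [D] ends. *)
Record located r (M : R) D E : Prop := Located {
  loc_gt0 : 0 < M;
  loc_peak : exists j, `|r D j| = M;
  loc_max : forall Q l, `|r Q l| <= M;
  loc_first : forall Q l, `|r Q l| = M -> Q = D \/ prec D Q;
  loc_below : suffix E D;
  loc_chain : forall Q, suffix E Q -> suffix Q D -> exists l, s * M <= `|r Q l|;
  loc_top : forall b F, E = b :: F -> forall l, `|r F l| < s * M }.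

(** The outcome of the third step, in a form shared by both algorithms: each
    threshold lies between [t * M] and [t / s] times the largest coefficient of
    [E], here the one with index [l0]. *)
Record picked r (M : R) D E i : Prop := Picked {
  pick_loc : located r M D E;
  pick_big : t * M <= `|r E i|;
  pick_least : exists l0, (forall l, `|r E l| <= `|r E l0|) /\
    (forall l, t / s * `|r E l0| <= `|r E l| -> `|r E i| <= `|r E l|) }.

Definition select sel E i Q l := sel Q l || ((Q == E) && (l == i)).

Let s_gt0 : 0 < s. Proof. exact: lt_trans ts. Qed.

Let residue_le sel Q i : `|residue sel Q i| <= `|c Q i|.
Proof. by rewrite /residue; case: ifP; rewrite ?normr0. Qed.

Let residue_unsel sel Q i : ~~ sel Q i -> residue sel Q i = c Q i.
Proof. by rewrite /residue => /negbTE ->. Qed.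

Let residue_neq0 sel Q i : 0 < `|residue sel Q i| -> ~~ sel Q i.
Proof. by rewrite /residue; case: (sel Q i); rewrite // normr0 ltxx. Qed.

Let located_le r M D E M' D' E' : located r M D E -> located r M' D' E' -> M <= M'.
Proof. by move=> [_ [j <-] _ _ _ _ _] []. Qed.

Let located_above r M D E E' :
  located r M D E -> located r M D E' -> suffix E' E -> E' = E.
Proof.
move=> h h' E'E; case: E h E'E => [|b F] h; first by rewrite suffixs0 => /eqP.
rewrite suffix_consr => /orP[/eqP//|E'F].
have [|l] := loc_chain h' E'F; first exact: suffix_consl (loc_below h).
by rewrite leNgt (loc_top h erefl).
Qed.

(** The peak is the first one in a strict order, and the climb stops at the first
    failure, so the first two steps are deterministic. *)
Lemma located_uniq r M D E M' D' E' :
  located r M D E -> located r M' D' E' -> [/\ M = M', D = D' & E = E'].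
Proof.
move=> h h'.
have eM : M = M' by apply/eqP; rewrite eq_le (located_le h h') (located_le h' h).
subst M'; have [j jD] := loc_peak h; have [j' j'D] := loc_peak h'.
have eD : D = D'.
  case: (loc_first h j'D) => [->//|DD']; case: (loc_first h' jD) => [->//|D'D].
  by case: (prec_asym DD' D'D).
subst D'; split => //.
have /orP[EE'|E'E] := suffix_total (loc_below h) (loc_below h').
  exact: located_above h' h EE'.
by symmetry; exact: located_above h h' E'E.
Qed.

(** If a largest coefficient of [E] survives a selection in [E], the next step
    finds the same peak, since removing coefficients creates no new peak, and
    climbs again to [E]. *)
Lemma located_select sel M D E i l :
  let r := residue sel in let r' := residue (select sel E i) in
  located r M D E -> (forall l', `|r E l'| <= `|r E l|) -> l != i ->
  located r' M D E.
Proof.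
move=> r r' h lmax li.
have r'E Q l' : (Q != E) || (l' != i) -> r' Q l' = r Q l'.
  by rewrite /r' /r /residue /select -negb_and => /negbTE ->; rewrite orbF.
have r'le Q l' : `|r' Q l'| <= `|r Q l'|.
  have [Hn|] := boolP ((Q != E) || (l' != i)); first by rewrite r'E.
  rewrite -negb_and negbK => /andP[/eqP -> /eqP ->].
  by rewrite /r' /residue /select !eqxx orbT normr0.
have [j jD] := loc_peak h.
split.
- exact: loc_gt0 h.
- have [Hn|] := boolP ((D != E) || (j != i)); first by exists j; rewrite r'E.
  rewrite -negb_and negbK => /andP[/eqP eD /eqP ej]; exists l.
  rewrite eD r'E ?li ?orbT //; apply/eqP; rewrite eq_le (loc_max h) -jD eD.
  exact: lmax.
- by move=> Q l'; apply: (le_trans (r'le _ _)); exact: loc_max h _ _.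
- move=> Q l' Ql'; apply: (loc_first h (l := l')).
  by apply/eqP; rewrite eq_le (loc_max h) -Ql' r'le.
- exact: loc_below h.
- move=> Q EQ QD; have [l1 h1] := loc_chain h EQ QD.
  have [eQ|nQ] := eqVneq Q E; last by exists l1; rewrite r'E ?nQ.
  subst Q; exists l; rewrite r'E ?li ?orbT //; exact: le_trans h1 (lmax _).
- move=> b F eE l'; apply: le_lt_trans (r'le _ _) _; exact: (loc_top h eE).
Qed.

(** A selection in [E] that leaves [E] partly selected has two possible outcomes.
    If the largest coefficient survives, the next step returns to [E]. If it was the
    selected one, it was also the smallest admissible one, and the coefficients
    that are left are either equal to it or smaller by the factor [t / s]. *)
Lemma select_uneven sel M D E i l :
  picked (residue sel) M D E i -> ~~ select sel E i E l ->
  uneven c (kap * M) E \/ located (residue (select sel E i)) M D E.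
Proof.
move=> [h big [l0 [l0max least]]].
have M0 := loc_gt0 h; have s0 := s_gt0.
have iE : ~~ sel E i.
  by apply: residue_neq0; apply: lt_le_trans big; rewrite mulr_gt0.
rewrite /select eqxx /= negb_or => /andP[lE li].
have [l0i|l0i] := eqVneq l0 i; last by right; exact: (located_select h l0max l0i).
subst l0; have [|] := lerP (t / s * `|residue sel E i|) `|residue sel E l|.
  move=> /least il; right; apply: (located_select h _ li) => l'.
  exact: le_trans (l0max _) il.
rewrite !residue_unsel // => small; left; exists i, l.
have [l1 h1] := loc_chain h (suffix_refl _) (loc_below h).
have := le_trans h1 (l0max l1); rewrite residue_unsel // => h2.
have h3 : (1 - t / s) * (s * M) <= (1 - t / s) * `|c E i|.
  by rewrite ler_wpM2l // subr_ge0 ler_pdivrMr // mul1r ltW.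
have h4 : (1 - t / s) * (s * M) = (s - t) * M.
  by field; rewrite gt_eqF.
have h5 : 2 * kap * M <= (s - t) * M by rewrite ler_wpM2r // ltW.
lra.
Qed.

Definition empty_sel sel := forall Q i, ~~ sel Q i.

(** The stages to which the norm bound applies, with [k] a fixed fraction of the
    current peak. *)
Definition settled sel :=
  empty_sel sel \/ exists2 M, 0 < M & tame c sel M (kap * M).

(** Invariant of the run after a step with peak size [M] and peak cube [D] that
    selects in [E]. The alternative [located (residue sel) M D E] means that [E]
    is not exhausted and that the next step selects in it again; [st_settled]
    remembers the last stage before the work on [E] began. *)
Record run_state sel (M : R) D E : Prop := RunState {
  st_gt0 : 0 < M;
  st_small : forall Q i, ~~ sel Q i -> `|c Q i| <= M;
  st_big : forall Q i, sel Q i -> t * M <= `|c Q i|;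
  st_part : forall Q i i', sel Q i -> ~~ sel Q i' ->
    uneven c (kap * M) Q \/ Q = E /\ located (residue sel) M D E;
  st_top : forall b F i, sel (b :: F) i -> exists D' j,
    [/\ suffix (b :: F) D', M <= `|c D' j|,
        forall i', ~~ sel F i' -> `|c F i'| < s * `|c D' j|,
        forall G, suffix (b :: F) G -> suffix G D' ->
          exists l, s * `|c D' j| <= `|c G l| &
        forall b' G, suffix (b :: F) G -> suffix (b' :: G) D' ->
          (forall i', ~~ sel G i') -> (exists i', sel (b' :: G) i') ->
          uneven c (kap * M) (b' :: G)];
  st_settled : located (residue sel) M D E -> exists sel0, [/\ settled sel0,
    forall Q i, sel0 Q i -> sel Q i & forall Q i, sel Q i -> sel0 Q i \/ Q = E] }.

Lemma run_state_tame sel M D E :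
  run_state sel M D E -> ~ located (residue sel) M D E -> tame c sel M (kap * M).
Proof.
move=> st nloc; have M0 := st_gt0 st; split.
- exact: st_small st.
- move=> Q i /(st_big st); apply: le_trans; by rewrite ler_pM2r.
- by move=> Q i i' /(st_part st) h /h[|[_ /nloc]].
- move=> b F i /(st_top st) [D' [j [bD MD FD _ cl]]]; exists D', j; split => //.
    apply: le_trans MD; rewrite mulrA ger_pMl //.
    by have := kap_s; have := ts; have := t_gt0; lra.
  move=> i' /FD h; have h1 : 3 * kap * M <= 3 * kap * `|c D' j|.
    by rewrite ler_wpM2l // mulr_ge0 // ltW.
  have h2 : 3 * kap * `|c D' j| <= (1 - s) * `|c D' j| by rewrite ler_wpM2r.
  lra.
Qed.

Lemma run_state_near sel M D E : run_state sel M D E -> exists sel0 E0,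
  [/\ settled sel0,
  forall Q i, sel0 Q i -> sel Q i & forall Q i, sel Q i -> sel0 Q i \/ Q = E0].
Proof.
move=> st; have [/(st_settled st)[sel0 h]|nloc] := EM (located (residue sel) M D E).
  by exists sel0, E.
exists sel, E; split; [right|by []|by left].
by exists M; [exact: st_gt0 st|exact: run_state_tame nloc].
Qed.

Lemma uneven_le k k' Q : k <= k' -> uneven c k' Q -> uneven c k Q.
Proof. by move=> kk' [i [i' h]]; exists i, i'; lra. Qed.

Lemma run_state_init sel M D E : empty_sel sel -> located (residue sel) M D E ->
  run_state sel M D E.
Proof.
move=> e0 h; split.
- exact: loc_gt0 h.
- by move=> Q i nsel; have := loc_max h Q i; rewrite residue_unsel.
- by move=> Q i; rewrite (negbTE (e0 _ _)).
- by move=> Q i i'; rewrite (negbTE (e0 _ _)).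
- by move=> b F i; rewrite (negbTE (e0 _ _)).
- by move=> _; exists sel; split => //; [left|left].
Qed.

(** The peak size decreases along the run. For a cube selected earlier, the only
    new instance of the last clause of [tame_top] would have a parent that is both
    below the new threshold and above the old one. For the cube [E] selected for the
    first time, a cube in use that lies on the climb still has a large
    coefficient, so it is partly selected, and it is not being exhausted, because
    the current step would then select in it. *)
Lemma run_state_step sel M0 D0 E0 M D E i :
  run_state sel M0 D0 E0 -> picked (residue sel) M D E i ->
  run_state (select sel E i) M D E.
Proof.
move=> st pk; have loc := pick_loc pk; have M_gt0 := loc_gt0 loc.
have [j jD] := loc_peak loc.
have jsel : ~~ sel D j by apply: residue_neq0; rewrite jD.
have iE : ~~ sel E i.
  by apply: residue_neq0; apply: lt_le_trans (pick_big pk); rewrite mulr_gt0.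
have cj : `|c D j| = M by rewrite -jD residue_unsel.
have MM0 : M <= M0 by rewrite -cj; exact: st_small st _ _ jsel.
have kMM0 : kap * M <= kap * M0 by rewrite ler_pM2l.
have selW Q l : sel Q l -> select sel E i Q l by rewrite /select => ->.
have selN Q l : ~~ select sel E i Q l -> ~~ sel Q l by apply: contra; exact: selW.
have selE Q l : Q != E -> select sel E i Q l = sel Q l.
  by rewrite /select => /negbTE ->; rewrite orbF.
have same : located (residue sel) M0 D0 E0 -> E0 = E.
  by move=> h; have [] := located_uniq h loc.
split.
- by [].
- by move=> Q l /selN nsel; have := loc_max loc Q l; rewrite residue_unsel.
- move=> Q l /orP[/(st_big st)|/andP[/eqP -> /eqP ->]].
    by apply: le_trans; rewrite ler_pM2l.
  by have := pick_big pk; rewrite residue_unsel.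
- move=> Q l l'; have [->|nQ] := eqVneq Q E.
    by move=> _ /(select_uneven pk)[]; [left|right].
  rewrite !selE // => /(st_part st) h /h[/(uneven_le kMM0)|[eQ /same eE]];
    first by left.
  by rewrite eQ eE eqxx in nQ.
- move=> b F l sel'; have [e0|] := boolP [forall l, ~~ sel (b :: F) l]; last first.
    rewrite negb_forall => /existsP[l1]; rewrite negbK => /(st_top st).
    move=> [D' [j' [bD MD FD chain cl]]]; exists D', j'; split => //.
    + exact: le_trans MD.
    + by move=> l2 /selN; exact: FD.
    + move=> b' G bG b'D Gempty [l2 /orP[bsel|/andP[/eqP eE _]]].
        apply: (uneven_le kMM0); apply: cl => //; last by exists l2.
        by move=> l3; exact: selN.
      have [l3 h3] := chain _ bG (suffix_consl b'D).
      have := loc_top loc (esym eE) l3; rewrite residue_unsel; last by apply: selN.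
      move=> h4; have : s * M < s * M by apply: le_lt_trans h4; apply: le_trans h3;
        rewrite ler_pM2l //; exact: le_trans MD.
      by rewrite ltxx.
  have eE : b :: F = E.
    by apply/eqP; apply: contraTT sel' => nE; rewrite selE // (forallP e0 l).
  exists D, j; rewrite cj eE; split => //.
  + exact: loc_below loc.
  + move=> l1 /selN nsel; have := loc_top loc (esym eE) l1; by rewrite residue_unsel.
  + move=> G EG GD; have [l1 h1] := loc_chain loc EG GD.
    by exists l1; exact: le_trans h1 (residue_le _ _ _).
  + move=> b' G EG b'D Gempty [l1 sel1].
    have nE : b' :: G != E by apply: contraTneq EG => <-; rewrite suffix_consN.
    rewrite selE // in sel1.
    have [|l2 h2] := loc_chain loc (Q := b' :: G) _ b'D.
      by rewrite suffix_consr EG orbT.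
    have nsel2 : ~~ sel (b' :: G) l2.
      by apply: residue_neq0; apply: lt_le_trans h2; rewrite mulr_gt0.
    have [/(uneven_le kMM0)//|[e1 /same e2]] := st_part st sel1 nsel2.
    by rewrite e1 e2 eqxx in nE.
- move=> _; have [h|h] := EM (located (residue sel) M0 D0 E0).
    have [sel0 [g0 h1 h2]] := st_settled st h; exists sel0; split => //.
      by move=> Q l /h1/selW.
    move=> Q l /orP[/h2|/andP[/eqP -> _]]; last by right.
    by rewrite (same h).
  exists sel; split => //; first by right; exists M0;
    [exact: st_gt0 st|exact: run_state_tame h].
  by move=> Q l /orP[|/andP[/eqP -> _]]; [left|right].
Qed.

(** While the run exhausts a cube, all its selections are in this cube; before and
    after, it is settled. *)
Lemma run_near_settled (sel : nat -> seq B -> I -> bool) :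
  empty_sel (sel 0%N) ->
  (forall m, sel m.+1 = sel m \/ exists M D E i,
     picked (residue (sel m)) M D E i /\ sel m.+1 = select (sel m) E i) ->
  forall m, exists sel0 E0, [/\ settled sel0,
    forall Q i, sel0 Q i -> sel m Q i & forall Q i, sel m Q i -> sel0 Q i \/ Q = E0].
Proof.
move=> sel0 step m.
suff [e|[M [D [E /run_state_near//]]]] : empty_sel (sel m) \/ exists M D E,
  run_state (sel m) M D E.
  by exists (sel m), [::]; split => //; [left|left].
elim: m => [|m IH]; first by left.
have [->//|[M [D [E [i [pk ->]]]]]] := step m.
right; exists M, D, E; case: IH => [e|[M0 [D0 [E0 st]]]].
  exact: run_state_step (run_state_init e (pick_loc pk)) pk.
exact: run_state_step st pk.
Qed.
End Run.

(** * Geometry and order of the dyadic cubes *)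

Local Open Scope classical_set_scope.

Section Cube.
Context (R : realType) (d : nat).
Notation B := {ffun 'I_d -> bool}.
Implicit Types (Q P : seq B) (b : B) (k : 'I_d) (x : Rspace R d).

(** The head of a word is the last subdivision, so that [b :: Q] is a child of [Q]
    and [suffix Q P] means that the cube of [P] is contained in that of [Q]. *)
Fixpoint corner_index Q k : nat := if Q is b :: Q' then (corner_index Q' k).*2 + b k
  else 0.

Lemma corner_index_lt Q k : (corner_index Q k < 2 ^ size Q)%N.
Proof.
elim: Q => //= b Q IH; rewrite expnS mul2n.
rewrite (@leq_trans (corner_index Q k).+1.*2) ?leq_double //.
by rewrite doubleS ltnS -[(corner_index Q k).*2.+1]addn1 leq_add2l leq_b1.
Qed.

Definition word_cube Q : dcube d := DCube [ffun k => Ordinal (corner_index_lt Q k)].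

Lemma lo_word_cube Q k : lo R (word_cube Q) k = (corner_index Q k)%:R / 2 ^+ size Q.
Proof. by rewrite /lo ffunE. Qed.

Lemma hi_word_cube Q k : hi R (word_cube Q) k = lo R (word_cube Q) k + (2 ^+ size Q)^-1.
Proof. by rewrite /hi ffunE /= lo_word_cube -addn1 natrD mulrDl mul1r. Qed.

Definition mid Q k : R := lo R (word_cube Q) k + (2 ^+ (size Q).+1)^-1.

Let half n : (2 ^+ n : R)^-1 = (2 ^+ n.+1)^-1 + (2 ^+ n.+1)^-1.
Proof. by rewrite exprSr invfM; exact: splitr. Qed.

Lemma lo_cons b Q k :
  lo R (word_cube (b :: Q)) k = if b k then mid Q k else lo R (word_cube Q) k.
Proof.
rewrite /mid !lo_word_cube /= natrD -mul2n natrM exprS.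
rewrite mulrDl -mulf_div divff // mul1r; case: (b k); first by rewrite mul1r.
by rewrite mul0r addr0.
Qed.

Lemma hi_cons b Q k :
  hi R (word_cube (b :: Q)) k = if b k then hi R (word_cube Q) k else mid Q k.
Proof.
rewrite !hi_word_cube lo_cons /mid /=; case: (b k) => //.
by rewrite (half (size Q)) addrA.
Qed.

Lemma lo_lt_hi Q k : lo R (word_cube Q) k < hi R (word_cube Q) k.
Proof. by rewrite hi_word_cube ltrDl invr_gt0 exprn_gt0. Qed.

Lemma mid_in Q k : lo R (word_cube Q) k < mid Q k < hi R (word_cube Q) k.
Proof.
by rewrite hi_word_cube /mid (half (size Q)) addrA !ltrDl invr_gt0 exprn_gt0.
Qed.

(** The child of [Q] that contains [x], when [Q] does. *)
Definition bit Q x : B := [ffun k => mid Q k <= tnth x k].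

Lemma cube_cons b Q x :
  cube_set (word_cube (b :: Q)) x <-> cube_set (word_cube Q) x /\ b = bit Q x.
Proof.
rewrite /cube_set /=; split => [h|[h ->]] => [|k]; last first.
  rewrite lo_cons hi_cons ffunE; have /andP[h1 h2] := h k.
  by case: (leP (mid Q k)) => h3 /=; apply/andP.
split=> [k|].
  have := h k; rewrite lo_cons hi_cons; have /andP[h1 h2] := mid_in Q k.
  by case: (b k) => /andP[h3 h4]; apply/andP; split => //;
    [exact: ltW (lt_le_trans h1 h3)|exact: lt_trans h4 h2].
apply/ffunP => k; rewrite ffunE; have := h k; rewrite lo_cons hi_cons.
by case: (b k) => /andP[h3 h4]; [rewrite h3|rewrite leNgt h4].
Qed.

Lemma cube_suffix Q P : suffix Q P ->
  cube_set (R := R) (word_cube P) `<=` cube_set (word_cube Q).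
Proof.
move=> /suffixP[s ->]; elim: s => //= b s IH x /cube_cons[h _]; exact: IH.
Qed.

Lemma cube_uniq Q P x :
  cube_set (word_cube Q) x -> cube_set (word_cube P) x -> size Q = size P -> Q = P.
Proof.
elim: Q P => [|b Q IH] [|b' P] //= /cube_cons[hQ ->] /cube_cons[hP ->] [hs].
by rewrite (IH P).
Qed.

Lemma cube_meet Q P x :
  cube_set (word_cube Q) x -> cube_set (word_cube P) x -> suffix Q P || suffix P Q.
Proof.
wlog QP : Q P / (size Q <= size P)%N.
  move=> H hQ hP; case/orP: (leq_total (size Q) (size P)) => h; first exact: H.
  by rewrite orbC; apply: H.
move=> hQ hP; apply/orP; left.
pose n := (size P - size Q)%N.
have dP : suffix (drop n P) P by exact: suffix_drop.
suff -> : Q = drop n P by [].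
by apply: (cube_uniq hQ (cube_suffix dP hP)); rewrite size_drop subKn.
Qed.

Definition corner Q : Rspace R d := [tuple lo R (word_cube Q) k | k < d].

Lemma cube_corner Q : cube_set (word_cube Q) (corner Q).
Proof. by move=> k; rewrite tnth_mktuple lexx lo_lt_hi. Qed.

Lemma cube_root x : cube_set (word_cube [::]) x <-> forall k, 0 <= tnth x k < 1.
Proof.
split=> h k; have := h k; rewrite hi_word_cube lo_word_cube /= expr0 mul0r invr1
  add0r //.
Qed.

(** The binary digits of the positions, read from the last one, form the word. *)
Lemma word_cube_surj (I : dcube d) : exists Q, I = word_cube Q.
Proof.
suff H n (p : 'I_d -> nat) : (forall k, p k < 2 ^ n)%N ->
    exists2 Q, size Q = n & forall k, corner_index Q k = p k.
  case: I => n p; have [|Q e h] := H n (fun k => p k); first by move=> k;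
    exact: ltn_ord.
  exists Q; rewrite /word_cube; subst n; congr DCube; apply/ffunP => k.
  by rewrite ffunE; apply/val_inj; rewrite /= h.
elim: n p => [|n IH] p hp.
  by exists [::] => // k; have := hp k; rewrite expn0 ltnS leqn0 => /eqP ->.
have [|Q e h] := IH (fun k => (p k)./2).
  by move=> k; rewrite ltn_half_double -mul2n -expnS.
exists ([ffun k => odd (p k)] :: Q); first by rewrite /= e.
by move=> k; rewrite /= h ffunE addnC odd_double_half.
Qed.

Lemma word_cube_inj : injective word_cube.
Proof.
move=> Q P e; have := cube_corner P; rewrite -e => h.
exact: (cube_uniq h (cube_corner P)) (congr1 (@level d) e).
Qed.

Hypothesis d_gt0 : (0 < d)%N.

(** Two cubes with a common point are comparable. If [Q] were strictly inside [P],
    a child of [P] other than the one containing [Q] would have points outside [Q];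
    with [d = 0] there is no other child. *)
Lemma cube_subset Q P :
  (cube_set (R := R) (word_cube P) `<=` cube_set (word_cube Q)) <-> suffix Q P.
Proof.
split => [h|]; last exact: cube_suffix.
have /orP[//|PQ] := cube_meet (h _ (cube_corner P)) (cube_corner P).
have [->|nPQ] := eqVneq P Q; first exact: suffix_refl.
have [b bQ] := suffix_child PQ nPQ.
pose b' : B := [ffun k => ~~ b k].
have /(cube_suffix bQ)/cube_cons[_ e1] : cube_set (word_cube Q) (corner (b' :: P)).
  by apply: h; have /cube_cons[] := cube_corner (b' :: P).
have /cube_cons[_ e2] := cube_corner (b' :: P).
have := congr1 (fun f : B => f (Ordinal d_gt0)) (etrans e1 (esym e2)).
by rewrite ffunE; case: (b _).
Qed.

Lemma interval_prec_trans (a1 b1 a2 b2 a3 b3 : R) :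
  interval_prec a1 b1 a2 b2 -> interval_prec a2 b2 a3 b3 ->
  interval_prec a1 b1 a3 b3.
Proof.
rewrite /interval_prec => -[h|[h h']] [g|[g g']]; [left|left|left|right; split]; lra.
Qed.

Lemma cube_prec_trans : forall I J K : dcube d,
  cube_prec R I J -> cube_prec R J K -> cube_prec R I K.
Proof.
move=> I J K [k [hk pk]] [l [hl pl]].
have [kl|lk|kl] := ltngtP k l.
- exists k; split => [m mk|].
    by have [-> ->] := hk m mk; apply: hl; exact: ltn_trans kl.
  by have [<- <-] := hl k kl.
- exists l; split => [m ml|].
    by have [-> ->] := hk m (ltn_trans ml lk); exact: hl.
  by have [-> ->] := hk l lk.
- have e := val_inj kl; subst l; exists k; split => [m mk|].
    by have [-> ->] := hk m mk; exact: hl.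
  exact: interval_prec_trans pk pl.
Qed.

Lemma cube_prec_irr (I : dcube d) : ~ cube_prec R I I.
Proof. by move=> [k [_ [|[_]]]]; rewrite ltxx. Qed.

Lemma cube_prec_total Q P :
  [\/ Q = P, cube_prec R (word_cube Q) (word_cube P) | cube_prec R (word_cube P)
    (word_cube Q)].
Proof.
pose same k := (lo R (word_cube Q) k == lo R (word_cube P) k) && (hi R (word_cube Q)
  k == hi R (word_cube P) k).
have [/existsP[k0 hk0]|] := boolP [exists k, ~~ same k]; last first.
  rewrite negb_exists => /forallP h; apply: Or31.
  have e k : lo R (word_cube Q) k = lo R (word_cube P) k /\ hi R (word_cube Q) k = hi
    R (word_cube P) k.
    by have := h k; rewrite negbK => /andP[/eqP -> /eqP ->].
  have hc : cube_set (word_cube P) (corner Q).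
    by move=> k; have [<- <-] := e k; have := cube_corner Q k.
  apply: (cube_uniq (cube_corner Q) hc); have := e (Ordinal d_gt0).
  rewrite !hi_word_cube => -[-> /addrI /invr_inj].
  by apply: ieexprIn; rewrite ?ltr0n // pnatr_eq1.
case: (@arg_minnP _ k0 (fun k => ~~ same k) val hk0) => k nk kmin.
have below (l : 'I_d) : (l < k)%N ->
  lo R (word_cube Q) l = lo R (word_cube P) l /\ hi R (word_cube Q) l = hi R
  (word_cube P) l.
  move=> lk; have : same l by apply: contraTT lk => /kmin; rewrite -leqNgt.
  by move=> /andP[/eqP -> /eqP ->].
have below' (l : 'I_d) : (l < k)%N ->
  lo R (word_cube P) l = lo R (word_cube Q) l /\ hi R (word_cube P) l = hi R
  (word_cube Q) l.
  by move=> /below[-> ->].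
suff [h|h] : interval_prec (lo R (word_cube Q) k) (hi R (word_cube Q) k) (lo R
  (word_cube P) k) (hi R (word_cube P) k) \/
    interval_prec (lo R (word_cube P) k) (hi R (word_cube P) k) (lo R (word_cube Q)
      k) (hi R (word_cube Q) k).
- by apply: Or32; exists k.
- by apply: Or33; exists k.
move: nk; rewrite /same /interval_prec.
move: (lo R (word_cube Q) k) (hi R (word_cube Q) k) (lo R (word_cube P) k) (hi R
  (word_cube P) k) => a1 b1 a2 b2.
have [h|h|h] := ltgtP (b1 - a1) (b2 - a2); [by right; left|by left; left|].
have [h'|h'|h'] := ltgtP a1 a2; [by left; right|by right; right|].
by subst a2; move: h => /addIr ->; rewrite eqxx.
Qed.

Lemma first_cube (L : seq (seq B)) : L != [::] -> exists2 D, D \in L &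
  forall Q, Q \in L -> Q = D \/ cube_prec R (word_cube D) (word_cube Q).
Proof.
elim: L => // Q [|P L] IH _.
  by exists Q; rewrite ?mem_head // => Q'; rewrite inE => /eqP ->; left.
have [//|D DL Dmin] := IH.
have [e|h|h] := cube_prec_total Q D.
- exists D; first by rewrite inE DL orbT.
  by move=> Q'; rewrite inE => /predU1P[->|/Dmin//]; left.
- exists Q; first exact: mem_head.
  move=> Q'; rewrite inE => /predU1P[->|/Dmin[->|h']]; [by left|by right|right].
  exact: cube_prec_trans h'.
- exists D; first by rewrite inE DL orbT.
  by move=> Q'; rewrite inE => /predU1P[->|/Dmin//]; right.
Qed.

End Cube.

(** * Signs and values of the Haar functions *)

Lemma nat_bits_inj n i j : (i < 2 ^ n)%N -> (j < 2 ^ n)%N ->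
  (forall m, (m < n)%N -> odd (i %/ 2 ^ m) = odd (j %/ 2 ^ m)) -> i = j.
Proof.
elim: n i j => [|n IH] i j; first by rewrite expn0 !ltnS !leqn0 => /eqP -> /eqP ->.
move=> hi hj h; rewrite -[i]odd_double_half -[j]odd_double_half.
have := h 0%N isT; rewrite expn0 !divn1 => ->; congr (_ + _.*2)%N.
apply: IH; rewrite ?ltn_half_double -?mul2n -?expnS // => m mn.
by have := h m.+1 mn; rewrite expnS !divnMA !divn2.
Qed.

Section Sign.
Context (R : realType) (d : nat).
Notation B := {ffun 'I_d -> bool}.
Implicit Types (Q P : seq B) (b e : B) (k : 'I_d) (x : Rspace R d).

Definition walsh e b : R := \prod_k (-1) ^+ (e k && b k).
Definition digits (j : nat) : B := [ffun k => digit j k].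
Definition haar_sign j b : R := walsh (digits j) b.

Lemma walshC e b : walsh e b = walsh b e.
Proof. by apply: eq_bigr => k _; rewrite andbC. Qed.

Lemma norm_walsh e b : `|walsh e b| = 1.
Proof.
by rewrite normr_prod big1 // => k _; rewrite normrX normrN1 expr1n.
Qed.

Lemma haar_sign0 b : haar_sign 0 b = 1.
Proof. by rewrite /haar_sign /walsh big1 // => k _; rewrite ffunE /digit div0n. Qed.

(** The sum factors over the coordinates, and a coordinate where [e] and [e'] differ
    gives the factor 0. *)
Lemma walsh_orth e e' : \sum_b walsh e b * walsh e' b = (2 ^+ d) *+ (e == e').
Proof.
pose F k (v : bool) : R := (-1) ^+ (e k && v) * (-1) ^+ (e' k && v).
rewrite (eq_bigr (fun b : B => \prod_k F k (b k))); last first.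
  by move=> b _; rewrite /walsh -big_split.
rewrite -(bigA_distr_bigA F) /=.
have FE k : \sum_v F k v = 2 *+ (e k == e' k).
  rewrite big_bool /F !andbF !andbT /= expr0 mulr1.
  by case: (e k); case: (e' k);
    rewrite /= ?expr1 ?expr0 ?mulr1 ?mul1r ?mulrNN ?mulr1 ?addNr.
rewrite (eq_bigr _ (fun k _ => FE k)).
have [->|ne] := eqVneq e e'.
  by under eq_bigr do rewrite eqxx; rewrite prodr_const card_ord.
have [/existsP[k nk]|] := boolP [exists k, e k != e' k].
  by rewrite (bigD1 k) //= (negbTE nk) mul0r.
rewrite negb_exists => /forallP h; case/eqP: ne; apply/ffunP => k.
by apply/eqP; move: (h k); rewrite negbK.
Qed.

Lemma digits_inj (i j : nat) : (i < 2 ^ d)%N -> (j < 2 ^ d)%N ->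
  digits i = digits j -> i = j.
Proof.
move=> hi hj e; apply: (nat_bits_inj hi hj) => m md.
have h : (d - m.+1 < d)%N by rewrite ltn_subrL /= (leq_trans _ md).
have := congr1 (fun f : B => f (Ordinal h)) e; rewrite !ffunE /digit /=.
by have -> : (d - (d - m.+1).+1 = m)%N by rewrite subnSK // subKn // ltnW.
Qed.

Lemma haar_sign_orth i j : (i < 2 ^ d)%N -> (j < 2 ^ d)%N ->
  \sum_b haar_sign i b * haar_sign j b = (2 ^+ d) *+ (i == j).
Proof.
move=> hi hj; rewrite walsh_orth; congr (_ *+ nat_of_bool _).
by apply/eqP/eqP => [|->//]; exact: digits_inj.
Qed.

Lemma sum_haar_sign j : haar_index d j -> \sum_b haar_sign j b = 0.
Proof.
move=> /andP[j1 jd]; have jlt : (j < 2 ^ d)%N by rewrite -(subnK (expn_gt0 2 d))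
  addn1 ltnS.
rewrite (eq_bigr (fun b => haar_sign j b * haar_sign 0 b)); last by move=> b _;
  rewrite haar_sign0 mulr1.
by rewrite haar_sign_orth ?expn_gt0 // (gtn_eqF j1).
Qed.

(** The other orthogonality relation of the Walsh matrix, which is symmetric once its
    rows are indexed by binary digits. *)
Lemma haar_sign_dual b b' :
  \sum_(0 <= j < 2 ^ d) haar_sign j b * haar_sign j b' = (2 ^+ d) *+ (b == b').
Proof.
rewrite big_mkord -walsh_orth; pose f (j : 'I_(2 ^ d)) := digits j.
have f_inj : injective f by move=> i j /digits_inj h; apply/val_inj/h; exact: ltn_ord.
have [g fK gK] : bijective f.
  by apply: inj_card_bij => //; rewrite card_ffun card_bool !card_ord.
rewrite (reindex f); last by exists g => ? _; [exact: fK|exact: gK].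
by apply: eq_bigr => j _; rewrite /haar_sign !(walshC (digits j)).
Qed.

Definition cube_ind Q : Rspace R d -> R := \1_(cube_set (word_cube Q)).

Lemma cube_indE Q x : cube_ind Q x = (x \in cube_set (word_cube Q))%:R.
Proof. by rewrite /cube_ind indicE. Qed.

Lemma cube_ind_cons b Q x : cube_ind (b :: Q) x = cube_ind Q x * (b == bit Q x)%:R.
Proof.
rewrite !cube_indE -natrM mulnb; congr (_%:R); congr nat_of_bool.
apply/idP/andP => [/set_mem/cube_cons[h ->]|[/set_mem h /eqP e]].
  by split => //; exact: mem_set.
by apply/mem_set/cube_cons.
Qed.

Lemma sum_cube_ind (u : B ->
  R) Q x : \sum_b u b * cube_ind (b :: Q) x = u (bit Q x) * cube_ind Q x.
Proof.
rewrite (bigD1 (bit Q x)) //= cube_ind_cons eqxx mulr1 big1 ?addr0 // => b nb.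
by rewrite cube_ind_cons (negbTE nb) !mulr0.
Qed.

Lemma rfunE eps Q k (y : R) :
  rfun eps (lo R (word_cube Q) k) (hi R (word_cube Q) k) y =
  (-1) ^+ (eps && (mid R Q k <= y)) * 2 ^+ size Q *
  ((lo R (word_cube Q) k <= y < hi R (word_cube Q) k)%R : bool)%:R.
Proof.
rewrite /rfun !indicE.
have -> : hi R (word_cube Q) k - lo R (word_cube Q) k = (2 ^+ size Q)^-1 by rewrite
  hi_word_cube addrC addKr.
have -> : (lo R (word_cube Q) k + hi R (word_cube Q) k) / 2 = mid R Q k.
  rewrite hi_word_cube addrA -mulr2n mulrDl -[lo _ _ _ *+ 2]mulr_natr mulfK
    ?pnatr_eq0 // /mid; congr (_ + _).
  by rewrite exprSr invfM.
rewrite invrK !set_itvE /=.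
have /andP[h1 h2] := mid_in R Q k.
have mem (a b' : R) : (y \in [set x | a <= x < b']) = (a <= y < b').
  by apply/idP/idP => [/set_mem//|h]; exact: mem_set.
rewrite !mem; case: eps => /=; last by rewrite expr0 mul1r mulrC.
have [my|ym] := leP (mid R Q k) y.
  by rewrite andbF sub0r (le_trans (ltW h1) my) expr1 /= mulN1r !mulNr mulrC.
by rewrite (lt_trans ym h2) !andbT /= subr0 expr0 mul1r mulrC.
Qed.

Lemma haarE Q j x :
  haar (word_cube Q) j x = haar_sign j (bit Q x) * 2 ^+ (d * size Q) * cube_ind Q x.
Proof.
rewrite /haar; under eq_bigr do rewrite rfunE.
rewrite !big_split /= prodr_const card_ord -exprM mulnC; congr (_ * _ * _).
  by apply: eq_bigr => k _; rewrite !ffunE.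
rewrite cube_indE; have [/set_mem h|/negP h] := boolP (x \in cube_set (word_cube Q)).
  by rewrite big1 // => k _; rewrite h.
have [/existsP[k nk]|] := boolP [exists k,
  ~~ (lo R (word_cube Q) k <= tnth x k < hi R (word_cube Q) k)].
  by rewrite (bigD1 k) //= (negbTE nk) mul0r.
rewrite negb_exists => /forallP h'; case: h; apply: mem_set => k.
by move: (h' k); rewrite negbK.
Qed.

Lemma haar_cube_ind Q j x :
  haar (word_cube Q) j x = \sum_b haar_sign j b * 2 ^+ (d * size Q) * cube_ind (b ::
    Q) x.
Proof. by rewrite haarE (sum_cube_ind (fun b => haar_sign j b * _)). Qed.

End Sign.

(** * Integrals over dyadic cubes *)

Section Mass.
Context (R : realType) (d : nat).
Notation B := {ffun 'I_d -> bool}.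
Notation mu := (lebesgue_tuple R d).
Notation unit := (@unit_cube R d).
Notation cube_ind := (@cube_ind R d).
Implicit Types (Q P : seq B) (b e : B) (k : 'I_d) (x : Rspace R d).
Implicit Types f g : Rspace R d -> R.

Lemma measurable_box (A : 'I_d -> set (measurableTypeR R)) :
  (forall k, measurable (A k)) ->
  measurable [set x : Rspace R d | forall k, A k (tnth x k)].
Proof.
move=> mA; rewrite (_ : [set _ | _] = \bigcap_(i in [set: 'I_d])
    ((@tnth d _ ^~ i) @^-1` A i)).
  apply: fin_bigcap_measurable => // i _.
  by rewrite -[X in measurable X]setTI; exact: measurable_tnth.
by apply/seteqP; split => x h i; [move=> _; exact: (h i)|exact: (h i I)].
Qed.

Lemma cube_box Q : cube_set (word_cube Q) =
  [set x : Rspace R d | forall k, `[lo R (word_cube Q) k,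
    hi R (word_cube Q) k[%classic (tnth x k)].
Proof. by apply/seteqP; split => x h k; have := h k; rewrite /= in_itv. Qed.

Lemma unit_box : unit = [set x : Rspace R d | forall k, `[0, 1]%classic (tnth x k)].
Proof. by apply/seteqP; split => x h k; have := h k; rewrite /= in_itv. Qed.

Lemma measurable_cube Q : measurable (cube_set (word_cube Q) : set (Rspace R d)).
Proof.
rewrite cube_box.
by apply: (measurable_box (A := fun k => `[lo R (word_cube Q) k,
  hi R (word_cube Q) k[%classic)).
Qed.

Lemma measurable_unit : measurable unit.
Proof.
by rewrite unit_box; apply: (measurable_box (A := fun k => `[0, 1]%classic)).
Qed.
Hint Resolve measurable_cube measurable_unit : core.

Lemma mu_cube Q : mu (cube_set (word_cube Q)) = ((2 ^+ (d * size Q))^-1)%:E.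
Proof.
rewrite cube_box.
rewrite (lebesgue_tuple_box (A := fun k => `[lo R (word_cube Q) k,
  hi R (word_cube Q) k[%classic)) //.
rewrite (eq_bigr (fun=> ((2 ^+ size Q)^-1 : R)%:E)) => [|k _]; last first.
  by rewrite lebesgue_measure_itv /= lte_fin lo_lt_hi hi_word_cube -EFinD addrC addKr.
by rewrite prodEFin prodr_const card_ord -exprVn -exprM mulnC exprVn.
Qed.

Lemma mu_unit : mu unit = 1%E.
Proof.
rewrite unit_box (lebesgue_tuple_box (A := fun k => `[0, 1]%classic)) //.
rewrite big1 // => k _.
by rewrite lebesgue_measure_itv /= lte_fin ltr01 oppr0 adde0.
Qed.

Lemma cube_unit Q : cube_set (word_cube Q) `<=` unit.
Proof.
move=> x h k; have /(cube_root (R := R))/(_ k)/andP[-> /ltW ->//] : cube_set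
  (word_cube [::]) x.
by apply: cube_suffix h; rewrite suffix0s.
Qed.

(** The norm is taken over the closed cube, the Haar functions live on the half-open
    one. *)
Lemma unit_root_null : mu (unit `\` cube_set (word_cube [::])) = 0%E.
Proof.
have diff_null dT (T : measurableType dT) (m : {measure set T ->
  \bar R}) (A C : set T) :
    measurable A -> measurable C -> C `<=` A -> m A = 1%E -> m C = 1%E ->
      m (A `\` C) = 0%E.
  move=> mA mC CA A1 C1.
  have A1' : (m : {content set T -> \bar R}) A = 1%E by exact: A1.
  have C1' : (m : {content set T -> \bar R}) C = 1%E by exact: C1.
  by rewrite measureD // ?setIidr // ?A1' ?C1' ?subee ?ltry.
apply: diff_null => //; [exact: cube_unit|exact: mu_unit|].
by have := mu_cube [::]; rewrite muln0 expr0 invr1.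
Qed.

Lemma L1D f g : L1 f -> L1 g -> L1 (fun x => f x + g x).
Proof. by move=> hf hg; exact: (integrableD measurable_unit hf hg). Qed.

Lemma L1Z (r : R) f : L1 f -> L1 (fun x => r * f x).
Proof. by move=> hf; exact: (integrableZl measurable_unit r hf). Qed.

Lemma L1B f g : L1 f -> L1 g -> L1 (fun x => f x - g x).
Proof. by move=> hf hg; exact: (integrableB measurable_unit hf hg). Qed.

Lemma L1_0 : L1 (fun _ : Rspace R d => 0 : R).
Proof. exact: integrable0. Qed.

Lemma L1_sum (J : Type) (r : seq J) (p : pred J) (F : J -> Rspace R d -> R) :
  (forall j, p j -> L1 (F j)) -> L1 (fun x => \sum_(j <- r | p j) F j x).
Proof.
move=> h; elim: r => [|j r IH].
  by under eq_fun do rewrite big_nil; exact: L1_0.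
under eq_fun do rewrite big_cons.
by have [pj|//] := boolP (p j); exact: L1D (h _ pj) IH.
Qed.

Lemma L1_norm f : L1 f -> L1 (fun x => `|f x|).
Proof. by move=> hf; exact: (integrable_norm hf). Qed.

Lemma L1_cst (r : R) : L1 (fun _ : Rspace R d => r).
Proof.
apply: measurable_bounded_integrable => //.
  by apply: (@le_lt_trans _ _ 1%E); rewrite ?ltry // -mu_unit.
exists `|r|; split; first exact: num_real.
by move=> M M1 x _; exact: ltW.
Qed.

Lemma L1M_indic f (A : set (Rspace R d)) : measurable A -> L1 f ->
  L1 (fun x => f x * \1_A x).
Proof.
move=> mA hf; rewrite /L1 (_ : _ \o _ = (EFin \o f) \* (EFin \o \1_A))%E //.
apply: (integrableMl measurable_unit hf); first exact: measurable_indic.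
exists 1; split; first exact: num_real.
by move=> M M1 x _; rewrite /= indicE; apply: le_trans (ltW M1); case: (_ \in _);
  rewrite ?normr1 ?normr0.
Qed.

Lemma L1M_cube_ind f Q : L1 f -> L1 (fun x => f x * cube_ind Q x).
Proof. exact: L1M_indic. Qed.

Lemma L1_indic (A : set (Rspace R d)) : measurable A -> L1 (\1_A : Rspace R d -> R).
Proof.
move=> mA; have := L1M_indic mA (L1_cst 1).
by under eq_fun do rewrite mul1r.
Qed.

Lemma L1_cube_ind Q : L1 (cube_ind Q).
Proof. exact: L1_indic. Qed.

Lemma meanD f g : L1 f -> L1 g -> mean (fun x => f x + g x) = mean f + mean g.
Proof. by move=> hf hg; rewrite /mean RintegralD. Qed.

Lemma meanB f g : L1 f -> L1 g -> mean (fun x => f x - g x) = mean f - mean g.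
Proof. by move=> hf hg; rewrite /mean RintegralB. Qed.

Lemma meanZ (r : R) f : L1 f -> mean (fun x => r * f x) = r * mean f.
Proof. by move=> hf; rewrite /mean RintegralZl. Qed.

Lemma mean0 : mean (fun _ : Rspace R d => 0 : R) = 0.
Proof. by rewrite /mean /Rintegral integral0. Qed.

Lemma mean_sum (J : Type) (r : seq J) (p : pred J) (F : J -> Rspace R d -> R) :
  (forall j, p j -> L1 (F j)) ->
  mean (fun x => \sum_(j <- r | p j) F j x) = \sum_(j <- r | p j) mean (F j).
Proof.
move=> h; elim: r => [|j r IH].
  by rewrite big_nil -[RHS]mean0; congr mean; apply/funext => x; rewrite big_nil.
rewrite big_cons -IH; have [pj|npj] := boolP (p j).
  rewrite -meanD //; [|exact: h|exact: L1_sum].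
  by congr mean; apply/funext => x; rewrite big_cons pj.
by congr mean; apply/funext => x; rewrite big_cons (negbTE npj).
Qed.

Lemma mean_le f g : L1 f -> L1 g -> (forall x, f x <= g x) -> mean f <= mean g.
Proof. by move=> hf hg h; rewrite /mean le_Rintegral. Qed.

Lemma mean_ge0 f : (forall x, 0 <= f x) -> 0 <= mean f.
Proof. by move=> h; exact: Rintegral_ge0. Qed.

Lemma mean_norm f : L1 f -> `|mean f| <= mean (fun x => `|f x|).
Proof. by move=> hf; exact: le_normr_Rintegral. Qed.

Lemma L1normE f : L1 f -> L1norm f = (mean (fun x => `|f x|))%:E.
Proof.
move=> hf; rewrite /mean /Rintegral fineK //.
exact: (integrable_fin_num measurable_unit (L1_norm hf)).
Qed.

Lemma mean_cube f Q : mean (fun x => f x * cube_ind Q x) = \int[mu]_(x in cube_set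
  (word_cube Q)) f x.
Proof.
rewrite -[in RHS](setIidr (@cube_unit Q)) Rintegral_mkcondr.
by apply: eq_Rintegral => x _; rewrite patch_indic.
Qed.

Lemma mean_cube_ind Q : mean (cube_ind Q) = (2 ^+ (d * size Q))^-1.
Proof.
transitivity (mean (fun x => 1 * cube_ind Q x)).
  by congr mean; apply/funext => x; rewrite mul1r.
by rewrite mean_cube Rintegral_cst // mul1r; exact: (congr1 fine (mu_cube Q)).
Qed.

Lemma mean_root f : L1 f -> mean (fun x => f x * cube_ind [::] x) = mean f.
Proof.
move=> hf; rewrite mean_cube /mean /Rintegral.
rewrite [in RHS](negligible_integral (measurableD measurable_unit (measurable_cube
  [::])) _ hf unit_root_null) //.
by rewrite setDD setIidr //; exact: cube_unit.
Qed.

Definition mass f Q := mean (fun x => f x * cube_ind Q x).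

Lemma mass_add f Q : L1 f -> \sum_b mass f (b :: Q) = mass f Q.
Proof.
move=> hf; rewrite -mean_sum; last by move=> b _; exact: L1M_cube_ind.
congr mean; apply/funext => x.
exact: (sum_cube_ind (fun=> f x)).
Qed.

Lemma massD f g Q : L1 f -> L1 g -> mass (fun x => f x + g x) Q = mass f Q + mass g Q.
Proof.
move=> hf hg; rewrite -meanD; [|exact: L1M_cube_ind..].
by congr mean; apply/funext => x; rewrite mulrDl.
Qed.

Lemma massZ r f Q : L1 f -> mass (fun x => r * f x) Q = r * mass f Q.
Proof.
move=> hf; rewrite -meanZ; last exact: L1M_cube_ind.
by congr mean; apply/funext => x; rewrite mulrA.
Qed.

Lemma norm_mass f Q : L1 f -> `|mass f Q| <= mass (fun x => `|f x|) Q.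
Proof.
move=> hf; apply: (le_trans (mean_norm (L1M_cube_ind _ hf))).
rewrite (_ : (fun x => `|f x * cube_ind Q x|) = (fun x => `|f x| * cube_ind Q x)) //.
by apply/funext => x; rewrite normrM cube_indE normr_nat.
Qed.

(** The Haar function is constant on each child, and its normalization is
    the inverse of the volume of [Q]. *)
Lemma coefE f Q j : L1 f -> coef f (word_cube Q) j = \sum_b haar_sign R j b * mass f
  (b :: Q).
Proof.
move=> hf; rewrite /coef -mean_cube mu_cube /=.
have -> : (fun x => f x * haar (word_cube Q) j x * cube_ind Q x) =
    (fun x => \sum_b 2 ^+ (d * size Q) * (haar_sign R j b * (f x * cube_ind (b :: Q)
      x))).
  apply/funext => x; have chi2 : cube_ind Q x * cube_ind Q x = cube_ind Q x by
    rewrite cube_indE -natrM mulnb andbb.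
  transitivity (2 ^+ (d * size Q) * (haar_sign R j (bit Q x) * f x) * cube_ind Q x).
    by rewrite haarE -[in RHS]chi2; ring.
  rewrite -(sum_cube_ind (fun b => 2 ^+ (d * size Q) * (haar_sign R j b * f x))).
  by apply: eq_bigr => b _; rewrite !mulrA.
rewrite mean_sum; last by move=> b _; do 2!apply: L1Z; exact: L1M_cube_ind.
rewrite mulr_sumr; apply: eq_bigr => b _.
rewrite meanZ; last by apply: L1Z; exact: L1M_cube_ind.
rewrite meanZ; last exact: L1M_cube_ind.
by rewrite mulKf // expf_neq0.
Qed.

End Mass.

(** * Haar expansions of integrable functions *)

Section HaarExpansion.
Context (R : realType) (d : nat).
Notation B := {ffun 'I_d -> bool}.
Notation I := 'I_(2 ^ d).-1.
Notation cube_ind := (@cube_ind R d).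
Notation haar_sign := (@haar_sign R d).
Implicit Types (Q P E : seq B) (b e : B) (k : 'I_d) (x : Rspace R d).
Implicit Types f g : Rspace R d -> R.

Definition inv_vol Q : R := 2 ^+ (d * size Q).

Lemma inv_vol_gt0 Q : 0 < inv_vol Q. Proof. by rewrite exprn_gt0. Qed.
Lemma inv_vol_neq0 Q : inv_vol Q != 0. Proof. by rewrite gt_eqF // inv_vol_gt0. Qed.
Lemma inv_vol_cons b Q : inv_vol (b :: Q) = 2 ^+ d * inv_vol Q.
Proof. by rewrite /inv_vol /= mulnS exprD. Qed.

Lemma cube_ind_suffix P Q x : suffix P Q -> cube_ind P x * cube_ind Q x = cube_ind Q x.
Proof.
move=> PQ; rewrite !cube_indE -natrM mulnb; congr (_%:R); congr nat_of_bool.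
by apply/andb_idl => /set_mem h; apply/mem_set; exact: cube_suffix h.
Qed.

Lemma cube_ind_disjoint P Q x : ~~ suffix P Q -> ~~ suffix Q P ->
  cube_ind P x * cube_ind Q x = 0.
Proof.
move=> PQ QP; rewrite !cube_indE -natrM mulnb.
case: andP => // -[/set_mem hP /set_mem hQ].
by have := cube_meet hP hQ; rewrite (negbTE PQ) (negbTE QP).
Qed.

Lemma haar_suffix b E i Q x : suffix (b :: E) Q ->
  haar (word_cube E) i x * cube_ind Q x = haar_sign i b * inv_vol E * cube_ind Q x.
Proof.
move=> EQ; rewrite -(cube_ind_suffix x EQ) haarE cube_ind_cons.
have [->|] := eqVneq b (bit E x); rewrite ?(mulr0, mul0r) // mulr1.
by rewrite !mulrA -[X in X * _](mulrA _ (cube_ind E x)) cube_ind_suffix // suffix_refl.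
Qed.

Lemma L1_haar E i : L1 (haar (word_cube E) i : Rspace R d -> R).
Proof.
rewrite (_ : haar _ _ = fun x => \sum_b (haar_sign i b * inv_vol E) * cube_ind (b ::
  E) x).
  by apply: L1_sum => b _; apply: L1Z; exact: L1_cube_ind.
by apply/funext => x; rewrite haar_cube_ind.
Qed.

Lemma mean_haar E i : haar_index d i -> mean (haar (word_cube E) i : Rspace R d ->
  R) = 0.
Proof.
move=> hi; rewrite (_ : haar _ _ = fun x => \sum_b (haar_sign i b * inv_vol E) *
  cube_ind (b :: E) x).
  rewrite mean_sum; last by move=> b _; apply: L1Z; exact: L1_cube_ind.
  rewrite (eq_bigr (fun b => haar_sign i b * (2 ^+ d)^-1));
    first by rewrite -mulr_suml sum_haar_sign ?mul0r.
  move=> b _; rewrite meanZ; last exact: L1_cube_ind.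
  rewrite mean_cube_ind -/(inv_vol _) inv_vol_cons invfM -mulrA; congr (_ * _).
  by rewrite mulrCA mulfV ?mulr1 ?inv_vol_neq0.
by apply/funext => x; rewrite haar_cube_ind.
Qed.

Lemma sum_haar_sign_mass f Q j (m : R) : haar_index d j ->
  (forall b, mass f (b :: Q) = m) -> \sum_b haar_sign j b * mass f (b :: Q) = 0.
Proof.
move=> hj h; rewrite (eq_bigr (fun b => haar_sign j b * m)) => [|b _];
  last by rewrite h.
by rewrite -mulr_suml sum_haar_sign // mul0r.
Qed.

(** Orthonormality. On a single cube it is the orthogonality of the signs. If the
    cubes are strictly nested, the Haar function of the larger one is constant on
    the smaller one, where the other has mean 0. *)
Lemma coef_haar E Q i j : haar_index d i -> haar_index d j ->
  coef (haar (word_cube E) i : Rspace R d ->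
    R) (word_cube Q) j = ((E == Q) && (i == j))%:R.
Proof.
move=> hi hj; rewrite coefE; last exact: L1_haar.
have lt2 l : haar_index d l -> (l < 2 ^ d)%N.
  by move=> /andP[_]; rewrite -ltnS subn1 prednK // expn_gt0.
have massE b b1 Q' : suffix (b1 :: E) (b :: Q') ->
    mass (haar (word_cube E) i) (b :: Q') = haar_sign i b1 * inv_vol E / inv_vol (b
      :: Q').
  move=> h; rewrite -[_ / _]/(_ * (2 ^+ (d * size (b :: Q')))^-1) -mean_cube_ind
    -meanZ; last exact: L1_cube_ind.
  by congr mean; apply/funext => x; exact: haar_suffix.
have [<-|EQ] := eqVneq E Q.
  rewrite (eq_bigr (fun b => (2 ^+ d)^-1 * (haar_sign i b * haar_sign j b)));
    last first.
    move=> b _; rewrite (massE b b E) ?suffix_refl // inv_vol_cons invfM.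
    rewrite [_^-1 / _]mulrC -!mulrA (mulVKf (inv_vol_neq0 E)); ring.
  rewrite -mulr_sumr haar_sign_orth ?lt2 //=; case: (i == j); last by rewrite mulr0.
  by rewrite mulr1n mulVf // expf_neq0.
rewrite /=; have [sEQ|nEQ] := boolP (suffix E Q).
  have [b1 h1] := suffix_child sEQ EQ.
  apply: (@sum_haar_sign_mass _ _ _ (haar_sign i b1 * inv_vol E / (2 ^+ d * inv_vol
    Q))) => // b.
  by rewrite (massE b b1) ?inv_vol_cons // suffix_consr h1 orbT.
have [sQE|nQE] := boolP (suffix Q E); last first.
  apply: (@sum_haar_sign_mass _ _ _ 0) => // b.
  rewrite /mass -[RHS](@mean0 R d); congr mean; apply/funext => x.
  rewrite haarE -mulrA -(@cube_ind_suffix Q (b :: Q)) ?suffix_consr ?suffix_refl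
    ?orbT //.
  by rewrite [X in _ * X]mulrA cube_ind_disjoint // mul0r mulr0.
have [|b1 h1] := suffix_child sQE; first by rewrite eq_sym.
rewrite (bigD1 b1) //= [X in X + _](_ : _ = 0) ?add0r.
  apply: big1 => b nb; rewrite [mass _ _](_ : _ = 0) ?mulr0 //.
  rewrite /mass -[RHS](@mean0 R d); congr mean; apply/funext => x.
  rewrite haarE -mulrA cube_ind_disjoint ?mulr0 //.
    rewrite suffix_consr negb_or; apply/andP; split.
      by apply: contra nb => /eqP e; rewrite e in h1;
        rewrite (suffix_child_inj h1 (suffix_refl _)).
    by apply: contra EQ => h; rewrite (suffix_anti h sQE).
  by apply: contra nb => h; rewrite (suffix_child_inj h h1).
rewrite [mass _ _](_ : _ = 0) ?mulr0 // -(mean_haar E hi); congr mean.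
apply/funext => x; rewrite haarE -mulrA; congr (_ * _).
by rewrite mulrC cube_ind_suffix.
Qed.

Lemma coef_cube_ind_below P Q j : haar_index d j -> suffix P Q ->
  coef (cube_ind P) (word_cube Q) j = 0.
Proof.
move=> hj PQ; rewrite coefE; last exact: L1_cube_ind.
apply: (@sum_haar_sign_mass _ _ _ (2 ^+ d * inv_vol Q)^-1) => // b.
rewrite -(inv_vol_cons b) -mean_cube_ind; congr mean; apply/funext => x.
by rewrite cube_ind_suffix // suffix_consr PQ orbT.
Qed.

Lemma coefD f g Q j : L1 f -> L1 g ->
  coef (fun x => f x + g x) (word_cube Q) j = coef f (word_cube Q) j + coef g
    (word_cube Q) j.
Proof.
move=> hf hg; rewrite !coefE //; last exact: L1D.
by rewrite -big_split; apply: eq_bigr => b _; rewrite massD // mulrDr.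
Qed.

Lemma coefZ r f Q j : L1 f ->
  coef (fun x => r * f x) (word_cube Q) j = r * coef f (word_cube Q) j.
Proof.
move=> hf; rewrite !coefE //; last exact: L1Z.
by rewrite mulr_sumr; apply: eq_bigr => b _; rewrite massZ // mulrCA.
Qed.

Lemma coefB f g Q j : L1 f -> L1 g ->
  coef (fun x => f x - g x) (word_cube Q) j = coef f (word_cube Q) j - coef g
    (word_cube Q) j.
Proof.
move=> hf hg; rewrite -mulN1r -coefZ // -coefD //; last exact: L1Z.
by congr coef; apply/funext => x; rewrite mulN1r.
Qed.

Lemma coef_sum (J : Type) (r : seq J) (p : pred J) (F : J -> Rspace R d -> R) Q j :
  (forall l, p l -> L1 (F l)) ->
  coef (fun x => \sum_(l <- r | p l) F l x) (word_cube Q) j = \sum_(l <- r | p l)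
    coef (F l) (word_cube Q) j.
Proof.
move=> h; rewrite coefE; last exact: L1_sum.
rewrite (eq_bigr (fun l => \sum_b haar_sign j b * mass (F l) (b :: Q))); last first.
  by move=> l /h hl; rewrite coefE.
rewrite exchange_big; apply: eq_bigr => b _ /=; rewrite -mulr_sumr; congr (_ * _).
rewrite -mean_sum; last by move=> l /h; exact: L1M_cube_ind.
by congr mean; apply/funext => x; rewrite mulr_suml.
Qed.

Definition cube_avg f Q : Rspace R d ->
  R^o := fun x => mass f Q * inv_vol Q * cube_ind Q x.
Definition haar_coef f Q (i : I) : R := coef f (word_cube Q) i.+1.
Definition haar_fun Q (i : I) : Rspace R d -> R^o := haar (word_cube Q) i.+1.
Definition norm_le (g : Rspace R d ->
  R^o) (r : R) : Prop := L1 g /\ mean (fun x => `|g x|) <= r.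
Definition nu f Q := mass (fun x => `|f x|) Q.

Lemma haar_index_ord (i : I) : haar_index d i.+1.
Proof. by rewrite /haar_index subn1 ltn_ord. Qed.

Lemma bound_rel_norm_le : bound_rel norm_le.
Proof.
split.
- split; first exact: L1_0.
  rewrite -[leRHS](@mean0 R d) le_eqVlt; apply/orP; left; apply/eqP; congr mean.
  by apply/funext => x; rewrite [X in `|X|](_ : _ = 0) ?normr0.
- move=> f g r q [hf fr] [hg gq]; split; first exact: L1D.
  apply: le_trans (lerD fr gq); rewrite -meanD; [|exact: L1_norm..].
  apply: mean_le; [exact/L1_norm/L1D|by apply: L1D; exact: L1_norm|].
  by move=> x; exact: ler_normD.
- move=> l f r [hf fr]; split; first exact: (L1Z l hf).
  apply: le_trans (ler_wpM2l (normr_ge0 l) fr); rewrite -meanZ; last exact: L1_norm.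
  rewrite le_eqVlt; apply/orP; left; apply/eqP; congr mean.
  by apply/funext => x; rewrite -normrM.
- by move=> f r q [hf fr] rq; split=> //; exact: le_trans rq.
Qed.

(** Completeness of the Haar functions of one cube, including the constant one
    [j = 0], among the functions that are constant on its children. *)
Lemma haar_series f Q x : L1 f ->
  \sum_(0 <= j < 2 ^ d) coef f (word_cube Q) j * haar (word_cube Q) j x = \sum_b
    cube_avg f (b :: Q) x.
Proof.
move=> hf.
rewrite (eq_bigr (fun j => \sum_b \sum_b' (mass f (b :: Q) * inv_vol Q * cube_ind (b'
  :: Q) x) *
    (haar_sign j b * haar_sign j b'))); last first.
  move=> j _; rewrite coefE // haar_cube_ind mulr_suml; apply: eq_bigr => b _.
  rewrite mulr_sumr; apply: eq_bigr => b' _; rewrite -/(inv_vol Q); ring.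
rewrite exchange_big; apply: eq_bigr => b _ /=; rewrite exchange_big /=.
under eq_bigr do rewrite -mulr_sumr haar_sign_dual.
rewrite (bigD1 b) //= eqxx big1 ?addr0 => [|b' nb].
  by rewrite /cube_avg inv_vol_cons mulr1n; ring.
by rewrite eq_sym (negbTE nb) mulr0.
Qed.

Lemma coef0 f Q : L1 f -> coef f (word_cube Q) 0 = mass f Q.
Proof.
by move=> hf; rewrite coefE // -mass_add //; apply: eq_bigr => b _;
  rewrite haar_sign0 mul1r.
Qed.

Lemma haar_fun_sum f Q : L1 f ->
  \sum_i haar_coef f Q i *: haar_fun Q i = \sum_b cube_avg f (b :: Q) - cube_avg f Q.
Proof.
move=> hf; apply/funext => x; apply/eqP; rewrite eq_sym; apply/eqP.
transitivity (\sum_b cube_avg f (b :: Q) x - cube_avg f Q x); first by rewrite fct_sumE.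
rewrite -haar_series // big_ltn ?expn_gt0 // coef0 // haarE haar_sign0 mul1r mulrA.
rewrite addrC addrA addNr add0r fct_sumE -{1}[(2 ^ d)%N]prednK ?expn_gt0 //.
by rewrite big_add1 /= big_mkord.
Qed.

Lemma mass_near f Q P : L1 f -> suffix Q P -> `|mass f Q - mass f P| <= nu f Q - nu f P.
Proof.
move=> hf QP; rewrite -!meanB; [|by apply: L1M_cube_ind; try exact: L1_norm..].
apply: (le_trans (mean_norm _)); first by apply: L1B; exact: L1M_cube_ind.
rewrite le_eqVlt; apply/orP; left; apply/eqP; congr mean; apply/funext => x.
rewrite -!mulrBr normrM; congr (_ * _); apply: ger0_norm.
by rewrite -(cube_ind_suffix x QP) -{1}[cube_ind Q x]mulr1 -mulrBr !cube_indE;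
  do 2!case: (_ \in _);
  rewrite /= ?subrr ?subr0 ?mulr1 ?mul0r ?mulr0.
Qed.

Lemma expansion_L1 f : L1 f ->
  expansion norm_le (nu f) (mass f) (haar_coef f) (cube_avg f) haar_fun.
Proof.
move=> hf; have hn := L1_norm hf.
have nu_ge Q : 0 <= nu f Q by apply: mean_ge0 => x; rewrite mulr_ge0 // cube_indE.
have nuA Q : \sum_b nu f (b :: Q) = nu f Q by exact: mass_add.
have aA Q : \sum_b mass f (b :: Q) = mass f Q by exact: mass_add.
have a_nu Q : `|mass f Q| <= nu f Q by exact: norm_mass.
split => //.
- move=> Q P i QP QnP; have [b bP] := suffix_child QP QnP.
  have h1 := mass_near hf bP.
  have h2 : `|haar_coef f Q i - haar_sign i.+1 b * mass f (b :: Q)| <= nu f Q - nu f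
    (b :: Q).
    rewrite /haar_coef coefE // (bigD1 b) //= addrAC addrN add0r.
    rewrite -(nuA Q) [X in _ <= X - _](bigD1 b) //= addrAC addrN add0r.
    apply: (le_trans (ler_norm_sum _ _ _)); apply: ler_sum => b' _.
    by rewrite normrM norm_walsh mul1r.
  have h3 : `|haar_sign i.+1 b * mass f (b :: Q)| = `|mass f (b :: Q)|.
    by rewrite normrM norm_walsh mul1r.
  have := ler_dist_dist (haar_coef f Q i) (haar_sign i.+1 b * mass f (b :: Q)).
  have := ler_dist_dist (mass f (b :: Q)) (mass f P); rewrite h3 => h4 h5.
  have h6 := ler_normD (`|haar_coef f Q i| - `|mass f (b :: Q)|) (`|mass f (b :: Q)|
    - `|mass f P|).
  rewrite addrA subrK in h6; lra.
- move=> Q; split; first by apply: L1Z; exact: L1_cube_ind.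
  rewrite (_ : (fun x => `|cube_avg f Q x|) = fun x => (`|mass f Q| * inv_vol Q) *
    cube_ind Q x).
    rewrite meanZ; last exact: L1_cube_ind.
    by rewrite mean_cube_ind -/(inv_vol Q) mulfK // inv_vol_neq0.
  by apply/funext => x; rewrite !normrM cube_indE normr_nat (ger0_norm (ltW
    (inv_vol_gt0 Q))).
- move=> Q i; split; first exact: L1_haar.
  rewrite (_ : (fun x => `|haar_fun Q i x|) = fun x => inv_vol Q * cube_ind Q x).
    by rewrite meanZ ?mean_cube_ind -/(inv_vol Q) ?mulfV ?inv_vol_neq0 //;
      exact: L1_cube_ind.
  apply/funext => x; rewrite /haar_fun haarE !normrM norm_walsh mul1r cube_indE
    normr_nat.
  by rewrite (ger0_norm (ltW (inv_vol_gt0 Q))).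
- by move=> Q; exact: haar_fun_sum.
Qed.

End HaarExpansion.

(** * Conditional expectations on dyadic cubes *)

Lemma ndseq_measure_small dT (T : measurableType dT) (R : realType)
    (m : {measure set T -> \bar R}) (A : set T) (F : (set T)^nat) (eps : R) :
  measurable A -> (m A < +oo)%E -> (forall i, measurable (F i)) ->
  {homo F : n k / (n <= k)%N >-> (n <= k)%O} -> 0 < eps ->
  exists n, fine (m ((\bigcup_i F i) `&` A)) - fine (m (F n `&` A)) <= eps.
Proof.
move=> mA Aoo mF ndF e0; pose F' i := F i `&` A.
have mF' i : measurable (F' i) by exact: measurableI.
have ndF' : {homo F' : n k / (n <= k)%N >-> (n <= k)%O}.
  by move=> n k nk; apply/subsetPset; apply: setSI; apply/subsetPset/ndF.
have mU : measurable (\bigcup_i F' i) by exact: bigcup_measurable.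
have := nondecreasing_cvg_mu (mu := m) mF' mU ndF'.
have Ufin : m (\bigcup_i F' i) \is a fin_num.
  rewrite ge0_fin_numE //; apply: le_lt_trans Aoo; apply: le_measure; rewrite ?inE //.
  by apply: bigcup_sub => i _; exact: subIsetr.
rewrite -(fineK Ufin) => /fine_cvg/cvgrPdist_le/(_ _ e0)[N _ /(_ N (leqnn N)) hN].
exists N; rewrite setI_bigcupl; apply: le_trans hN; exact: ler_norm.
Qed.

Section ConditionalExpectation.
Context (R : realType) (d : nat).
Notation B := {ffun 'I_d -> bool}.
Notation cube_ind := (@cube_ind R d).
Notation mu := (lebesgue_tuple R d).
Notation unit := (@unit_cube R d).
Implicit Types (Q P E : seq B) (b e : B) (k : 'I_d) (x : Rspace R d).
Implicit Types f g : Rspace R d -> R.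

Definition norm1 f := mean (fun x => `|f x|).

Lemma norm1_ge0 f : 0 <= norm1 f.
Proof. exact: mean_ge0. Qed.

Lemma norm1D f g : L1 f -> L1 g -> norm1 (fun x => f x + g x) <= norm1 f + norm1 g.
Proof.
by move=> hf hg; have [_] := norm_leD (bound_rel_norm_le R d) (conj hf (lexx _))
  (conj hg (lexx _)).
Qed.

Lemma norm1Z r f : L1 f -> norm1 (fun x => r * f x) <= `|r| * norm1 f.
Proof. by move=> hf; have [_] := norm_leZ (bound_rel_norm_le R d) r (conj hf (lexx
  _)). Qed.

Lemma norm1_null f : (forall x, cube_set (word_cube [::]) x -> f x = 0) -> L1 f ->
  norm1 f = 0.
Proof.
move=> f0 hf; rewrite /norm1 -mean_root; last exact: L1_norm.
rewrite -[RHS](@mean0 R d); congr mean; apply/funext => x; rewrite cube_indE.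
by case: (boolP (x \in _)) => [/set_mem/f0 ->|_]; rewrite ?mulr0 // normr0 mul0r.
Qed.

Fixpoint level_words n : seq (seq B) :=
  if n is n'.+1 then [seq b :: Q | Q <- level_words n', b <- enum {: B}] else [:: [::]].

Lemma mem_level_words n Q : (Q \in level_words n) = (size Q == n).
Proof.
elim: n Q => [|n IH] [|b Q] /=; rewrite ?inE //.
  by apply/negbTE/negP => /allpairsP[[? ?] []].
apply/allpairsP/idP => [[[Q' b'] /= [h _ [_ ->]]]|h].
  by rewrite -(eqP (_ : size Q' == n)) // -IH.
by exists (Q, b); rewrite /= mem_enum IH.
Qed.

Lemma level_words_uniq n : uniq (level_words n).
Proof.
elim: n => //= n IH; apply: allpairs_uniq => //; first exact: enum_uniq.
by move=> [Q b] [Q' b'] _ _ /= [-> ->].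
Qed.

Lemma sum_level_wordsS n (Z : nmodType) (F : seq B -> Z) :
  \sum_(Q <- level_words n.+1) F Q = \sum_(Q <- level_words n) \sum_b F (b :: Q).
Proof. by rewrite big_allpairs_dep; apply: eq_bigr => Q _; rewrite big_enum. Qed.

Lemma sum_level_words_suffix P n (F : seq B -> R) : (forall Q,
  \sum_b F (b :: Q) = F Q) ->
  (size P <= n)%N -> \sum_(Q <- level_words n | suffix P Q) F Q = F P.
Proof.
move=> FA /subnK <-; elim: (n - size P)%N => [|m IH].
  rewrite add0n big_mkcond (bigD1_seq P) ?mem_level_words ?level_words_uniq //=
    suffix_refl.
  rewrite big_seq_cond big1 ?addr0 // => Q /andP[];
    rewrite mem_level_words => /eqP sQ nQ.
  case: ifP => // /suffixP[s e]; move: sQ nQ; rewrite e size_cat.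
  by move/eqP; rewrite -{2}[size P]add0n eqn_add2r size_eq0 => /eqP ->; rewrite eqxx.
rewrite addSn big_mkcond sum_level_wordsS -IH [RHS]big_mkcond /=.
apply: eq_big_seq => Q; rewrite mem_level_words => /eqP sQ.
have e b : suffix P (b :: Q) = suffix P Q.
  rewrite suffix_consr; case: eqP => // eP; move: sQ; rewrite eP /= => /eqP.
  by rewrite addnS -addSn -{1}[size Q]add0n eqn_add2r.
by under eq_bigr do rewrite e; case: ifP => h; [rewrite FA|rewrite big1].
Qed.

Lemma sum_level_words n (F : seq B -> R) : (forall Q, \sum_b F (b :: Q) = F Q) ->
  \sum_(Q <- level_words n) F Q = F [::].
Proof.
move=> FA; rewrite -(@sum_level_words_suffix [::] n F FA (leq0n n)).
by apply: eq_bigl => Q; rewrite suffix0s.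
Qed.

(** The conditional expectation of [f] on the cubes of level [n]. *)
Definition cond_exp n f : Rspace R d ->
  R := fun x => \sum_(Q <- level_words n) cube_avg f Q x.

Lemma L1_cube_avg f Q : L1 (cube_avg f Q).
Proof. by apply: L1Z; exact: L1_cube_ind. Qed.

Lemma L1_cond_exp n f : L1 (cond_exp n f).
Proof. by apply: L1_sum => Q _; exact: L1_cube_avg. Qed.

Lemma cond_expD n f g x : L1 f -> L1 g ->
  cond_exp n (fun x => f x + g x) x = cond_exp n f x + cond_exp n g x.
Proof.
move=> hf hg; rewrite /cond_exp -big_split; apply: eq_bigr => Q _ /=.
by rewrite /cube_avg massD // -mulrDl -mulrDl.
Qed.

Lemma cond_expZ n r f x : L1 f -> cond_exp n (fun x => r * f x) x = r * cond_exp n f x.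
Proof.
by move=> hf; rewrite /cond_exp mulr_sumr; apply: eq_bigr => Q _;
  rewrite /cube_avg massZ // !mulrA.
Qed.

Lemma norm1_cond_exp n f : L1 f -> norm1 (cond_exp n f) <= norm1 f.
Proof.
move=> hf; have ex := expansion_L1 hf.
have [_] : norm_le (cond_exp n f) (\sum_(Q <- level_words n) `|mass f Q|).
  rewrite (_ : cond_exp n f = \sum_(Q <- level_words n) cube_avg f Q); last first.
    by apply/funext => x; rewrite fct_sumE.
  by apply: (norm_le_sum (bound_rel_norm_le R d)) => Q _; exact: norm_le_e ex Q.
move=> /le_trans; apply; rewrite /norm1 -(mean_root (L1_norm hf)) -[leRHS]/(nu f [::]).
rewrite -(sum_level_words n (nu_add ex)); apply: ler_sum => Q _; exact: abs_a ex Q.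
Qed.

Lemma sum_cube_ind_level P n x : (size P <= n)%N ->
  \sum_(Q <- level_words n | suffix P Q) cube_ind Q x = cube_ind P x.
Proof.
apply: sum_level_words_suffix => Q; rewrite -[RHS]mul1r -(sum_cube_ind (fun=> 1)).
by apply: eq_bigr => b _; rewrite mul1r.
Qed.

Lemma mass_cube_ind P Q : (size P <= size Q)%N ->
  mass (cube_ind P) Q = if suffix P Q then (inv_vol R Q)^-1 else 0.
Proof.
move=> PQ; case: ifP => h.
  by rewrite -mean_cube_ind; congr mean; apply/funext => x; rewrite cube_ind_suffix.
rewrite -[RHS](@mean0 R d); congr mean; apply/funext => x;
  rewrite cube_ind_disjoint ?h //.
apply/negP => h'; have e : Q = P.
  move/suffixP: (h') => [s e]; move: PQ;
    rewrite e size_cat -{2}[size Q]add0n leq_add2r leqn0 size_eq0.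
  by move=> /eqP ->.
by rewrite e suffix_refl in h.
Qed.

Lemma cond_exp_ind P n x : (size P <= n)%N -> cond_exp n (cube_ind P) x = cube_ind P x.
Proof.
move=> Pn; rewrite -(sum_cube_ind_level x Pn) [RHS]big_mkcond; apply: eq_big_seq => Q.
rewrite mem_level_words => /eqP sQ; rewrite /cube_avg mass_cube_ind ?sQ //.
by case: ifP => _; rewrite ?mul0r // mulVf ?mul1r // inv_vol_neq0.
Qed.

Lemma mass_cond_exp f P n : L1 f -> (size P <= n)%N -> mass (cond_exp n f) P = mass f P.
Proof.
move=> hf Pn; rewrite -(sum_level_words_suffix (F := mass f) (fun Q => mass_add Q hf)
  Pn).
transitivity (mean (fun x => \sum_(Q <- level_words n) mass f Q * inv_vol R Q *
  (cube_ind Q x * cube_ind P x))).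
  congr mean; apply/funext => x; rewrite /cond_exp mulr_suml; apply: eq_bigr => Q _.
  by rewrite /cube_avg -mulrA.
rewrite mean_sum; last by move=> Q _; apply: L1Z; apply: L1M_cube_ind;
  exact: L1_cube_ind.
rewrite [RHS]big_mkcond; apply: eq_big_seq => Q; rewrite mem_level_words => /eqP sQ.
rewrite meanZ; last by apply: L1M_cube_ind; exact: L1_cube_ind.
rewrite (_ : (fun x => cube_ind Q x * cube_ind P x) = (fun x => cube_ind P x *
  cube_ind Q x)); last first.
  by apply/funext => x; rewrite mulrC.
rewrite -/(mass (cube_ind P) Q) mass_cube_ind ?sQ //; case: ifP => _;
  last by rewrite mulr0.
by rewrite mulfK // inv_vol_neq0.
Qed.

Lemma coef_cond_exp_low f Q n j : L1 f -> (size Q < n)%N ->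
  coef (cond_exp n f) (word_cube Q) j = coef f (word_cube Q) j.
Proof.
move=> hf Qn; rewrite !coefE //; last exact: L1_cond_exp.
by apply: eq_bigr => b _; rewrite mass_cond_exp.
Qed.

Lemma coef_cube_ind_level P Q j : haar_index d j -> (size P <= size Q)%N ->
  coef (cube_ind P) (word_cube Q) j = 0.
Proof.
move=> hj PQ; have [h|h] := boolP (suffix P Q); first exact: coef_cube_ind_below.
rewrite coefE; last exact: L1_cube_ind.
rewrite big1 // => b _; rewrite mass_cube_ind; last by rewrite /= ltnW.
case: ifP => [|_]; last by rewrite mulr0.
rewrite suffix_consr (negbTE h) orbF => /eqP e.
by move: PQ; rewrite e /= ltnn.
Qed.

(** The convergence of the conditional expectations is a property that passes to
    linear combinations and to limits, so it has to be checked only on enough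
    indicators. *)
Definition dyadic_approx f := L1 f /\ forall eps : R, 0 < eps ->
  exists n0, forall n, (n0 <= n)%N -> norm1 (fun x => f x - cond_exp n f x) <= eps.

(** Conditional expectations are contractions, so an error of [eps / 3] for the
    approximating function costs only twice as much. *)
Lemma dyadic_approx_lim f : L1 f ->
  (forall eps : R, 0 < eps -> exists g,
    dyadic_approx g /\ norm1 (fun x => f x - g x) <= eps) ->
  dyadic_approx f.
Proof.
move=> hf h; split => // eps e0; have e3 : 0 < eps / 3 by rewrite divr_gt0.
have [g [[hg gP] fg]] := h _ e3; have [n0 hn] := gP _ e3; exists n0 => n /hn gn.
have hfg := L1B hf hg; have hgp := L1B hg (L1_cond_exp n g).
rewrite (_ : (fun x => f x - cond_exp n f x) =
   (fun x => ((f x - g x) + (g x - cond_exp n g x)) + -1 * cond_exp n (fun x => f x -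
     g x) x)).
  apply: (le_trans (norm1D _ _)); first exact: L1D.
    by apply: L1Z; exact: L1_cond_exp.
  have h1 := norm1D hfg hgp;
    have h2 := norm1Z (-1) (L1_cond_exp n (fun x => f x - g x)).
  have h3 := norm1_cond_exp n hfg; rewrite normrN1 mul1r in h2; lra.
apply/funext => x.
have -> : cond_exp n (fun x => f x - g x) x = cond_exp n f x - cond_exp n g x.
  rewrite -mulN1r -cond_expZ // -cond_expD //; last exact: L1Z.
  by congr cond_exp; apply/funext => y; rewrite mulN1r.
ring.
Qed.

Lemma dyadic_approxD f g : dyadic_approx f -> dyadic_approx g ->
  dyadic_approx (fun x => f x + g x).
Proof.
move=> [hf fP] [hg gP]; split; first exact: L1D.
move=> eps e0; have e2 : 0 < eps / 2 by rewrite divr_gt0.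
have [n0 h0] := fP _ e2; have [n1 h1] := gP _ e2; exists (maxn n0 n1) => n.
rewrite geq_max => /andP[/h0 {}h0 /h1 {}h1].
have e : norm1 (fun x => f x + g x - cond_exp n (fun x => f x + g x) x) =
    norm1 (fun x => (f x - cond_exp n f x) + (g x - cond_exp n g x)).
  by congr norm1; apply/funext => x; rewrite cond_expD //; ring.
rewrite e; apply: (le_trans (norm1D (L1B hf (L1_cond_exp n f)) (L1B hg (L1_cond_exp n
  g)))).
by rewrite [leRHS]splitr; exact: lerD h0 h1.
Qed.

Lemma dyadic_approxZ r f : dyadic_approx f -> dyadic_approx (fun x => r * f x).
Proof.
move=> [hf fP]; split; first exact: L1Z.
move=> eps e0; have r0 : 0 < `|r| + 1 by rewrite ltr_wpDl.
have [n0 h0] := fP (eps / (`|r| + 1)) (divr_gt0 e0 r0); exists n0 => n /h0 {}h0.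
have e : norm1 (fun x => r * f x - cond_exp n (fun x => r * f x) x) =
    norm1 (fun x => r * (f x - cond_exp n f x)).
  by congr norm1; apply/funext => x; rewrite cond_expZ //; ring.
rewrite e; apply: (le_trans (norm1Z r (L1B hf (L1_cond_exp n f)))).
apply: (@le_trans _ _ ((`|r| + 1) * norm1 (fun x => f x - cond_exp n f x))).
  by rewrite ler_wpM2r ?norm1_ge0 // lerDl.
by rewrite mulrC -ler_pdivlMr.
Qed.

Lemma dyadic_approx0 : dyadic_approx (fun=> 0).
Proof.
split; first exact: L1_0.
move=> eps e0; exists 0%N => n _; rewrite norm1_null ?ltW // => [x _|].
  rewrite /cond_exp big1 ?subr0 // => Q _; rewrite /cube_avg.
  suff -> : mass (fun _ : Rspace R d => 0 : R) Q = 0 by rewrite !mul0r.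
  transitivity (mean (fun _ : Rspace R d => 0 : R)); last exact: mean0.
  by congr mean; apply/funext => y; rewrite mul0r.
by apply: L1B; [exact: L1_0|exact: L1_cond_exp].
Qed.

Lemma dyadic_approx_sum (J : Type) (r : seq J) (p : pred J) (F : J -> Rspace R d -> R) :
  (forall j, p j -> dyadic_approx (F j)) ->
    dyadic_approx (fun x => \sum_(j <- r | p j) F j x).
Proof.
move=> h; elim: r => [|j r IH].
  by under eq_fun do rewrite big_nil; exact: dyadic_approx0.
under eq_fun do rewrite big_cons.
by have [pj|//] := boolP (p j); exact: dyadic_approxD (h _ pj) IH.
Qed.

Lemma approx_cube_ind P : dyadic_approx (cube_ind P).
Proof.
split; first exact: L1_cube_ind.
move=> eps e0; exists (size P) => n Pn; rewrite norm1_null ?ltW // => [x _|].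
  by rewrite cond_exp_ind // subrr.
by apply: L1B; [exact: L1_cube_ind|exact: L1_cond_exp].
Qed.

Lemma dyadic_approx_root f g : L1 f -> dyadic_approx g ->
  (forall x, cube_set (word_cube [::]) x -> f x = g x) -> dyadic_approx f.
Proof.
move=> hf hg fg; apply: dyadic_approx_lim => // eps e0; exists g; split => //.
rewrite norm1_null ?ltW // => [x /fg ->|]; first by rewrite subrr.
by apply: L1B => //; case: hg.
Qed.

Lemma mean_indic (A : set (Rspace R d)) : measurable A ->
  mean (\1_A : Rspace R d -> R) = fine (mu (A `&` unit)).
Proof. by move=> mA; rewrite /mean /Rintegral integral_indic //;
  exact: measurable_unit. Qed.

Lemma dyadic_approx_ndseq (F : (set (Rspace R d))^nat) :
  {homo F : n m / (n <= m)%N >-> (n <= m)%O} ->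
  (forall i, measurable (F i) /\ dyadic_approx (\1_(F i) : Rspace R d -> R)) ->
  measurable (\bigcup_i F i) /\ dyadic_approx (\1_(\bigcup_i F i) : Rspace R d -> R).
Proof.
move=> ndF FP; have mF i : measurable (F i) by case: (FP i).
have mU : measurable (\bigcup_i F i) by exact: bigcup_measurable.
split => //; apply: dyadic_approx_lim; first exact: L1_indic.
move=> eps e0.
have [|n hn] := ndseq_measure_small (m := mu) (@measurable_unit R d) _ mF ndF e0.
  by apply: (@le_lt_trans _ _ 1%E); rewrite ?ltry // -(mu_unit R d).
exists (\1_(F n)); split; first by case: (FP n).
have sub : F n `<=` \bigcup_i F i by move=> x Fx; exists n.
have -> : norm1 (fun x => \1_(\bigcup_i F i) x - \1_(F n) x) =
    mean (\1_(\bigcup_i F i) : Rspace R d -> R) - mean (\1_(F n) : Rspace R d -> R).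
  rewrite -meanB; [|exact: L1_indic..]; congr mean; apply/funext => x.
  apply: ger0_norm; rewrite subr_ge0 !indicE ler_nat.
  by have [/set_mem/sub/mem_set ->|] := boolP (x \in F n).
by rewrite !mean_indic.
Qed.

End ConditionalExpectation.

(** * Density of the dyadic step functions *)

Import HBSimple.

Section Density.
Context (R : realType) (d : nat).
Notation B := {ffun 'I_d -> bool}.
Notation cube_ind := (@cube_ind R d).
Notation mu := (lebesgue_tuple R d).
Notation unit := (@unit_cube R d).
Implicit Types (Q P E : seq B) (b e : B) (k : 'I_d) (x : Rspace R d).
Implicit Types f g : Rspace R d -> R.

Definition ray_box (a : 'I_d -> \bar R) : set (Rspace R d) :=
  [set x | forall k, ((tnth x k)%:E < a k)%E].

Lemma measurable_ray_box a : measurable (ray_box a).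
Proof.
apply: (measurable_box (A := fun k => [set y | (y%:E < a k)%E])) => k.
case: (a k) => [r||].
- have -> : [set y | (y%:E < r%:E)%E] = `]-oo, r[%classic.
    by apply/seteqP; split => y /=; rewrite in_itv /= lte_fin.
  exact: measurable_itv.
- have -> : [set y | (y%:E < +oo)%E] = [set: R].
    by apply/seteqP; split => y //= _; rewrite ltry.
  exact: measurableT.
- have -> : [set y | (y%:E < -oo)%E] = (set0 : set R) by apply/seteqP; split => y.
  exact: measurable0.
Qed.

Fixpoint address n x : seq B := if n is n'.+1 then bit (address n' x) x :: address n'
  x else [::].

Lemma size_address n x : size (address n x) = n.
Proof. by elim: n => //= n ->. Qed.

Lemma cube_address n x : cube_set (word_cube [::]) x ->
  cube_set (word_cube (address n x)) x.
Proof. by move=> h; elim: n => //= n IH; apply/cube_cons. Qed.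

Lemma pow2_small (eps : R) : 0 < eps -> exists n0, forall n, (n0 <= n)%N ->
  (2 ^+ n)^-1 <= eps.
Proof.
move=> e0; exists (Num.Def.archi_bound eps^-1) => n hn.
rewrite invf_ple ?posrE ?exprn_gt0 //.
have h := archi_boundP (ltW (_ : 0 < eps^-1)); apply: le_trans (ltW (h _)) _;
  first by rewrite invr_gt0.
by rewrite -natrX ler_nat (leq_trans hn) // ltnW // ltn_expl.
Qed.

(* A box is, inside the half-open unit cube, the increasing union of the dyadic
   cubes of level [n] whose upper sides stay within the box. *)
Section RayBox.
Variable a : 'I_d -> \bar R.
Let inner Q := [forall k, ((hi R (word_cube Q) k)%:E <= a k)%E].
Let S n : set (Rspace R d) := \big[setU/set0]_(Q <- level_words d n | inner Q)
  cube_set (word_cube Q).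

Let SP n x : S n x <-> cube_set (word_cube [::]) x /\ inner (address n x).
Proof.
rewrite /S -bigcup_seq_cond; split.
  move=> [Q /= /andP[]]; rewrite mem_level_words => /eqP sQ iQ xQ.
  have x0 : cube_set (word_cube [::]) x by apply: cube_suffix xQ; rewrite suffix0s.
  by rewrite (cube_uniq (cube_address n x0) xQ) // size_address.
move=> [x0 ix]; exists (address n x); last exact: cube_address.
by rewrite /= mem_level_words size_address eqxx.
Qed.

Let S_indic n x : \1_(S n) x = \sum_(Q <- level_words d n | inner Q) cube_ind Q x :> R.
Proof.
rewrite indicE; have [/set_mem/SP[x0 ix]|nx] := boolP (x \in S n).
  rewrite big_mkcond (bigD1_seq (address n x)) ?level_words_uniq ?mem_level_words
    ?size_address //= ix.
  rewrite cube_indE mem_set; last exact: cube_address.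
  rewrite big_seq_cond big1 ?addr0 // => Q /andP[];
    rewrite mem_level_words => /eqP sQ nQ.
  case: ifP => // _; rewrite cube_indE memNset // => xQ; case/eqP: nQ.
  by apply: (cube_uniq xQ (cube_address n x0)); rewrite size_address.
rewrite big_seq_cond big1 // => Q /andP[QL iQ]; rewrite cube_indE memNset // => xQ.
case/negP: nx; apply: mem_set; rewrite /S -bigcup_seq_cond; exists Q => //=.
by rewrite QL iQ.
Qed.

Let S_dyadic n : measurable (S n) /\ dyadic_approx (\1_(S n) : Rspace R d -> R).
Proof.
split; first by apply: bigsetU_measurable => Q _; exact: measurable_cube.
rewrite (_ : \1_(S n) = fun x => \sum_(Q <- level_words d n | inner Q) cube_ind Q x).
  by apply: dyadic_approx_sum => Q _; exact: approx_cube_ind.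
by apply/funext => x; exact: S_indic.
Qed.

Let S_nd : {homo S : n m / (n <= m)%N >-> (n <= m)%O}.
Proof.
apply/nondecreasing_seqP => n; apply/subsetPset => x /SP[x0 ix]; apply/SP; split => //.
apply/forallP => k; apply: le_trans (forallP ix k); rewrite lee_fin /= hi_cons.
by case: ifP => // _; have /andP[_ /ltW] := mid_in R (address n x) k.
Qed.

Let S_cup : \bigcup_n S n = ray_box a `&` cube_set (word_cube [::]).
Proof.
apply/seteqP; split => [x [n _ /SP[x0 /forallP ix]]|x [ax x0]].
  split => // k; apply: lt_le_trans (ix k); rewrite lte_fin.
  by have /andP[] := cube_address n x0 k.
have /choice[N hN] : forall k, exists N, forall n, (N <= n)%N ->
    ((tnth x k + (2 ^+ n)^-1)%:E <= a k)%E.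
  move=> k; have := ax k; case: (a k) => [r||//].
    rewrite lte_fin -subr_gt0 => /pow2_small[N hN]; exists N => n /hN h.
    by rewrite lee_fin addrC -lerBrDr.
  by move=> _; exists 0%N => n _; rewrite leey.
exists (\max_k N k)%N => //; apply/SP; split => //; apply/forallP => k.
apply: le_trans (hN k _ (leq_bigmax k));
  rewrite lee_fin hi_word_cube size_address lerD2r.
by have /andP[] := cube_address (\max_k N k)%N x0 k.
Qed.

Lemma dyadic_approx_ray_box : dyadic_approx (\1_(ray_box a) : Rspace R d -> R).
Proof.
have [mS dS] := dyadic_approx_ndseq S_nd S_dyadic.
apply: (dyadic_approx_root _ dS); first by apply: L1_indic; exact: measurable_ray_box.
by move=> x x0; rewrite S_cup !indicE in_setI [X in _ && X]mem_set // andbT.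
Qed.
End RayBox.

Lemma measurable_ray_gen (A : set (Rspace R d)) :
  measurable A -> <<s range ray_box >> A.
Proof.
pose T' := g_sigma_algebraType (range ray_box).
have mid : measurable_fun [set: T'] (id : T' -> Rspace R d).
  apply/measurable_fun_tnthP => k.
  apply: (measurability _ (RGenInftyO.measurableE R)) => _ /= -[_ [r ->] <-].
  apply: sub_sigma_algebra; exists (fun l => if l == k then r%:E else +oo%E) => //.
  apply/seteqP; split => x /=.
    by move=> h; split => //; rewrite in_itv /=; have := h k; rewrite eqxx lte_fin.
  move=> [_]; rewrite in_itv /= => h l; case: eqP => [->|_]; first by rewrite lte_fin.
  exact: ltry.
by move=> mA; have := mid measurableT A mA; rewrite setTI.
Qed.

(** The boxes form a pi-system that generates the measurable sets, and the sets with
    the property form a lambda-system. *)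
Lemma dyadic_approx_indic (A : set (Rspace R d)) : measurable A ->
  dyadic_approx (\1_A : Rspace R d -> R).
Proof.
move=> mA.
suff : <<s range ray_box >> `<=` [set A | measurable A /\ dyadic_approx (\1_A :
  Rspace R d -> R)].
  by move=> /(_ A (measurable_ray_gen mA)) [].
apply: lambda_system_subset => //.
- move=> _ _ [a _ <-] [b _ <-]; exists (fun k => Order.min (a k) (b k)) => //.
  apply/seteqP; split => x /=.
    by move=> h; split => k; have := h k; rewrite lt_min => /andP[].
  by move=> [h1 h2] k; rewrite lt_min h1 h2.
- split; first by move=> E _; exact: subsetT.
  + split; first exact: measurableT.
    apply: (dyadic_approx_root _ (approx_cube_ind R (d:=d) [::]));
      first exact: L1_indic.
    by move=> x x0; rewrite cube_indE indicT mem_set.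
  + move=> E F FE [mE dE] [mF dF]; split; first exact: measurableD.
    rewrite (_ : \1_(E `\` F) = fun x => \1_E x + -1 * \1_F x).
      exact: (dyadic_approxD dE (dyadic_approxZ (-1) dF)).
    apply/funext => x; rewrite !indicE in_setD mulN1r.
    by case: (boolP (x \in F)) => [/set_mem/FE/mem_set ->|_];
      rewrite /= ?andbF ?andbT ?subrr ?subr0.
  + exact: dyadic_approx_ndseq.
- move=> _ [a _ <-]; split; first exact: measurable_ray_box.
  exact: dyadic_approx_ray_box.
Qed.

Lemma dyadic_approx_L1 f : L1 f -> dyadic_approx f.
Proof.
move=> hf; have [g [gi _ gf]] := approximation_sfun_integrable (@measurable_unit R d)
  hf.
apply: dyadic_approx_lim => // eps e0.
have [n hn] : exists n, norm1 (fun x => f x - g n x) <= eps.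
  have /fine_cvg/cvgrPdist_le/(_ _ e0)[N _ hN] := gf; exists N.
  have := hN N (leqnn N); rewrite sub0r normrN; apply: le_trans; exact: ler_norm.
exists (g n); split => //.
rewrite (_ : (g n : Rspace R d -> R) =
    fun x => \sum_(y <- finmap.enum_fset (fset_set (range (g n)))) y * \1_(g n @^-1`
      [set y]) x).
  apply: dyadic_approx_sum => y _; apply: dyadic_approxZ; apply: dyadic_approx_indic.
  exact: measurable_sfunP.
by apply/funext => x; rewrite fimfunE fsbig_finite.
Qed.

Lemma norm1_cond_exp_small f (eps : R) : L1 f -> 0 < eps ->
  exists n, norm1 (fun x => f x - cond_exp n f x) <= eps.
Proof. by move=> /dyadic_approx_L1[_ h] /h[n hn]; exists n; exact: hn. Qed.

End Density.

(** * Existence and structure of the greedy steps *)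

Lemma seq_argmax (R : realDomainType) (T : eqType) (F : T -> R) (r : seq T) (x0 : T) :
  x0 \in r -> exists2 x, x \in r & forall y, y \in r -> F y <= F x.
Proof.
elim: r x0 => // y [|z r] IH x0 _.
  by exists y; rewrite ?mem_head // => w; rewrite inE => /eqP ->.
have [x xr xmax] := IH z (mem_head _ _).
have [yx|xy] := leP (F y) (F x).
  exists x; first by rewrite inE xr orbT.
  by move=> w; rewrite inE => /predU1P[->|/xmax].
exists y; first exact: mem_head.
by move=> w; rewrite inE => /predU1P[->|/xmax h] //; exact: le_trans h (ltW xy).
Qed.

Section Step.
Context (R : realType) (d : nat) (d_gt0 : (0 < d)%N) (s t : R) (a : algorithm).
Hypothesis t_gt0 : 0 < t.
Hypothesis ts : t < s.
Hypothesis s_lt1 : s < 1.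
Notation B := {ffun 'I_d -> bool}.
Notation I := 'I_(2 ^ d).-1.
Implicit Types (Q P E D F : seq B) (b e : B) (k : 'I_d) (x : Rspace R d).
Implicit Types f g G : Rspace R d -> R.

Let s_gt0 : 0 < s. Proof. exact: lt_trans ts. Qed.

Lemma haar_index_ordP j : haar_index d j -> exists i : I, j = i.+1.
Proof.
move=> /andP[j1 jd].
have ij : (j.-1 < (2 ^ d).-1)%N by rewrite prednK // -subn1.
by exists (Ordinal ij); rewrite /= prednK.
Qed.

Lemma mem_index j : haar_index d j -> j \in index_iota 1 (2 ^ d).
Proof.
by move=> /andP[j1 jd]; rewrite mem_index_iota j1 /= -ltnS -[(2 ^ d)%N]prednK
  ?expn_gt0 // -subn1 ltnS.
Qed.

Lemma index_mem j : j \in index_iota 1 (2 ^ d) -> haar_index d j.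
Proof.
by rewrite mem_index_iota => /andP[j1 jd];
  rewrite /haar_index j1 /= subn1 -ltnS prednK ?expn_gt0.
Qed.

Lemma i_one : haar_index d 1.
Proof.
rewrite /haar_index leqnn subn_gt0 -{1}(expn0 2) ltn_exp2l //.
Qed.

Lemma coef_le_norm1 g Q j : L1 g -> `|coef g (word_cube Q) j| <= norm1 g.
Proof.
move=> hg; have ex := expansion_L1 hg; rewrite coefE //.
apply: (le_trans (ler_norm_sum _ _ _)).
apply: (@le_trans _ _ (nu g Q)).
  rewrite -(nu_add ex); apply: ler_sum => b _; rewrite normrM norm_walsh mul1r.
  exact: abs_a ex _.
rewrite /norm1 -(mean_root (L1_norm hg)) -[leRHS]/(nu g [::]).
by apply: (nu_suffix (nu_ge0 ex) (nu_add ex)); rewrite suffix0s.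
Qed.

Lemma coef_cond_exp_high g n Q j : haar_index d j -> (n <= size Q)%N ->
  coef (cond_exp n g) (word_cube Q) j = 0.
Proof.
move=> hj nQ; rewrite coef_sum; last by move=> *; exact: L1_cube_avg.
rewrite big_seq_cond big1 // => P; rewrite andbT mem_level_words => /eqP sP.
by rewrite /cube_avg coefZ ?coef_cube_ind_level ?mulr0 ?sP //; exact: L1_cube_ind.
Qed.

(** From level [n] on, [g] and [g - cond_exp n g] have the same coefficients, and a
    coefficient is bounded by the norm. *)
Lemma coef_small g (eps : R) : L1 g -> 0 < eps -> exists n, forall Q j,
  haar_index d j -> (n <= size Q)%N -> `|coef g (word_cube Q) j| <= eps.
Proof.
move=> hg e0; have [n hn] := norm1_cond_exp_small hg e0; exists n => Q j hj nQ.
have -> : coef g (word_cube Q) j = coef (fun x => g x - cond_exp n g x) (word_cube Q) j.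
  by rewrite coefB ?coef_cond_exp_high ?subr0 //; exact: L1_cond_exp.
by apply: (le_trans (coef_le_norm1 _ _ _)) => //; apply: L1B => //; exact: L1_cond_exp.
Qed.

Fixpoint short_words n : seq (seq B) := if n is n'.+1 then level_words d n' ++
  short_words n' else [::].

Lemma mem_short_words n Q : (Q \in short_words n) = (size Q < n)%N.
Proof. by elim: n => //= n IH;
  rewrite mem_cat mem_level_words IH ltnS [RHS]leq_eqVlt. Qed.

Lemma short_words_uniq n : uniq (short_words n).
Proof.
elim: n => //= n IH; rewrite cat_uniq level_words_uniq IH andbT /=; apply/hasPn => Q.
by rewrite /= mem_short_words mem_level_words => h; rewrite ltn_eqF.
Qed.

(** Coefficients of size at least that of a given nonzero one occur on finitely many
    levels only, so the maximum exists and is attained finitely often. *)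
Lemma peak_finite g Q0 j0 : L1 g -> haar_index d j0 -> coef g (word_cube Q0) j0 != 0 ->
  exists n, (exists Q j, is_peak g (word_cube Q) j) /\
    (forall Q j, is_peak g (word_cube Q) j -> (size Q < n)%N).
Proof.
move=> hg hj0 c0; have e0 : 0 < `|coef g (word_cube Q0) j0| / 2 by rewrite divr_gt0
  ?normr_gt0.
have [n hn] := coef_small hg e0; exists n.
have half_lt : `|coef g (word_cube Q0) j0| / 2 < `|coef g (word_cube Q0) j0|.
  by rewrite ltr_pdivrMr // ltr_pMr ?normr_gt0 // ltr1n.
have high Q j : haar_index d j -> (n <= size Q)%N ->
    `|coef g (word_cube Q) j| < `|coef g (word_cube Q0) j0|.
  by move=> hj nQ; exact: le_lt_trans (hn _ _ hj nQ) half_lt.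
pose r := [seq (Q, j) | Q <- short_words n, j <- index_iota 1 (2 ^ d)].
have r0 : (Q0, j0) \in r.
  apply/allpairsP; exists (Q0, j0); split => //; last exact: mem_index.
  by rewrite mem_short_words ltnNge; apply/negP => /(high _ _ hj0); rewrite ltxx.
have [[Q j] Qr Qmax] := seq_argmax (fun p => `|coef g (word_cube p.1) p.2|) r0.
split.
  exists Q, j; split.
    by case/allpairsP: Qr => [[? ?] [_ hj [_ ->]]]; exact: index_mem.
  move=> I0 i hi; have [P ->] := word_cube_surj I0.
  have [Pn|nP] := ltnP (size P) n.
    apply: (Qmax (P, i)); apply/allpairsP; exists (P, i); split => //;
      last exact: mem_index.
    by rewrite mem_short_words.
  by apply: le_trans (ltW (high _ _ hi nP)) _; exact: (Qmax (Q0, j0)).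
move=> P i [hi Pmax]; rewrite ltnNge; apply/negP => /(high _ _ hi).
by rewrite ltNge Pmax.
Qed.

Lemma step1_ex g Q0 j0 : L1 g -> haar_index d j0 -> coef g (word_cube Q0) j0 != 0 ->
  exists D j, step1 g (word_cube D) j.
Proof.
move=> hg hj0 c0; have [n [[Q [j hQ]] fin]] := peak_finite hg hj0 c0.
pose pk P := `[< exists i, is_peak g (word_cube P) i >].
have Qin : Q \in [seq P <- short_words n | pk P].
  by rewrite mem_filter mem_short_words (fin _ _ hQ) andbT; apply/asboolP; exists j.
have [|D] := first_cube R d_gt0 (L := [seq P <- short_words n | pk P]).
  by apply: contraTneq Qin => ->.
rewrite mem_filter => /andP[/asboolP[i hi] _] Dfirst.
have ex : exists i, `[< is_peak g (word_cube D) i >] by exists i; apply/asboolP.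
case: (ex_minnP ex) => j' /asboolP hj' j'min; exists D, j'; split => //.
- move=> I0 l; have [P ->] := word_cube_surj I0 => hP.
  have [|->|] := Dfirst P; [|by left|by right].
  by rewrite mem_filter mem_short_words (fin _ _ hP) andbT; apply/asboolP; exists l.
- by move=> l hl; apply: j'min; apply/asboolP.
Qed.

Lemma chain_okP g D j E : chain_ok s g (word_cube D) j (word_cube E) <->
  suffix E D /\ forall Q, suffix E Q -> suffix Q D ->
    exists2 i, haar_index d i & s * `|coef g (word_cube D) j| <= `|coef g (word_cube
      Q) i|.
Proof.
split=> [[/(cube_subset R d_gt0) ED ch]|[ED ch]]; split => //.
- by move=> Q EQ QD; apply: ch; apply/(cube_subset R d_gt0).
- exact/(cube_subset R d_gt0).
- move=> I0; have [Q ->] := word_cube_surj I0.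
  by move=> /(cube_subset R d_gt0) QD /(cube_subset R d_gt0) EQ; exact: ch.
Qed.

Lemma step2_ex g D j : haar_index d j -> exists E,
  step2 s g (word_cube D) j (word_cube E).
Proof.
move=> hj; pose ok n := `[< exists2 E,
  size E = n & chain_ok s g (word_cube D) j (word_cube E) >].
have ex : exists n, ok n.
  exists (size D); apply/asboolP; exists D => //; apply/chain_okP; split;
    first exact: suffix_refl.
  move=> Q DQ QD; rewrite (suffix_anti QD DQ); exists j => //.
  by rewrite ler_piMl // ltW.
case: (ex_minnP ex) => n /asboolP[E sE okE] nmin; exists E; split => // I0.
have [P ->] := word_cube_surj I0 => okP; apply/(cube_subset R d_gt0).
have Pn : (n <= size P)%N by apply: nmin; apply/asboolP; exists P.
have /chain_okP[ED _] := okE; have /chain_okP[PD _] := okP.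
case/orP: (suffix_total ED PD) => // PE; have := size_suffix PE; rewrite sE => nP.
have e : size P = size E by apply/eqP; rewrite sE eqn_leq nP Pn.
case/suffixP: PE e => u -> /eqP;
  rewrite size_cat -{1}[size P]add0n eqn_add2r eq_sym size_eq0.
by move=> /eqP ->; exact: suffix_refl.
Qed.

Let tau g D j E := threshold a s t g (word_cube D) j (word_cube E).

(** The only information about the thresholds that the proof uses. It holds because
    the largest coefficient of [E] is between [s] times the peak and the peak. *)
Lemma thresholdP g D j E : chain_ok s g (word_cube D) j (word_cube E) ->
  exists l0, [/\ haar_index d l0,
    forall l, haar_index d l -> `|coef g (word_cube E) l| <= `|coef g (word_cube E) l0|,
    t * `|coef g (word_cube D) j| <= tau g D j E & tau g D j E <= t / s * `|coef g
      (word_cube E) l0|].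
Proof.
move=> /chain_okP[ED ch]; have [l hl hc] := ch E (suffix_refl _) ED.
have [l0 hl0 l0max] := seq_argmax (fun i => `|coef g (word_cube E) i|) (mem_index
  i_one).
have max0 i : haar_index d i -> `|coef g (word_cube E) i| <= `|coef g (word_cube E) l0|.
  by move=> hi; exact/l0max/mem_index.
have sM := le_trans hc (max0 _ hl).
have t0s : 0 <= t / s by rewrite divr_ge0 // ltW.
have tM : t * `|coef g (word_cube D) j| <= t / s * `|coef g (word_cube E) l0|.
  have -> : t * `|coef g (word_cube D) j| = t / s * (s * `|coef g (word_cube D) j|).
    by rewrite mulrA divfK // gt_eqF.
  by rewrite ler_wpM2l.
exists l0; split => //; first exact: index_mem.
- rewrite /tau /threshold; case: a => //; apply: le_trans tM _.
  rewrite ler_wpM2l //; exact: (@le_bigmax_seq _ _ _ _ 0 l0 xpredT (fun i => `|coef g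
    (word_cube E) i|)).
- rewrite /tau /threshold; case: a => //; rewrite ler_wpM2l // big_seq_cond.
  by apply: bigmax_le => // i; rewrite andbT => /index_mem/max0.
Qed.

Lemma step3_ex g D j E : chain_ok s g (word_cube D) j (word_cube E) ->
  exists i, step3 (tau g D j E) g (word_cube E) i.
Proof.
move=> /thresholdP[l0 [hl0 l0max _ le0]].
pose r := [seq i <- index_iota 1 (2 ^ d) | tau g D j E <= `|coef g (word_cube E) i|].
have l0r : l0 \in r.
  rewrite mem_filter mem_index // andbT; apply: le_trans le0 _.
  by rewrite ler_piMl // ler_pdivrMr // mul1r ltW.
have [i ir imin] := seq_argmax (fun i => - `|coef g (word_cube E) i|) l0r.
move: ir; rewrite mem_filter => /andP[ti /index_mem hi]; exists i; split => // l hl tl.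
by rewrite -lerN2; apply: imin; rewrite mem_filter tl mem_index.
Qed.

Lemma step_ex f G : L1 f -> L1 G -> exists G', L1 G' /\ greedy_step a s t f G G'.
Proof.
move=> hf hG; have hg := L1B hf hG.
have [h|/existsNP[I0 /existsNP[j0 /not_implyP[hj0 /eqP c0]]]] :=
    pselect (forall I i, haar_index d i -> coef (fun x => f x - G x) I i = 0).
  by exists G; split => //; left.
have [Q0 e0] := word_cube_surj I0; subst I0.
have [D [j hD]] := step1_ex hg hj0 c0.
have [[hj _] _ _] := hD; have [E hE] := step2_ex (fun x => f x - G x) D hj.
have [i hi] := step3_ex hE.1.
exists (fun x => G x + coef f (word_cube E) i * haar (word_cube E) i x); split.
  by apply: L1D => //; apply: L1Z; exact: L1_haar.
right; split; first by exists (word_cube Q0), j0.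
by exists (word_cube D), j, (word_cube E), i.
Qed.

Lemma greedy_ex f : L1 f -> exists G : nat -> Rspace R d -> R, greedy a s t f G.
Proof.
move=> hf.
have /choice[F hF] : forall G : Rspace R d -> R, exists G' : Rspace R d -> R,
    L1 G -> L1 G' /\ greedy_step a s t f G G'.
  move=> G; have [hG|nG] := pselect (L1 G); last by exists G.
  by have [G' h] := step_ex hf hG; exists G'.
pose Gs n := iter n F (fun _ : Rspace R d => 0 : R).
have LG n : L1 (Gs n) by elim: n => [|n IH]; [exact: L1_0|exact: (hF _ IH).1].
by exists Gs; split => // m; exact: (hF _ (LG m)).2.
Qed.

Definition word_prec P Q := cube_prec R (word_cube P) (word_cube Q).

Lemma word_prec_asym P Q : word_prec P Q -> word_prec Q P -> False.
Proof. by move=> h1 h2; apply: (cube_prec_irr (cube_prec_trans h1 h2)). Qed.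

(** A step of the algorithm in terms of words. The parent of the selected cube fails
    the comparison with the peak, since otherwise the climb would continue. *)
Lemma greedy_stepP f G G' : L1 f -> L1 G -> greedy_step a s t f G G' ->
  ((forall Q i, haar_coef (fun x => f x - G x) Q i = 0) /\ G' = G) \/
  exists M D E i, picked word_prec s t (haar_coef (fun x => f x - G x)) M D E i /\
    G' = fun x => G x + haar_coef f E i * haar_fun E i x.
Proof.
move=> hf hG [[h0 ->]|[[I0 [i0 [hi0 c0]]] [I1 [j [I2 [l [h1 h2 h3 ->]]]]]]].
  by left; split => // Q i; apply: h0; exact: haar_index_ord.
right; set g := (fun x => f x - G x) in c0 h1 h2 h3 *.
have [D e] := word_cube_surj I1; subst I1; have [E e] := word_cube_surj I2; subst I2.
have [[hj peak] first jmin] := h1; have [okE topE] := h2; have [hl tl lmin] := h3.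
have [j' ej] := haar_index_ordP hj; have [l' el] := haar_index_ordP hl; subst j l.
exists `|haar_coef g D j'|, D, E, l'; split => //.
have M0 : 0 < `|haar_coef g D j'| by apply: lt_le_trans (peak I0 i0 hi0);
  rewrite normr_gt0.
have /chain_okP[ED ch] := okE.
have [l0 [hl0 l0max tlow thigh]] := thresholdP okE.
have [i1 e1] := haar_index_ordP hl0; subst l0.
split; [split|exact: le_trans tl|].
- by [].
- by exists j'.
- by move=> Q i; apply: peak; exact: haar_index_ord.
- move=> Q i e; have pk : is_peak g (word_cube Q) i.+1.
    split=> [|J l hl']; first exact: haar_index_ord.
    by rewrite -[leRHS]/(`|haar_coef g Q i|) e; exact: peak.
  by case: (first _ _ pk) => [/(@word_cube_inj R d) ->|h]; [left|right].
- exact: ED.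
- move=> Q EQ QD; have [i hi hc] := ch Q EQ QD; have [i' ei] := haar_index_ordP hi.
  by exists i'; subst i.
- move=> b F eE i; rewrite ltNge; apply/negP => hF.
  have FE : suffix F E by rewrite eE suffix_consr suffix_refl orbT.
  suff : chain_ok s g (word_cube D) j'.+1 (word_cube F).
    move=> /topE/(cube_subset R d_gt0); rewrite eE => /size_suffix /=.
    by rewrite ltnn.
  apply/chain_okP; split; first exact: suffix_trans ED.
  move=> Q FQ QD; have /orP[EQ|QE] := suffix_total ED QD; first exact: ch.
  move: QE; rewrite eE suffix_consr => /orP[/eqP eQ|QF].
    by apply: ch => //; rewrite eQ eE suffix_refl.
  by rewrite (suffix_anti QF FQ); exists i.+1 => //; exact: haar_index_ord.
- exists i1; split => [i|i hi]; first by apply: l0max; exact: haar_index_ord.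
  by apply: lmin; [exact: haar_index_ord|exact: le_trans thigh hi].
Qed.

End Step.

(** * Boundedness and convergence of the approximants *)

Section Tail.
Context (R : realFieldType) (B I : finType).
Implicit Types (c : seq B -> I -> R) (sel : seq B -> I -> bool).

(** The coefficients of [f - cond_exp n f]. *)
Definition tail_coef n c Q i := if (n <= size Q)%N then c Q i else 0.
Definition tail_sel n sel (Q : seq B) (i : I) := (n <= size Q)%N && sel Q i.

(** The clauses of tameness concern a selected cube, its parent and smaller cubes.
    Only the parent can be lost by discarding the levels below [n], and its
    coefficients become 0. *)
Lemma tame_tail n c sel M k : 0 <= M -> tame c sel M k ->
  tame (tail_coef n c) (tail_sel n sel) M k.
Proof.
move=> M0 [small big part top].
have unev Q : (n <= size Q)%N -> uneven c k Q -> uneven (tail_coef n c) k Q.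
  by move=> nQ [i [i' h]]; exists i, i'; rewrite /tail_coef nQ.
split.
- by rewrite /tail_coef /tail_sel => Q i; case: leqP => /= _;
    [exact: small|rewrite normr0].
- by move=> Q i /andP[nQ /big]; rewrite /tail_coef nQ.
- by move=> Q i i' /andP[nQ sQ]; rewrite /tail_sel nQ => /(part _ _ _ sQ); exact: unev.
- move=> b F i /andP[nF /top[D [j [FD kD FsD cl]]]]; exists D, j.
  have below Q : suffix (b :: F) Q -> (n <= size Q)%N.
    by move=> /size_suffix; exact: leq_trans.
  have cD : tail_coef n c D j = c D j by rewrite /tail_coef below.
  rewrite cD; split => //.
    move=> i'; rewrite /tail_sel /tail_coef; case: leqP => /= _; first exact: FsD.
    by rewrite normr0 add0r.
  move=> b' G FG GD Gempty [i' /andP[nG sG]]; apply: unev => //; apply: cl => //.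
    by move=> l; have := Gempty l; rewrite /tail_sel (below _ FG).
  by exists i'.
Qed.

Lemma settled_tail n c kap sel : settled c kap sel ->
  settled (tail_coef n c) kap (tail_sel n sel).
Proof.
move=> [e|[M M0 h]]; [left => Q i|right; exists M => //].
  by rewrite /tail_sel (negbTE (e Q i)) andbF.
exact: tame_tail (ltW M0) h.
Qed.
End Tail.

Section Final.
Context (R : realType) (d : nat) (d_gt0 : (0 < d)%N) (s t kap : R) (a : algorithm).
Hypothesis t_gt0 : 0 < t.
Hypothesis ts : t < s.
Hypothesis s_lt1 : s < 1.
Hypothesis kap_gt0 : 0 < kap.
Hypothesis kap_t : kap <= t.
Hypothesis kap_ts : 2 * kap <= s - t.
Hypothesis kap_s : 3 * kap <= 1 - s.
Notation B := {ffun 'I_d -> bool}.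
Notation I := 'I_(2 ^ d).-1.
Implicit Types (Q P E D F : seq B) (b e : B) (k : 'I_d) (x : Rspace R d).
Implicit Types f g : Rspace R d -> R.

(** The bound of [tame_bound] with [k = kap * M], plus the terms of one cube. *)
Definition bound_const : R := 6 + (2 * #|I|%:R + 8) * kap^-1 + #|I|%:R.

Lemma bound_const_ge0 : 0 <= bound_const.
Proof. by rewrite !addr_ge0 // mulr_ge0 ?addr_ge0 ?mulr_ge0 // invr_ge0 ltW. Qed.

Definition haar_comb g (r : seq (seq B * I)) : Rspace R d -> R^o :=
  \sum_(p <- r) haar_coef g p.1 p.2 *: haar_fun (R := R) p.1 p.2.

Lemma haar_combE g r x : haar_comb g r x = \sum_(p <- r) haar_coef g p.1 p.2 *
  haar_fun (R := R) p.1 p.2 x.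
Proof. by rewrite /haar_comb fct_sumE. Qed.

Definition sel_of (r : seq (seq B * I)) Q i := (Q, i) \in r.

Let i0 : I.
Proof. by apply: (@Ordinal _ 0); rewrite -subn1 subn_gt0 -{1}(expn0 2) ltn_exp2l. Qed.

Lemma norm1E g : L1 g -> nu g [::] = norm1 g.
Proof. by move=> hg; rewrite /nu /mass mean_root //; exact: L1_norm. Qed.

(** Each of the at most [#|I|] terms in the exceptional cube [E] has a coefficient
    bounded by the norm of [g]. *)
Lemma selection_bound g (r : seq (seq B * I)) sel E : L1 g -> uniq r ->
  settled (haar_coef g) kap sel -> (forall Q i, sel Q i -> sel_of r Q i) ->
  (forall Q i, sel_of r Q i -> sel Q i \/ Q = E) ->
    norm_le (haar_comb g r) (bound_const * norm1 g).
Proof.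
move=> hg ur st sub near; have normP := bound_rel_norm_le R d;
  have ex := expansion_L1 hg.
have n0 : 0 <= norm1 g by exact: norm1_ge0.
rewrite /haar_comb (bigID (fun p => sel p.1 p.2)) /=.
rewrite /bound_const mulrDl; apply: (norm_leD normP).
  pose L := undup (map fst r).
  have uL : uniq L by exact: undup_uniq.
  have selL Q i : sel Q i -> Q \in L.
    by move=> /sub h; rewrite mem_undup; apply/mapP; exists (Q, i).
  have -> : \sum_(p <- r | sel p.1 p.2) haar_coef g p.1 p.2 *: haar_fun (R := R) p.1
    p.2 =
      \sum_(Q <- L) \sum_(i | sel Q i) haar_coef g Q i *: haar_fun (R := R) Q i.
    transitivity (\sum_(p <- [seq (Q, i) | Q <- L, i <- enum I] | sel p.1 p.2)
        haar_coef g p.1 p.2 *: haar_fun (R := R) p.1 p.2).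
      rewrite -[LHS]big_filter -[RHS]big_filter; apply/perm_big/uniq_perm.
      - exact: filter_uniq.
      - apply/filter_uniq/allpairs_uniq => //; first exact: enum_uniq.
        by move=> [? ?] [? ?].
      - move=> [Q i]; rewrite !mem_filter /=; have [h|//] := boolP (sel Q i).
        rewrite [LHS](sub _ _ h); symmetry; apply/allpairsP; exists (Q, i).
        by rewrite /= mem_enum (selL _ _ h).
    rewrite big_mkcond big_allpairs_dep; apply: eq_bigr => Q _.
    by rewrite big_enum /= -big_mkcond.
  have [e|[M M0 tm]] := st.
    rewrite big1 => [|Q _]; last by rewrite big1 // => i; rewrite (negbTE (e _ _)).
    apply: (norm_le_weaken normP (norm_le0 normP));
      rewrite mulr_ge0 // addr_ge0 // mulr_ge0 ?addr_ge0 ?mulr_ge0 //.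
    by rewrite invr_ge0 ltW.
  have kM : kap * M <= M.
    by rewrite ger_pMl //; have := kap_t; have := ts; have := s_lt1; lra.
  have := tame_bound [ffun=> true] i0 normP ex (mulr_gt0 kap_gt0 M0) kM tm uL selL.
  rewrite norm1E // [M / _](_ : _ = kap^-1) //.
  by rewrite invfM mulrCA mulfV ?mulr1 // gt_eqF.
apply: (@norm_le_weaken _ _ _ normP _ (\sum_(p <- r | ~~ sel p.1 p.2) norm1 g)).
  apply: (norm_le_sum normP) => p _; apply: (norm_le_weaken normP).
    exact: (norm_leZ normP (haar_coef g p.1 p.2) (norm_le_h ex p.1 p.2)).
  by rewrite mulr1; exact: coef_le_norm1.
rewrite big_const_seq iter_addr_0 -[leLHS]mulr_natl ler_wpM2r // ler_nat -size_filter.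
rewrite -(size_map snd) cardE uniq_leq_size //; last by move=> i _; rewrite mem_enum.
rewrite map_inj_in_uniq; first exact: filter_uniq.
have inE' p : p \in [seq p <- r | ~~ sel p.1 p.2] -> p.1 = E.
  rewrite mem_filter => /andP[ns pr]; have [|h|//] := near p.1 p.2.
    by rewrite /sel_of -surjective_pairing.
  by rewrite h in ns.
by move=> [Q i] [Q' i'] /inE' /= -> /inE' /= -> ->.
Qed.

Lemma haar_coef_comb f r Q i : uniq r ->
  haar_coef (haar_comb f r) Q i = if sel_of r Q i then haar_coef f Q i else 0.
Proof.
move=> ur; transitivity (\sum_(p <- r) haar_coef f p.1 p.2 * ((p.1 == Q) && (p.2.+1
  == i.+1))%:R).
  rewrite /haar_coef /haar_comb fct_sumE coef_sum; last by move=> p _; apply: L1Z;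
    exact: L1_haar.
  apply: eq_bigr => p _; rewrite coefZ; last exact: L1_haar.
  by rewrite coef_haar //; exact: haar_index_ord.
rewrite (eq_bigr (fun p => if p == (Q, i) then haar_coef f Q i else 0)); last first.
  move=> [P j] _ /=; rewrite xpair_eqE eqSS.
  have -> : (nat_of_ord j == nat_of_ord i) = (j == i) by [].
  by case: (eqVneq P Q) => [->|_]; case: (eqVneq j i) => [->|_]; rewrite ?mulr1 ?mulr0.
rewrite -big_mkcond /= /sel_of; case: ifP => h.
  rewrite -big_filter; have -> : [seq p <- r | p == (Q, i)] = [:: (Q, i)].
    by apply: filter_pred1_uniq.
  by rewrite big_seq1.
by rewrite big_seq_cond big1 // => p /andP[pr /eqP e]; rewrite e h in pr.
Qed.

Lemma L1_haar_comb f r : L1 (haar_comb f r).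
Proof.
rewrite /haar_comb fct_sumE; apply: L1_sum => p _; apply: L1Z; exact: L1_haar.
Qed.

Lemma residue_comb f r : L1 f -> uniq r ->
  haar_coef (fun x => f x - haar_comb f r x) = residue (haar_coef f) (sel_of r).
Proof.
move=> hf ur; apply/funext => Q; apply/funext => i.
rewrite {1}/haar_coef coefB //; last exact: L1_haar_comb.
rewrite -[X in _ - X]/(haar_coef (haar_comb f r) Q i) haar_coef_comb // /residue.
by case: ifP => _; rewrite ?subrr ?subr0.
Qed.

Local Notation picked := (picked (@word_prec R d) s t).

Lemma picked_fresh f r M D E i : L1 f -> uniq r ->
  picked (residue (haar_coef f) (sel_of r)) M D E i -> (E, i) \notin r.
Proof.
move=> hf ur [loc big _]; apply/negP => h; move: big.
rewrite /residue /sel_of h normr0 leNgt mulr_gt0 //; exact: loc_gt0 loc.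
Qed.

Definition greedy_advance f r r' :=
  (r' = r /\ forall Q i, residue (haar_coef f) (sel_of r) Q i = 0) \/
  exists M D E i, picked (residue (haar_coef f) (sel_of r)) M D E i /\ r' = (E, i) :: r.

(** Since the selected pairs are never selected again, the coefficients of [f] used
    in the fourth step are those of the residual, and the run is recorded by a
    duplicate-free list that grows at its head. *)
Lemma greedy_comb f G : L1 f -> greedy a s t f G -> exists r : nat -> seq (seq B * I),
  [/\ r 0 = [::], forall m, uniq (r m), forall m, G m = haar_comb f (r m) &
      forall m, greedy_advance f (r m) (r m.+1)].
Proof.
move=> hf [G0 step].
pose repr m r := uniq r /\ G m = haar_comb f r.
have next : forall mr : nat * seq (seq B * I), exists r', repr mr.1 mr.2 ->
    repr mr.1.+1 r' /\ greedy_advance f mr.2 r'.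
  move=> [m r]; have [[ur e]|nr] := pselect (repr m r); last by exists r.
  have hG : L1 (G m) by rewrite e; exact: L1_haar_comb.
  have [[h0 eG]|[M [D [E [i [pk eG]]]]]] := greedy_stepP d_gt0 t_gt0 ts hf hG (step m).
    exists r => _; split; first by split; rewrite //= eG.
    by left; split => // Q i; rewrite -residue_comb // -(h0 Q i) e.
  have pk' : picked (residue (haar_coef f) (sel_of r)) M D E i by rewrite
    -residue_comb // -e.
  exists ((E, i) :: r) => _; split; last by right; exists M, D, E, i.
  split; first by rewrite /= ur (picked_fresh hf ur pk').
  by rewrite eG e /haar_comb big_cons /= addrC.
have [F hF] := choice next.
pose r := fix r m := if m is m'.+1 then F (m', r m') else [::].
have hr m : repr m (r m).
  elim: m => [|m IH]; last exact: (hF (m, r m) IH).1.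
  by split => //; rewrite G0 /haar_comb big_nil.
by exists r; split => // m; [case: (hr m)|case: (hr m)|exact: (hF (m, r m) (hr m)).2].
Qed.

Lemma sel_of_cons E i r : sel_of ((E, i) :: r) = select (sel_of r) E i.
Proof.
apply/funext => Q; apply/funext => l.
by rewrite /sel_of /select inE xpair_eqE orbC.
Qed.

Lemma greedy_settled f (r : nat -> seq (seq B * I)) :
  r 0 = [::] -> (forall m, greedy_advance f (r m) (r m.+1)) ->
  forall m, exists sel E, [/\ settled (haar_coef f) kap sel,
    forall Q i, sel Q i -> sel_of (r m) Q i &
    forall Q i, sel_of (r m) Q i -> sel Q i \/ Q = E].
Proof.
move=> r0 adv; apply: (run_near_settled (@word_prec_asym R d) t_gt0 ts kap_gt0 kap_t
  kap_ts kap_s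
  (sel := fun m => sel_of (r m))).
  by move=> Q i; rewrite /sel_of r0.
move=> m; have [[-> _]|[M [D [E [i [pk ->]]]]]] := adv m; first by left.
by right; exists M, D, E, i; rewrite sel_of_cons.
Qed.

Section Convergence.
Variables (f : Rspace R d -> R) (r : nat -> seq (seq B * I)).
Hypothesis hf : L1 f.
Hypothesis r0 : r 0 = [::].
Hypothesis ur : forall m, uniq (r m).
Hypothesis adv : forall m, greedy_advance f (r m) (r m.+1).

Let r_mono m m' p : (m <= m')%N -> p \in r m -> p \in r m'.
Proof.
move=> /subnK <- h; elim: (m' - m)%N => // l IH; rewrite addSn.
have [[-> _]//|[M [D [E [i [_ ->]]]]]] := adv (l + m).
by rewrite inE IH orbT.
Qed.

(* While [p] is not selected, all the selected coefficients are at least [t] times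
   its coefficient. They lie on finitely many levels, so there are finitely many of
   them, while the list grows at each step. *)
Let eventually_chosen p : haar_coef f p.1 p.2 != 0 ->
  exists N, forall m, (N <= m)%N -> p \in r m.
Proof.
move=> c0; have [[N hN]|never] := pselect (exists N, p \in r N).
  by exists N => m Nm; exact: r_mono hN.
have npr m : p \notin r m by apply/negP => h; apply: never; exists m.
have e0 : 0 < t * `|haar_coef f p.1 p.2| / 2 by rewrite divr_gt0 // mulr_gt0 ?normr_gt0.
have res m : residue (haar_coef f) (sel_of (r m)) p.1 p.2 = haar_coef f p.1 p.2.
  by rewrite /residue /sel_of -surjective_pairing (negbTE (npr m)).
have [n hn] := coef_small hf e0.
pose box := [seq (Q, i) | Q <- short_words d n, i <- enum I].
have inbox m : size (r m) = m /\ {subset r m <= box}.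
  elim: m => [|m [sm bm]]; first by rewrite r0.
  have [[_ /(_ p.1 p.2)]|[M [D [E [i [[loc big _] ->]]]]]] := adv m.
    by rewrite res => e; rewrite e eqxx in c0.
  split; first by rewrite /= sm.
  move=> q; rewrite inE => /predU1P[->|/bm//].
  apply/allpairsP; exists (E, i); rewrite /= mem_enum; split => //.
  rewrite mem_short_words ltnNge; apply/negP => nE.
  have := hn E i.+1 (haar_index_ord i) nE; apply/negP; rewrite -ltNge.
  apply: (@lt_le_trans _ _ (t * `|haar_coef f p.1 p.2|)).
    by rewrite ltr_pdivrMr // ltr_pMr ?ltr1n // mulr_gt0 ?normr_gt0.
  apply: (@le_trans _ _ (t * M)); first by rewrite ler_pM2l // -(res m);
    exact: loc_max loc _ _.
  apply: (le_trans big); rewrite /residue; case: ifP => _ //.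
  by rewrite normr0.
have [sz sub] := inbox (size box).+1.
by have := uniq_leq_size (ur _) sub; rewrite sz ltnn.
Qed.

Let eventually_all (l : seq (seq B * I)) : exists N, forall m, (N <= m)%N ->
  forall p, p \in l -> haar_coef f p.1 p.2 != 0 -> p \in r m.
Proof.
elim: l => [|p l [N hN]]; first by exists 0%N.
have [e|/eventually_chosen[N' hN']] := eqVneq (haar_coef f p.1 p.2) 0.
  exists N => m Nm q; rewrite inE => /predU1P[->|]; last exact: hN.
  by rewrite e eqxx.
exists (maxn N N') => m; rewrite geq_max => /andP[/hN h /hN' h'] q.
by rewrite inE => /predU1P[-> //|]; exact: h.
Qed.

(* The blocks of the levels below [n] telescope. *)
Let low_sum n x :
  \sum_(Q <- short_words d n) \sum_i haar_coef f Q i * haar_fun (R := R) Q i x =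
  cond_exp n f x - cube_avg f [::] x.
Proof.
have D Q : \sum_i haar_coef f Q i * haar_fun (R := R) Q i x =
    \sum_b cube_avg f (b :: Q) x - cube_avg f Q x.
  have := congr1 (fun u : Rspace R d -> R^o => u x) (haar_fun_sum Q hf).
  by rewrite /= !fct_sumE.
under eq_bigr do rewrite D.
elim: n => [|n IH]; first by rewrite big_nil /cond_exp big_seq1 subrr.
by rewrite /= big_cat /= IH sumrB -(sum_level_wordsS n (fun Q => cube_avg f Q x))
  /cond_exp addrA subrK.
Qed.

Let high_part n m : haar_comb f [seq p <- r m | (n <= size p.1)%N] =
  haar_comb (fun x => f x - cond_exp n f x) [seq p <- r m | (n <= size p.1)%N].
Proof.
rewrite /haar_comb big_seq [RHS]big_seq; apply: eq_bigr => p;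
  rewrite mem_filter => /andP[np _].
by rewrite /haar_coef coefB ?coef_cond_exp_high ?subr0 //;
  [exact: haar_index_ord|exact: L1_cond_exp].
Qed.

(** Late approximants contain all the nonzero terms of the levels below [n], whose sum
    is [cond_exp n f - mean f]. The remainder is then [f - cond_exp n f] minus a
    partial sum of its own Haar series, over the tail of a nearly tame set. *)
Lemma greedy_cvg_comb (eps : R) : 0 < eps -> exists N, forall m, (N <= m)%N ->
  norm1 (fun x => f x - (mean f + haar_comb f (r m) x)) <= eps.
Proof.
move=> e0; have C0 : 0 < 1 + bound_const by have := bound_const_ge0; lra.
have [n hn] := norm1_cond_exp_small hf (divr_gt0 e0 C0).
set g := (fun x => f x - cond_exp n f x) in hn.
have hg : L1 g by apply: L1B => //; exact: L1_cond_exp.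
have [N hN] := eventually_all [seq (Q, i) | Q <- short_words d n, i <- enum I].
exists N => m /hN low.
set high := [seq p <- r m | (n <= size p.1)%N].
have cg : haar_coef g = tail_coef n (haar_coef f).
  apply/funext => Q; apply/funext => i; rewrite /tail_coef /haar_coef coefB //;
    last exact: L1_cond_exp.
  by case: leqP => h; [rewrite coef_cond_exp_high ?subr0 //;
    exact: haar_index_ord|rewrite coef_cond_exp_low // subrr].
have [sel [E [st sub near]]] := greedy_settled r0 adv m.
have [hh hhC] : norm_le (haar_comb g high) (bound_const * norm1 g).
  apply: (@selection_bound _ _ (tail_sel n sel) E) => //; first exact: filter_uniq.
  - by rewrite cg; exact: settled_tail.
  - by move=> Q i /andP[nQ /sub h]; rewrite /sel_of mem_filter /= nQ.
  - move=> Q i; rewrite /sel_of mem_filter /= => /andP[nQ /near[h|->]]; last by right.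
    by left; rewrite /tail_sel nQ.
have splitG x : haar_comb f (r m) x = cond_exp n f x - cube_avg f [::] x + haar_comb
  g high x.
  rewrite -high_part !haar_combE (bigID (fun p => (n <= size p.1)%N)) /=.
  rewrite addrC -[X in _ + X = _]big_filter; congr (_ + _).
  rewrite -low_sum; transitivity (\sum_(p <- [seq (Q, i) | Q <- short_words d n,
    i <- enum I])
      haar_coef f p.1 p.2 * haar_fun (R := R) p.1 p.2 x); last first.
    by rewrite big_allpairs_dep; apply: eq_bigr => Q _; rewrite big_enum.
  rewrite [RHS](bigID (fun p => p \in r m)) /= [X in _ = _ + X]big_seq_cond [X in _ =
    _ + X]big1; last first.
    by move=> p /andP[pl pr]; case: (eqVneq (haar_coef f p.1 p.2) 0) => [->|/(low p
      pl) h];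
      rewrite ?mul0r // h in pr *.
  rewrite addr0 -[LHS]big_filter -[RHS]big_filter; apply/perm_big/uniq_perm.
  - exact: filter_uniq.
  - apply/filter_uniq/allpairs_uniq; [exact: short_words_uniq|exact: enum_uniq|].
    by move=> [? ?] [? ?].
  - move=> [Q i]; rewrite !mem_filter /= andbC; congr (_ && _).
    rewrite -ltnNge -mem_short_words;
      apply/idP/allpairsP => [h|[[Q' i'] /= [h _ [-> _]]] //].
    by exists (Q, i); rewrite /= h mem_enum.
have hu : L1 (fun x => f x - (mean f + haar_comb f (r m) x)).
  by apply: L1B => //; apply: L1D; [exact: L1_cst|exact: L1_haar_comb].
have hv : L1 (fun x => g x + -1 * haar_comb g high x) by apply: L1D => //; exact: L1Z.
have e : norm1 (fun x => (f x - (mean f + haar_comb f (r m) x)) + -1 * (g x + -1 *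
  haar_comb g high x)) = 0.
  apply: norm1_null; last by apply: L1D => //; exact: L1Z.
  move=> x x0; rewrite splitG /cube_avg /mass mean_root // /inv_vol muln0 expr0
    cube_indE mem_set // /g !mulr1.
  have alg (u v w z : R) : u - (v + (w - v + z)) + -1 * (u - w + -1 * z) = 0 by ring.
  exact: alg.
have h1 := norm1D (L1D hu (L1Z (-1) hv)) hv.
have h2 := norm1D hg (L1Z (-1) hh); have h3 := norm1Z (-1) hh.
rewrite normrN1 mul1r in h3; rewrite e add0r in h1.
have e1 : norm1 (fun x => f x - (mean f + haar_comb f (r m) x)) =
    norm1 (fun x => (f x - (mean f + haar_comb f (r m) x) + -1 * (g x + -1 *
      haar_comb g high x)) +
      (g x + -1 * haar_comb g high x)).
  by congr norm1; apply/funext => x; ring.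
rewrite e1; apply: (le_trans h1); apply: (le_trans h2).
have h4 : norm1 g * (1 + bound_const) <= eps by rewrite -ler_pdivlMr.
have h5 : norm1 (haar_comb g high) <= bound_const * norm1 g by exact: hhC.
lra.
Qed.
End Convergence.
End Final.

Theorem mainTheorem1 (R : realType) (d : nat) (s t : R) (a : algorithm) :
  (1 <= d)%N -> 0 < t -> t < s -> s < 1 ->
  (forall f : Rspace R d -> R, L1 f ->
     (exists G : nat -> Rspace R d -> R, greedy a s t f G) /\
     (forall G : nat -> Rspace R d -> R, greedy a s t f G ->
        L1norm (fun x => f x - (mean f + G m x)) @[m --> \oo] --> 0%E)) /\
  (exists C : R, forall f : Rspace R d -> R, L1 f ->
     forall G : nat -> Rspace R d -> R, greedy a s t f G ->
     forall m : nat, (1 <= m)%N -> (L1norm (G m) <= C%:E * L1norm f)%E).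
Proof.
move=> d0 t0 ts s1.
pose kap := Num.min ((s - t) / 2) (Num.min ((1 - s) / 3) t).
have k0 : 0 < kap by rewrite !lt_min !divr_gt0 ?subr_gt0 ?t0.
have kt : kap <= t by rewrite !ge_min lexx !orbT.
have kts : 2 * kap <= s - t by rewrite mulrC -ler_pdivlMr // ge_min lexx.
have ks : 3 * kap <= 1 - s by rewrite mulrC -ler_pdivlMr // !ge_min lexx orbT.
split => [f hf|].
  split; first exact: greedy_ex.
  move=> G gr; have [r [r0 ur eG adv]] := greedy_comb d0 t0 ts hf gr.
  have hm m : L1 (fun x => f x - (mean f + G m x)).
    by rewrite eG; apply: L1B => //; apply: L1D; [exact: L1_cst|exact: L1_haar_comb].
  apply/fine_cvgP; split; first by near=> m; rewrite L1normE.
  apply/cvgrPdist_le => eps e0.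
  have [N hN] := greedy_cvg_comb d0 t0 ts s1 k0 kt kts ks hf r0 ur adv e0.
  exists N => // m /= /hN; rewrite -eG L1normE //= sub0r normrN ger0_norm //.
  exact: norm1_ge0.
exists (bound_const d kap) => f hf G gr m _.
have [r [r0 ur eG adv]] := greedy_comb d0 t0 ts hf gr.
have [sel [E [st sub near]]] := greedy_settled t0 ts k0 kt kts ks r0 adv m.
have [h1 h2] := selection_bound d0 ts s1 k0 kt hf (ur m) st sub near.
by rewrite eG L1normE // [X in (_ <= _ * X)%E]L1normE // -EFinM lee_fin.
Unshelve. all: by end_near.
Qed.
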